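(* Consider the linear model $y_i=x_i^T\beta^*+\epsilon_i$, $i=1,\dots,n$, with $\beta^*\in\mathbb{R}^p$ $k$-sparse with support $S$, and the program $$\min_{\|\beta\|_1\le R}\Big\{\tfrac12\beta^T\tfrac{X^TX}{n}\beta-\tfrac{y^TX}{n}\beta+\rho_\lambda(\beta)\Big\}. \qquad (P)$$ There are positive constants $c_0,c_1,c_2,c_3,c_\ell,c_u$ (not depending on $n,p,k$) such that the following holds. Suppose $X$ and $\epsilon$ are sub-Gaussian, $n\ge c_0k\log p$, and $(\lambda,R)$ are chosen such that $\|\beta^*\|_1\le\frac R2$ and $c_\ell\sqrt{\frac{\log p}{n}}\le\lambda\le\frac{c_u}{R}$. Also suppose the sample covariance matrix $\widehat\Gamma=\frac{X^TX}{n}$ satisfies $|||\widehat\Gamma_{SS}^{-1}|||_\infty\le c_\infty$. (a) Suppose $\rho_\lambda$ is $\mu$-amenable with $\mu<\lambda_{\min}(\Sigma_x)$, and $\widehat\Gamma$ also satisfies the incoherence condition $|||\widehat\Gamma_{S^cS}\widehat\Gamma_{SS}^{-1}|||_\infty\le\eta<1$. Then with probability at least $1-c_1\exp(-c_2\min\{k,\log p\})$, the program $(P)$ has a unique stationary point $\hat\beta$ (corresponding to the global optimum); furthermore $\mathrm{supp}(\hat\beta)\subseteq\mathrm{supp}(\beta^* )$ and $$\|\hat\beta-\beta^*\|_\infty\le c_3\sqrt{\tfrac{\log p}{n}}+c_\infty\lambda.$$ (b) Suppose $\rho_\lambda$ is $(\mu,\gamma)$-amenable with $\mu<\lambda_{\min}(\Sigma_x)$,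 and $$\min_{j\in S}|\beta^*_j|\ge\lambda(\gamma+c_\infty)+c_3\sqrt{\tfrac{\log p}{n}}.$$ Then with probability at least $1-c_1\exp(-c_2\min\{k,\log p\})$, the program $(P)$ has a unique stationary point $\hat\beta$, given by the oracle estimator $\hat\beta^{\mathcal{O}}$, and $$\|\hat\beta-\beta^*\|_\infty\le c_3\sqrt{\tfrac{\log p}{n}}.$$
   Context: The pairs $(x_i,y_i)\in\mathbb{R}^p\times\mathbb{R}$ are i.i.d.; $X\in\mathbb{R}^{n\times p}$ has rows $x_i^T$; $y=(y_i)$, $\epsilon=(\epsilon_i)$; $\Sigma_x=\mathrm{Cov}(x_i)$; $\lambda_{\min}$ denotes the smallest eigenvalue. ''Sub-Gaussian'' means that the $x_i$ are i.i.d. zero-mean sub-Gaussian random vectors and the $\epsilon_i$ are i.i.d. zero-mean sub-Gaussian, independent of $X$; the constants may depend on the sub-Gaussian parameters and other fixed problem parameters, but not on $n,p,k$. $S=\mathrm{supp}(\beta^* )$, $k$-sparse means $|S|\le k$; $M_{AB}$ denotes the submatrix with rows in $A$, columns in $B$; $|||M|||_\infty$ is the $\ell_\infty$-operator norm (maximum absolute row sum). The penalty is coordinate-separable: $\rho_\lambda(\beta)=\sum_{j=1}^p\rho_\lambda(\beta_j)$ for a continuous univariate $\rho_\lambda$. It is $\mu$-amenable ($\mu\ge 0$) if: (i) $\rho_\lambda(t)=\rho_\lambda(-t)$ for all $t$ and $\rho_\lambda(0)=0$; (ii) $\rho_\lambda$ is nondecreasing on $\mathbb{R}^+$; (iii)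 $t\mapsto\rho_\lambda(t)/t$ is nonincreasing on $\mathbb{R}^+$ ($t>0$); (iv) $\rho_\lambda$ is differentiable at every $t\ne 0$; (v) $t\mapsto\rho_\lambda(t)+\frac{\mu}{2}t^2$ is convex; (vi) $\lim_{t\to0^+}\rho_\lambda'(t)=\lambda$. It is $(\mu,\gamma)$-amenable if in addition (vii) $\gamma\in(0,\infty)$ and $\rho_\lambda'(t)=0$ for all $t\ge\gamma\lambda$. Let $\mathcal{L}_n(\beta)=\frac12\beta^T\frac{X^TX}{n}\beta-\frac{y^TX}{n}\beta$. A stationary point of $(P)$ is a feasible $\tilde\beta$ such that $\langle\nabla\mathcal{L}_n(\tilde\beta)+\nabla\rho_\lambda(\tilde\beta),\beta-\tilde\beta\rangle\ge0$ for all feasible $\beta$, where $\langle\nabla\rho_\lambda(\tilde\beta),\beta-\tilde\beta\rangle:=\lim_{t\to0^+}\langle\nabla\rho_\lambda(\tilde\beta+t(\beta-\tilde\beta)),\beta-\tilde\beta\rangle$. Oracle estimator: $\hat\beta^{\mathcal{O}}=(\hat\beta^{\mathcal{O}}_S,0_{S^c})$ with $\hat\beta^{\mathcal{O}}_S=\arg\min_{\beta_S\in\mathbb{R}^S}\mathcal{L}_n(\beta_S,0_{S^c})$. *)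

(* Defs.v *)
From HB Require Import structures.
From mathcomp Require Export all_boot all_order all_algebra.
From mathcomp Require Export all_classical all_reals all_analysis.

Export Order.TTheory GRing.Theory Num.Theory.
Export numFieldNormedType.Exports.

Set Implicit Arguments.
Unset Strict Implicit.
Unset Printing Implicit Defensive.

Local Open Scope classical_set_scope.
Local Open Scope ring_scope.

Section Probability.
Context {R : realType} {d : measure_display} {Omega : measurableType d}.
Context (P : probability Omega R).

Definition borel (T : topologicalType) : set (set T) :=
  <<s [set U : set T | open U] >>.

Definition random_element (T : topologicalType) (Z : Omega -> T) : Prop :=
  forall B : set T, borel B -> measurable (Z @^-1` B).

(* The product rule for finite subfamilies is included: take [B i = setT]
   for the other indices. *)
Definition mutually_independent (I : finType) (T : topologicalType)
    (Z : I -> Omega -> T) : Prop :=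
  forall B : I -> set T, (forall i, borel (B i)) ->
    P (\bigcap_(i in [set: I]) (Z i @^-1` B i)) = (\prod_i P (Z i @^-1` B i))%E.

Definition identically_distributed (I : Type) (T : topologicalType)
    (Z : I -> Omega -> T) : Prop :=
  forall (i j : I) (B : set T), borel B -> P (Z i @^-1` B) = P (Z j @^-1` B).

Definition iid (I : finType) (T : topologicalType) (Z : I -> Omega -> T) : Prop :=
  [/\ forall i, random_element (Z i), mutually_independent Z
    & identically_distributed Z].

Definition independent (T T' : topologicalType)
    (Z : Omega -> T) (Z' : Omega -> T') : Prop :=
  forall (B : set T) (B' : set T'), borel B -> borel B' ->
    P (Z @^-1` B `&` Z' @^-1` B') = (P (Z @^-1` B) * P (Z' @^-1` B'))%E.

Definition zero_mean_subgaussian (sigma : R) (Z : Omega -> R) : Prop :=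
  ('E_P[Z] = 0)%E /\
  forall t : R, (mmt_gen_fun P Z t <= (expR (sigma ^+ 2 * t ^+ 2 / 2))%:E)%E.

Definition zero_mean_subgaussian_vector (p : nat) (sigma : R)
    (x : Omega -> 'rV[R]_p) : Prop :=
  forall u : 'cV[R]_p, \sum_j u j 0 ^+ 2 = 1 ->
    zero_mean_subgaussian sigma (fun w => (x w *m u) 0 0).

Definition covariance_mx (p : nat) (x : Omega -> 'rV[R]_p) : 'M[R]_p :=
  \matrix_(j, l) fine (covariance P (fun w => x w 0 j) (fun w => x w 0 l)).

Definition subgaussian_design (n p : nat) (sigma : R)
    (X : Omega -> 'M[R]_(n, p)) : Prop :=
  iid (fun i w => row i (X w)) /\
  forall i, zero_mean_subgaussian_vector sigma (fun w => row i (X w)).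

Definition subgaussian_noise (n : nat) (sigma : R)
    (eps : Omega -> 'cV[R]_n) : Prop :=
  iid (fun i w => eps w i 0) /\
  forall i, zero_mean_subgaussian sigma (fun w => eps w i 0).

(* [E] itself need not be measurable. *)
Definition with_probability_at_least (q : R) (E : set Omega) : Prop :=
  exists A : set Omega, [/\ measurable A, A `<=` E & (q%:E <= P A)%E].

End Probability.

Section Matrices.
Context {R : realType}.

(* For a symmetric matrix of positive size the infimum is attained. *)
Definition lambda_min (p : nat) (A : 'M[R]_p) : R := inf [set a | eigenvalue A a].

Definition opnorm_inf (m n : nat) (M : 'M[R]_(m, n)) : R :=
  \big[Num.max/0]_(i < m) \sum_(j < n) `|M i j|.

Definition submx_of (m n : nat) (A : {set 'I_m}) (B : {set 'I_n})
    (M : 'M[R]_(m, n)) : 'M[R]_(#|A|, #|B|) :=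
  \matrix_(i, j) M (enum_val i) (enum_val j).

Definition supp (p : nat) (b : 'cV[R]_p) : {set 'I_p} := [set j | b j 0 != 0]%SET.

(* The l_infinity norm of a vector is the library norm [`|b|] of matrices,
   that is, the maximum of the absolute values of the entries. *)
Definition l1norm (p : nat) (b : 'cV[R]_p) : R := \sum_j `|b j 0|.

Definition dot (p : nat) (u v : 'cV[R]_p) : R := \sum_j u j 0 * v j 0.

(* Where a partial derivative does not exist the entry is an unspecified real. *)
Definition grad (p : nat) (f : 'cV[R]_p -> R) (b : 'cV[R]_p) : 'cV[R]_p :=
  \col_j 'D_(delta_mx j 0) f b.

End Matrices.

Section Penalty.
Context {R : realType}.

Definition amenable (mu lam : R) (rho : R -> R) : Prop :=
  continuous rho /\
  [/\ (forall t, rho (- t) = rho t) /\ rho 0 = 0,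
      forall s t, 0 <= s -> s <= t -> rho s <= rho t,
      forall s t, 0 < s -> s <= t -> rho t / t <= rho s / s &
      forall t, t != 0 -> derivable rho t 1] /\
  convex_function [set: convex_lmodType R^o]
    (fun t : R => rho t + mu / 2 * t ^+ 2) /\
  derive1 rho t @[t --> 0^'+] --> lam.

Definition amenable_gamma (mu gam lam : R) (rho : R -> R) : Prop :=
  [/\ amenable mu lam rho, 0 < gam & forall t, gam * lam <= t -> derive1 rho t = 0].

Definition penalty (p : nat) (rho : R -> R) (b : 'cV[R]_p) : R :=
  \sum_j rho (b j 0).

End Penalty.

Section Program.
Context {R : realType}.

Definition sample_cov (n p : nat) (X : 'M[R]_(n, p)) : 'M[R]_p :=
  n%:R^-1 *: (X^T *m X).

Definition loss (n p : nat) (X : 'M[R]_(n, p)) (y : 'cV[R]_n) (b : 'cV[R]_p) : R :=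
  2^-1 * (b^T *m sample_cov X *m b) 0 0 - (n%:R^-1 *: (y^T *m X) *m b) 0 0.

Definition feasible (p : nat) (Rad : R) (b : 'cV[R]_p) : Prop := l1norm b <= Rad.

(* When [b j 0 = b' j 0 = 0] the [j]-th partial derivative of the penalty
   along the segment is unspecified, but it is multiplied by zero. *)
Definition penalty_slope (p : nat) (rho : R -> R) (b v : 'cV[R]_p) : R :=
  lim (dot (grad (penalty rho) (b + t *: v)) v @[t --> 0^'+]).

Definition stationary (n p : nat) (X : 'M[R]_(n, p)) (y : 'cV[R]_n)
    (rho : R -> R) (Rad : R) (b : 'cV[R]_p) : Prop :=
  feasible Rad b /\
  forall b', feasible Rad b' ->
    0 <= dot (grad (loss X y) b) (b' - b) + penalty_slope rho b (b' - b).

Definition global_optimum (n p : nat) (X : 'M[R]_(n, p)) (y : 'cV[R]_n)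
    (rho : R -> R) (Rad : R) (b : 'cV[R]_p) : Prop :=
  feasible Rad b /\
  forall b', feasible Rad b' ->
    loss X y b + penalty rho b <= loss X y b' + penalty rho b'.

(* Vectors [(b_S, 0)] are represented as full vectors supported in [S]. *)
Definition oracle (n p : nat) (X : 'M[R]_(n, p)) (y : 'cV[R]_n)
    (S : {set 'I_p}) (b : 'cV[R]_p) : Prop :=
  supp b \subset S /\
  forall b' : 'cV[R]_p, supp b' \subset S -> loss X y b <= loss X y b'.

Definition inverse_bounded (p : nat) (S : {set 'I_p}) (cinf : R)
    (G : 'M[R]_p) : Prop :=
  submx_of S S G \in unitmx /\ opnorm_inf (invmx (submx_of S S G)) <= cinf.

Definition incoherent (p : nat) (S : {set 'I_p}) (eta : R) (G : 'M[R]_p) : Prop :=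
  opnorm_inf (submx_of (~: S)%SET S G *m invmx (submx_of S S G)) <= eta.

End Program.

(* Main.v *)
(* Maurey's empirical method reduces the restricted strong convexity
   [v^T Ghat v >= alpha |v|_2^2 - T |v|_1^2], with [T] of order [ln p / n], to
   finitely many averages of signed coordinate vectors, for each of which the
   quadratic form has a sub-exponential lower tail.  Given [X], the three noise
   vectors (of the oracle error, of the dual certificate outside [S], and
   [X^T eps / n] itself) are linear in [eps] with row energies [O(1 / n)], so they
   are [O(sqrt (ln p / n))] with high probability.

   On this event a primal-dual witness is built: a minimizer over the vectors of
   the l1-ball supported in [S] (part (a)), or the oracle (part (b)).  In part (a)
   the l1-constraint is inactive at the minimizer by a coordinatewise growth
   inequality for the penalty.  Strict dual feasibility outside [S] together with
   restricted strong convexity makes the witness stationary, globally optimal, and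
   the only stationary point, since [rho + mu t^2 / 2] is convex and
   [mu < alpha - 2 k T]. *)

(* The obstacle is the l1 term of restricted strong convexity, which need not be small on
   differences of feasible points. Its part on [S] costs curvature of order [k * T]; its part
   outside [S] becomes linear in the l1 mass there, because that mass is at most [2 * Rad]. Half of
   the slack [2 * dl] in strict dual feasibility pays for it, and this is where [lam <= cu / Rad]
   enters, [T] being of order ln p / n. The noise in the dual certificate is bounded without
   incoherence: it acts through the residuals of the columns outside [S] after projection onto those
   in [S], which are no longer than the columns themselves. In part (b) the penalty contributes
   nothing on [S], so this noise is the whole certificate. Independence of [X] and [eps] is given on
   Borel sets, whereas inverse matrices are handled entry by entry; a coordinate sigma-algebra on
   matrices joins the two views. The bad events have total probability at most [8 * expR (- ln p)],
   which is within the bound with exponent [min k (ln p)]. *)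
From HB Require Import structures.
Require Import Defs.
From mathcomp Require Import measurable_realfun ring lra.
Set Implicit Arguments.
Unset Strict Implicit.
Unset Printing Implicit Defensive.
Local Open Scope classical_set_scope.
Local Open Scope ring_scope.

(** * Amenable penalties *)

Section Limits.
Context {R : realType}.

Lemma cvg_at_right_epsP (f : R -> R) (a l : R) : f t @[t --> a^'+] --> l <->
  forall e, 0 < e ->
    exists2 r, 0 < r & forall h, 0 < h -> h < r -> `|f (a + h) - l| <= e.
Proof.
split=> [fl e e0|H].
  have /cvgrPdist_le/(_ e e0)/= := fl.
  case=> r /= r0 hr; exists r => // h h0 hr'.
  rewrite distrC; apply: hr; last by rewrite ltrDl.
  by rewrite /ball_/= opprD addrA subrr sub0r normrN gtr0_norm.
apply/cvgrPdist_le => /= e e0; have [r r0 hr] := H e e0.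
exists r => //= x; rewrite /ball_/= distrC => xr ax.
rewrite distrC (_ : x = a + (x - a)); last by ring.
by apply: hr; rewrite ?subr_gt0// -[X in X < _]gtr0_norm ?subr_gt0.
Qed.

(** The difference quotient is multiplied out, so that [h = 0] is allowed and the later estimates
    remain linear. *)
Lemma derivable_eps (f : R -> R) (a : R) : derivable f a 1 ->
  forall e, 0 < e -> exists2 r, 0 < r & forall h, `|h| < r ->
    `|f (a + h) - f a - h * derive1 f a| <= e * `|h|.
Proof.
move=> fa e e0.
have : h^-1 *: (f (h + a) - f a) @[h --> 0^'] --> derive1 f a.
  rewrite derive1E; move: fa; rewrite /derivable /derive.
  set d := (fun _ : R => _); set d' := (fun _ : R => _).
  suff -> : d = d' by [].
  by rewrite funeqE => h; rewrite /d /d' /= [h%:A]mulr1.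
move/cvgrPdist_le => /(_ e e0) [r /= r0 hr]; exists r => // h hlt.
have [->|h0] := eqVneq h 0; first by rewrite addr0 subrr mul0r subr0 normr0 mulr0.
have := hr h; rewrite /ball_/= sub0r normrN => /(_ hlt h0).
rewrite distrC => {}hr.
have -> : f (a + h) - f a - h * derive1 f a
  = h * (h^-1 * (f (h + a) - f a) - derive1 f a).
  by rewrite (addrC h a); field.
by rewrite normrM mulrC ler_wpM2r.
Qed.

Lemma ler_addeps_scale (x y c : R) :
  (forall e, 0 < e -> x <= y + e * c) -> x <= y.
Proof.
move=> H; apply/ler_addgt0Pr => e e0.
have c0 : 0 < `|c| + 1 by rewrite ltr_wpDl.
have := H (e / (`|c| + 1)) (divr_gt0 e0 c0) => /le_trans; apply.
rewrite lerD2l -mulrA ler_piMr ?(ltW e0)// mulrC ler_pdivrMr// mul1r.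
by rewrite (le_trans (ler_norm c))// lerDl.
Qed.

End Limits.

Section AmenablePenalty.
Context {R : realType} (mu lam : R) (rho : R -> R).
Hypotheses (mu0 : 0 <= mu) (am : amenable mu lam rho).

Let rho_cont : continuous rho. Proof. by case: am. Qed.
Let rho_even t : rho (- t) = rho t. Proof. by case: am => _ [[[]]]. Qed.
Let rho0 : rho 0 = 0. Proof. by case: am => _ [[[]]]. Qed.
Let rho_mono s t : 0 <= s -> s <= t -> rho s <= rho t.
Proof. by case: am => _ [[_ H _ _] _]; exact: H. Qed.
Let rho_star s t : 0 < s -> s <= t -> rho t / t <= rho s / s.
Proof. by case: am => _ [[_ _ H _] _]; exact: H. Qed.
Let rho_der t : t != 0 -> derivable rho t 1.
Proof. by case: am => _ [[_ _ _ H] _]; exact: H. Qed.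

Lemma penalty_abs t : rho `|t| = rho t.
Proof. by case: (ler0P t) => _; rewrite ?rho_even. Qed.

Let rho_convex x y t : 0 <= t -> t <= 1 ->
  rho (t * x + (1 - t) * y) + mu / 2 * (t * x + (1 - t) * y) ^+ 2 <=
  t * (rho x + mu / 2 * x ^+ 2) + (1 - t) * (rho y + mu / 2 * y ^+ 2).
Proof.
move=> t0 t1; case: am => _ [_ [cvx _]].
(* [convex_function] takes its weights in a type of interval elements, so [t] is packaged as one. *)
have ht : Itv.spec (@Itv.num_sem R) (Itv.Real `[0, 1]%Z) t.
  rewrite /Itv.spec /= /Itv.num_sem /= in_itv/= t0 t1.
  by rewrite ger0_real.
have := cvx (Itv.mk ht) x y (mem_set I) (mem_set I).
by rewrite convRE.
Qed.

Let rho_mvt s : 0 < s -> exists2 c, 0 < c < s & rho s = derive1 rho c * s.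
Proof.
move=> s0; have [] := @MVT R rho (derive1 rho) 0 s s0.
- move=> x; rewrite in_itv/= => /andP[x0 _]; apply: DeriveDef.
    by apply: rho_der; rewrite gt_eqF.
  by rewrite derive1E.
- exact: continuous_subspaceT.
- move=> c; rewrite in_itv/= => cs; rewrite rho0 !subr0 => ->.
  by exists c.
Qed.

Let rho'0 e : 0 < e -> exists2 r, 0 < r & forall h, 0 < h -> h < r ->
  `|derive1 rho h - lam| <= e.
Proof.
case: am => _ [_ [_ /cvg_at_right_epsP H]] => e0; have [r r0 hr] := H e e0.
by exists r => // h h0 hlt; have := hr h h0 hlt; rewrite add0r.
Qed.

(** The quotient [rho t / t] is nonincreasing, hence at most its limit at 0; by the mean value
    theorem on a short interval that limit is the one of the derivative, [lam]. *)
Lemma penalty_le t : rho t <= lam * `|t|.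
Proof.
rewrite -penalty_abs; have [->|t0] := eqVneq t 0.
  by rewrite normr0 rho0 mulr0.
have {t0}: 0 < `|t| by rewrite normr_gt0.
move: `|t| => {}t t0.
apply: (@ler_addeps_scale _ _ _ t) => e e0; have [r r0 hr] := rho'0 e0.
pose s := Num.min t r.
have s0 : 0 < s by rewrite lt_min t0.
have [c /andP[c0 cs] rs] := rho_mvt s0.
have := hr c c0; rewrite (lt_le_trans cs) ?ge_min ?lexx ?orbT// => /(_ isT).
move=> /ler_normlP[_ cl].
have := rho_star s0 (_ : s <= t); rewrite ge_min lexx => /(_ isT).
rewrite rs mulfK ?gt_eqF// ler_pdivrMr// => /le_trans; apply.
by rewrite -mulrDl ler_pM2r//; lra.
Qed.

Lemma amenable_level_ge0 : 0 <= lam.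
Proof.
have := penalty_le 1; rewrite normr1 mulr1; apply: le_trans.
by rewrite -{1}rho0; exact: rho_mono.
Qed.

(** Mirror image of [penalty_le]: the function on the right is convex and vanishes at 0, so its
    quotient by [b] is nondecreasing and at least its limit [lam] at 0. *)
Let penalty_ge_pos b : 0 <= b -> lam * b <= rho b + mu / 2 * b ^+ 2.
Proof.
rewrite le_eqVlt => /orP[/eqP<-|b0]; first by rewrite rho0 expr0n/= !mulr0 addr0.
apply: (@ler_addeps_scale _ _ _ b) => e e0; have [r r0 hr] := rho'0 e0.
pose s := Num.min b r.
have s0 : 0 < s by rewrite lt_min b0.
have sb : s <= b by rewrite ge_min lexx.
have [c /andP[c0 cs] rs] := rho_mvt s0.
have := hr c c0; rewrite (lt_le_trans cs) ?ge_min ?lexx ?orbT// => /(_ isT).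
move=> /ler_normlP[cl _].
have t0 : 0 <= s / b by rewrite divr_ge0// ltW.
have t1 : s / b <= 1 by rewrite ler_pdivrMr// mul1r.
have := rho_convex b 0 t0 t1.
rewrite mulr0 addr0 rho0 expr0n/= mulr0 addr0 mulr0 addr0.
rewrite mulfVK ?gt_eqF// rs => H.
have H2 : (lam - e) * s <= s / b * (rho b + mu / 2 * b ^+ 2).
  apply: le_trans H; apply: (@le_trans _ _ (derive1 rho c * s)).
    by rewrite ler_pM2r//; lra.
  by rewrite lerDl mulr_ge0 ?sqr_ge0// divr_ge0.
have : (lam - e) * b <= rho b + mu / 2 * b ^+ 2.
  rewrite -(@ler_pM2l _ (s / b)) ?divr_gt0//.
  apply: le_trans H2; rewrite [leLHS](_ : _ = (lam - e) * s)//.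
  by field; rewrite gt_eqF.
lra.
Qed.

Lemma penalty_ge b : lam * `|b| <= rho b + mu / 2 * b ^+ 2.
Proof. by rewrite -(penalty_abs b) -[b ^+ 2]real_normK ?num_real// penalty_ge_pos. Qed.

(** By convexity the chord from [a] to [b] is at least as steep as the chord from 0 to [a], whose
    slope is at least [lam] by [penalty_ge_pos]. *)
Lemma penalty_increment a b : 0 <= a -> a <= b ->
  lam * (b - a) <= rho b + mu / 2 * b ^+ 2 - (rho a + mu / 2 * a ^+ 2).
Proof.
rewrite le_eqVlt => /orP[/eqP<-|a0] ab.
  by rewrite rho0 expr0n/= mulr0 addr0 !subr0 penalty_ge_pos.
have b0 : 0 < b by exact: lt_le_trans ab.
have t0 : 0 <= a / b by rewrite divr_ge0// ltW.
have t1 : a / b <= 1 by rewrite ler_pdivrMr// mul1r.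
have := rho_convex b 0 t0 t1.
rewrite mulr0 addr0 rho0 expr0n/= mulr0 addr0 mulr0 addr0 mulfVK ?gt_eqF//.
have := penalty_ge_pos (ltW a0).
move: (rho a + _) (rho b + _) => ga gb h1; rewrite mulrAC ler_pdivlMr// => h2.
have h3 : lam * a * b <= ga * b by rewrite ler_pM2r.
rewrite -(@ler_pM2l _ a)//.
have h4 : (lam * a) * (b - a) <= ga * (b - a) by rewrite ler_wpM2r// subr_ge0.
by apply: (@le_trans _ _ (ga * (b - a))); [rewrite mulrCA mulrA//; lra|lra].
Qed.

(** Since [rho a >= a * (rho b / b)], the increment is at most [(rho b / b) * (b - a)], and
    [penalty_le] bounds the quotient by [lam]. *)
Lemma penalty_decrement a b : 0 <= a -> a <= b -> rho b - rho a <= lam * (b - a).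
Proof.
rewrite le_eqVlt => /orP[/eqP<-|a0] ab.
  by rewrite rho0 !subr0 (le_trans (penalty_le b))// ger0_norm.
have b0 : 0 < b by exact: lt_le_trans ab.
have := rho_star a0 ab; rewrite ler_pdivlMr// => h.
have h2 : rho b / b <= lam.
  by rewrite ler_pdivrMr// (le_trans (penalty_le b))// gtr0_norm.
apply: (@le_trans _ _ (rho b / b * (b - a))); last by rewrite ler_wpM2r// subr_ge0.
by rewrite mulrBr mulfVK ?gt_eqF//; lra.
Qed.

Lemma penalty_lipschitz a b : `|rho a - rho b| <= lam * `|a - b|.
Proof.
have H x y : 0 <= x -> x <= y -> `|rho x - rho y| <= lam * `|x - y|.
  move=> x0 xy; rewrite distrC (distrC x) !ger0_norm ?subr_ge0 ?rho_mono//.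
  exact: penalty_decrement.
rewrite -(penalty_abs a) -(penalty_abs b).
apply: (@le_trans _ _ (lam * `| `|a| - `|b| |)); last first.
  by rewrite ler_wpM2l ?amenable_level_ge0// ler_dist_dist.
by have [ab|/ltW ab] := leP `|a| `|b|; [|rewrite distrC (distrC `|a|)]; apply: H.
Qed.

(* The subgradient inequality of the convex function [rho + mu t^2 / 2],
   rewritten as a statement on [rho]. *)
Definition weak_subgradient (a q : R) : Prop :=
  forall b, rho a + q * (b - a) - mu / 2 * (b - a) ^+ 2 <= rho b.

Lemma weak_subgradient0 q : `|q| <= lam -> weak_subgradient 0 q.
Proof.
move=> ql b; rewrite rho0 subr0 add0r; have := penalty_ge b.
suff : q * b <= lam * `|b| by lra.
by rewrite (le_trans (ler_norm _))// normrM ler_wpM2r.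
Qed.

Lemma weak_subgradient_derive a : a != 0 -> weak_subgradient a (derive1 rho a).
Proof.
move=> a0 b; have [->|ba] := eqVneq b a.
  by rewrite subrr expr0n/= !mulr0 subr0 addr0.
pose v := b - a; have v0 : 0 < `|v| by rewrite normr_gt0 subr_eq0.
pose A := rho b - rho a + mu / 2 * v ^+ 2.
suff : derive1 rho a * v <= A by rewrite /A /v; lra.
apply: (@ler_addeps_scale _ _ _ `|v|) => e e0.
have [r r0 hr] := derivable_eps (rho_der a0) e0.
pose h := Num.min 1 (r / 2 / `|v|).
have h0 : 0 < h by rewrite !lt_min ltr01 !divr_gt0.
have h1 : h <= 1 by rewrite !ge_min lexx.
have hv : `|h * v| < r.
  rewrite normrM (gtr0_norm h0) (@le_lt_trans _ _ (r / 2))//; last lra.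
  by rewrite -ler_pdivlMr// !ge_min lexx orbT.
have := hr _ hv => /ler_normlP[H _].
have := rho_convex b a (ltW h0) h1.
have -> : h * b + (1 - h) * a = a + h * v by rewrite /v; ring.
move=> cv.
have hvE : `|h * v| = h * `|v| by rewrite normrM gtr0_norm.
rewrite hvE in H.
rewrite -(@ler_pM2l _ h)//.
(* In the convexity inequality the squares combine to [mu / 2 * h * (1 - h) * v ^+ 2]; the part in
   [h ^+ 2] has a favourable sign and is dropped. *)
have hh : 0 <= h * (h * (mu / 2 * v ^+ 2)).
  by rewrite mulr_ge0 ?(ltW h0)// mulr_ge0 ?(ltW h0)// mulr_ge0 ?sqr_ge0// divr_ge0.
have bE : b = a + v by rewrite /v; ring.
rewrite /A.
move: cv hh H; rewrite bE; clear -h; set D := derive1 rho a.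
set ra := rho a; set rb := rho (a + v); set rh := rho (a + h * v).
set nv := `|v|; move=> cv hh H; lra.
Qed.

Lemma norm_derive_penalty a : a != 0 -> `|derive1 rho a| <= lam.
Proof.
move=> a0; apply: (@ler_addeps_scale _ _ _ 1) => e e0; rewrite mulr1.
have [r r0 hr] := derivable_eps (rho_der a0) e0.
have h0 : 0 < r / 2 by lra.
have hN : `|r / 2| = r / 2 by rewrite gtr0_norm.
have := hr (r / 2); rewrite hN => /(_ ltac:(lra)).
have := penalty_lipschitz (a + r / 2) a; rewrite addrAC subrr add0r hN => h1 h2.
rewrite -(@ler_pM2r _ (r / 2))// -[X in _ * X]hN -normrM.
have -> : derive1 rho a * (r / 2) = (rho (a + r / 2) - rho a)
   - (rho (a + r / 2) - rho a - r / 2 * derive1 rho a) by ring.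
by rewrite (le_trans (ler_normB _ _))//; lra.
Qed.

Lemma derive_penaltyN a : a != 0 -> derive1 rho (- a) = - derive1 rho a.
Proof.
move=> a0; apply/eqP; rewrite -addr_eq0 -normr_eq0 eq_le normr_ge0 andbT.
apply: (@ler_addeps_scale _ _ _ 2) => e e0; rewrite add0r.
have [r r0 hr] := derivable_eps (rho_der a0) e0.
have Na0 : - a != 0 by rewrite oppr_eq0.
have [s s0 hs] := derivable_eps (rho_der Na0) e0.
pose h := Num.min r s / 2.
have m0 : 0 < Num.min r s by rewrite lt_min r0.
have h0 : 0 < h by rewrite /h; lra.
have hltr : h < r.
  have m1 : Num.min r s <= r by rewrite ge_min lexx.
  by rewrite /h; lra.
have hlts : h < s.
  have m1 : Num.min r s <= s by rewrite ge_min lexx orbT.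
  by rewrite /h; lra.
have := hr (- h); rewrite normrN gtr0_norm// => /(_ hltr) /ler_normlP[h1 h2].
have := hs h; rewrite gtr0_norm// => /(_ hlts) /ler_normlP[h3 h4].
have E : rho (- a + h) = rho (a - h) by rewrite -rho_even opprD opprK.
move: h1 h2 h3 h4; rewrite E rho_even => h1 h2 h3 h4.
rewrite -(@ler_pM2r _ h)// -[X in _ * X](gtr0_norm h0) -normrM.
by apply/ler_normlP; split; lra.
Qed.

(** The weak subgradient inequalities at [x] for the steps [h] and [- h] squeeze the derivative at
    [x] between two difference quotients, up to [mu / 2 * h]. Continuity of [rho] compares these
    with the quotients at [a]. This is what makes the limit in [penalty_slope] computable. *)
Lemma derive_penalty_continuous a : a != 0 -> {for a, continuous (derive1 rho)}.
Proof.
move=> a0; apply/cvgrPdist_le => /= e e0.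
have e4 : 0 < e / 4 by lra.
have [r r0 hr] := derivable_eps (rho_der a0) e4.
pose h := Num.min (r / 2) (e / (4 * (mu + 1))).
have h0 : 0 < h by rewrite lt_min !divr_gt0// mulr_gt0// ltr_wpDl.
have hr2 : h < r by apply: (@le_lt_trans _ _ (r / 2)); [rewrite ge_min lexx|lra].
have hmu : mu * h <= e / 4.
  have : h <= e / (4 * (mu + 1)) by rewrite ge_min lexx orbT.
  rewrite ler_pdivlMr; last by rewrite mulr_gt0// ltr_wpDl.
  lra.
have := hr h; rewrite gtr0_norm// => /(_ hr2) /ler_normlP[p1 p2].
have := hr (- h); rewrite normrN gtr0_norm// => /(_ hr2) /ler_normlP[p3 p4].
have cont (c : R) : \forall x \near a, `|rho (a + c) - rho (x + c)| <= e / 8 * h.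
  have : rho (x + c) @[x --> a] --> rho (a + c).
    by apply: (@continuous_comp _ _ _ (fun x => x + c) rho);
      [apply: cvgD; [exact: cvg_id|exact: cvg_cst]|exact: rho_cont].
  by move/cvgrPdist_le; apply; rewrite mulr_gt0// divr_gt0.
have nz : \forall x \near a, x != 0.
  exists `|a|; rewrite /= ?normr_gt0// => x /=; apply: contraTneq => ->.
  by rewrite subr0 ltxx.
near=> x.
have x0 : x != 0 by near: x.
have c0 : `|rho a - rho x| <= e / 8 * h.
  by rewrite -[a]addr0 -[x]addr0; near: x; exact: cont.
have c1 : `|rho (a + h) - rho (x + h)| <= e / 8 * h by near: x; exact: cont.
have c2 : `|rho (a - h) - rho (x - h)| <= e / 8 * h by near: x; exact: cont.
have s1 := weak_subgradient_derive x0 (x + h).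
have s2 := weak_subgradient_derive x0 (x - h).
(* Error budget: [e / 4] from differentiability at [a], [e / 8] twice from continuity of [rho], and
   [e / 8] from the curvature term. *)
have ne : e / 4 * h + e / 8 * h * 3 <= e * h by have := mulr_gt0 e0 h0; lra.
have hmu2 : mu / 2 * h ^+ 2 <= e / 8 * h.
  have := ler_wpM2r (ltW h0) hmu; rewrite (expr2 h); lra.
rewrite -(@ler_pM2r _ h)// -[X in `|_| * X](gtr0_norm h0) -normrM mulrBl.
move: s1 s2 p1 p2 p3 p4 ne; rewrite (mulNr h) (addrC x h).
rewrite (addrC x (- h)) !addrK sqrrN mulrN ![_ + x]addrC.
rewrite ![h * _]mulrC.
move/ler_normlP : c0 c1 c2 => [c01 c02] /ler_normlP[c11 c12] /ler_normlP[c21 c22].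
move: hmu2 c01 c02 c11 c12 c21 c22.
move: (e / 4 * h) (e / 8 * h) (e * h) (mu / 2 * _) => e4h e8h eh m2.
move: (derive1 rho a * h) (derive1 rho x * h) => Da Dx.
move: (rho (a + h)) (rho (x + h)) (rho (a - h)) (rho (x - h)) (rho a) (rho x).
move=> rap rxp ram rxm ra rx hmu2 c01 c02 c11 c12 c21 c22 s1 s2 p1 p2 p3 p4 ne.
apply/ler_normlP; split.
- by clear s2 p1 p3 p4 c01 c12 c21 c22; lra.
- by clear s1 p1 p2 p3 c01 c11 c12 c22; lra.
Unshelve. all: by end_near.
Qed.

End AmenablePenalty.

(** The two difference quotients are the same function, so the equality also holds at 0, where both
    sides may be unspecified. *)
Lemma grad_penaltyE (R : realType) (p : nat) (rho : R -> R) (c : 'cV[R]_p) j :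
  grad (penalty rho) c j 0 = derive1 rho (c j 0).
Proof.
rewrite mxE /derive /derive1.
set d := (fun _ : R => _); set d' := (fun _ : R => _).
suff -> : d = d' by []; apply/funext => h; rewrite /d /d' /=.
congr (_ *: _); rewrite /penalty (bigD1 j)//= [X in _ - X](bigD1 j)//=.
rewrite !mxE !eqxx mulr1 opprD addrACA -[RHS]addr0; congr (_ + _).
apply/eqP; rewrite subr_eq0; apply/eqP/eq_bigr => l lj.
by rewrite !mxE (negbTE lj) mulr0 add0r.
Qed.

Section Slope.
Context {R : realType} (mu lam : R) (rho : R -> R).
Hypotheses (mu0 : 0 <= mu) (am : amenable mu lam rho).

(* The one-sided derivative of [rho] at [a] in the direction [s]. *)
Definition slope1 (a s : R) : R :=
  if a == 0 then lam * `|s| else derive1 rho a * s.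

Lemma cvg_slope1 a s : derive1 rho (a + t * s) * s @[t --> 0^'+] --> slope1 a s.
Proof.
(* For [s = 0] the point stays at [a]; if moreover [a = 0] the derivative there is unspecified, and
   only the factor [s] gives the limit. *)
rewrite /slope1; have [->|s0] := eqVneq s 0.
  rewrite normr0 !mulr0 if_same.
  rewrite (_ : (fun _ => _) = fun=> 0); first exact: cvg_cst.
  by apply/funext => t; rewrite !mulr0.
have [->|a0] := eqVneq a 0; last first.
  have cc : derive1 rho (a + t * s) @[t --> 0^'+] --> derive1 rho a.
    have /cvgrPdist_le H := derive_penalty_continuous mu0 am a0.
    apply/cvg_at_right_epsP => e e0; have /= [r r0 hr] := H e e0.
    exists (r / `|s|); first by rewrite divr_gt0// normr_gt0.
    move=> h h0; rewrite ltr_pdivlMr ?normr_gt0// => hs.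
    rewrite distrC; apply: hr => /=.
    by rewrite add0r opprD addrA subrr sub0r normrN normrM gtr0_norm.
  exact: (cvgM cc (cvg_cst _)).
apply/cvg_at_right_epsP => e e0.
have [_ [_ [_ /cvg_at_right_epsP H]]] := am.
have s0' : 0 < `|s| by rewrite normr_gt0.
have [r r0 hr] := H (e / `|s|) (divr_gt0 e0 s0').
exists (r / `|s|); first by rewrite divr_gt0.
move=> h h0; rewrite ltr_pdivlMr// => hs; rewrite !add0r.
have -> : derive1 rho (h * s) * s = derive1 rho (h * `|s|) * `|s|.
  case: (ltgtP s 0) s0 => // [sn|sp] _; last by rewrite gtr0_norm.
  rewrite ltr0_norm// (mulrN h) (derive_penaltyN am) ?mulrNN//.
  by apply: mulf_neq0; [rewrite gt_eqF|rewrite lt_eqF].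
rewrite -mulrBl normrM normr_id -ler_pdivlMr//.
by have := hr (h * `|s|); rewrite add0r; apply => //; rewrite mulr_gt0.
Qed.

Lemma penalty_slopeE (p : nat) (b v : 'cV[R]_p) :
  penalty_slope rho b v = \sum_j slope1 (b j 0) (v j 0).
Proof.
apply: cvg_lim => //; rewrite /dot.
rewrite (_ : (fun t : R => \sum_j _) =
  (fun t : R => \sum_j derive1 rho (b j 0 + t * v j 0) * v j 0)); last first.
  by apply/funext => t; apply: eq_bigr => j _; rewrite grad_penaltyE !mxE.
apply: cvg_big => [x|j _]; [exact: add_continuous|exact: cvg_slope1].
Qed.

(** At 0 the subgradient that attains the slope depends on the direction: it is [lam] times the sign
    of [s]. This serves for an arbitrary stationary point, about whose zero entries nothing is
    known. *)
Lemma slope1_subgradient a s : exists q,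
  weak_subgradient mu rho a q /\ slope1 a s = q * s.
Proof.
rewrite /slope1; case: eqP => [->|/eqP a0]; last first.
  by exists (derive1 rho a); split => //; exact: (weak_subgradient_derive mu0 am).
exists (lam * Num.sg s); split; last by rewrite -mulrA -normrEsg.
apply: (weak_subgradient0 mu0 am); rewrite normrM normr_sg ger0_norm ?(amenable_level_ge0 am)//.
by case: (s != 0); rewrite ?mulr1// mulr0 (amenable_level_ge0 am).
Qed.

(* [7/4 < 2] leaves room for the noise when [l1norm bstar <= Rad / 2]. *)
Lemma penalty_growth (b a : R) :
  4 / 7 * lam * (`|b| - 7 / 4 * `|a|) <= rho b - rho a + mu / 2 * (b - a) ^+ 2.
Proof.
have l0 := amenable_level_ge0 am.
suff H x y : 0 <= x -> 0 <= y ->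
    4 / 7 * lam * (x - 7 / 4 * y) <= rho x - rho y + mu / 2 * (x - y) ^+ 2.
  have := H `|b| `|a| (normr_ge0 _) (normr_ge0 _).
  rewrite !(penalty_abs am) => /le_trans; apply.
  rewrite lerD2l ler_wpM2l ?divr_ge0// -[leLHS]real_normK ?num_real//.
  rewrite -[leRHS]real_normK ?num_real//.
  by rewrite ler_sqr ?nnegrE ?normr_ge0// ler_dist_dist.
move=> x0 y0; have [xy|/ltW yx] := leP x y.
  have h := penalty_decrement am x0 xy.
  have h2 : 0 <= mu / 2 * (x - y) ^+ 2 by rewrite mulr_ge0 ?sqr_ge0// divr_ge0.
  have h3 := mulr_ge0 l0 x0; lra.
have h1 := penalty_increment mu0 am y0 yx.
have h2 : rho y <= rho x by case: am => _ [[_ + _ _] _]; apply.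
have [r xE] : exists r, x = y + r by exists (x - y); ring.
have r0 : 0 <= r by lra.
rewrite {}xE in h1 h2 *.
(* With [x = y + r], [penalty_increment] yields slope [lam - mu * y], which is at least
   [4 / 7 * lam] in the first case. In the second the increment of [rho] is only used to be
   nonnegative, and completing the square in [mu * r] suffices because 9/49 > 8/49. *)
have [m|m] := leP (mu * y) (3 / 7 * lam).
  have h3 := ler_wpM2r r0 m.
  have h4 := mulr_ge0 l0 y0; lra.
have mu_gt0 : 0 < mu.
  rewrite lt_neqAle mu0 andbT; apply: contraTneq m => <-.
  by rewrite mul0r -leNgt mulr_ge0// divr_ge0.
suff : 0 <= mu * (mu / 2 * r ^+ 2 - 4 / 7 * lam * (r - 3 / 4 * y)).
  rewrite pmulr_rge0// => h; clear -h h2; lra.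
have -> : mu * (mu / 2 * r ^+ 2 - 4 / 7 * lam * (r - 3 / 4 * y)) =
  2^-1 * (mu * r - 4 / 7 * lam) ^+ 2 + lam * (3 / 7 * (mu * y) - 8 / 49 * lam).
  by field.
apply: addr_ge0; first by rewrite mulr_ge0 ?sqr_ge0.
by rewrite mulr_ge0//; lra.
Qed.

End Slope.

(** * Quadratic forms and the primal-dual witness *)

Section Dot.
Context {R : realType}.
Implicit Types p : nat.

Lemma dotE p (u v : 'cV[R]_p) : dot u v = (u^T *m v) 0 0.
Proof. by rewrite mxE; apply: eq_bigr => j _; rewrite mxE. Qed.

Lemma dotC p (u v : 'cV[R]_p) : dot u v = dot v u.
Proof. by apply: eq_bigr => j _; rewrite mulrC. Qed.

Lemma dotDl p (u v z : 'cV[R]_p) : dot (u + v) z = dot u z + dot v z.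
Proof. by rewrite -big_split; apply: eq_bigr => j _; rewrite mxE mulrDl. Qed.

Lemma dotZl p a (u z : 'cV[R]_p) : dot (a *: u) z = a * dot u z.
Proof. by rewrite mulr_sumr; apply: eq_bigr => j _; rewrite mxE mulrA. Qed.

Lemma dotNl p (u z : 'cV[R]_p) : dot (- u) z = - dot u z.
Proof. by rewrite -scaleN1r dotZl mulN1r. Qed.

Lemma dotBl p (u v z : 'cV[R]_p) : dot (u - v) z = dot u z - dot v z.
Proof. by rewrite dotDl dotNl. Qed.

Lemma dotDr p (u v z : 'cV[R]_p) : dot z (u + v) = dot z u + dot z v.
Proof. by rewrite dotC dotDl !(dotC z). Qed.

Lemma dotZr p a (u z : 'cV[R]_p) : dot z (a *: u) = a * dot z u.
Proof. by rewrite dotC dotZl (dotC z). Qed.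

Lemma dotNr p (u z : 'cV[R]_p) : dot z (- u) = - dot z u.
Proof. by rewrite dotC dotNl (dotC z). Qed.

Lemma dot_mulmx m p (A : 'M[R]_(m, p)) (u : 'cV[R]_m) (v : 'cV[R]_p) :
  dot u (A *m v) = dot (A^T *m u) v.
Proof. by rewrite !dotE trmx_mul trmxK mulmxA. Qed.

Lemma dot_delta p (u : 'cV[R]_p) j : dot u (delta_mx j 0) = u j 0.
Proof.
rewrite /dot (bigD1 j)//= mxE !eqxx mulr1 big1 ?addr0// => l lj.
by rewrite mxE (negbTE lj) mulr0.
Qed.

Lemma dot_ge0 p (u : 'cV[R]_p) : 0 <= dot u u.
Proof. by apply: sumr_ge0 => j _; rewrite -expr2 sqr_ge0. Qed.

Lemma dot_eq0 p (u : 'cV[R]_p) : dot u u <= 0 -> u = 0.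
Proof.
move=> u0; apply/colP => j; rewrite mxE; apply/eqP; rewrite -sqrf_eq0.
rewrite eq_le sqr_ge0 andbT; apply: le_trans u0.
rewrite /dot (bigD1 j)//= -expr2 lerDl.
by apply: sumr_ge0 => l _; rewrite -expr2 sqr_ge0.
Qed.

Definition qform p (G : 'M[R]_p) (v : 'cV[R]_p) : R := dot v (G *m v).

Lemma l1norm_ge0 p (v : 'cV[R]_p) : 0 <= l1norm v.
Proof. exact: sumr_ge0. Qed.

Lemma l1norm_triangle p (u v : 'cV[R]_p) : l1norm (u + v) <= l1norm u + l1norm v.
Proof.
by rewrite -big_split; apply: ler_sum => j _; rewrite mxE ler_normD.
Qed.

Lemma l1normN p (v : 'cV[R]_p) : l1norm (- v) = l1norm v.
Proof. by apply: eq_bigr => j _; rewrite mxE normrN. Qed.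

(** Cauchy-Schwarz against the constant 1, with the defect written as half the double sum of
    [(|f i| - |f j|) ^+ 2]. *)
Lemma sum_norm_le_card (I : finType) (S : {set I}) (f : I -> R) :
  (\sum_(j in S) `|f j|) ^+ 2 <= #|S|%:R * \sum_(j in S) f j ^+ 2.
Proof.
rewrite -sum1_card natr_sum -subr_ge0.
set A := \sum_(i in S) 1%:R; set a := \sum_(j in S) `|f j|.
have -> : A * (\sum_(j in S) f j ^+ 2) - a ^+ 2 =
  2^-1 * \sum_(i in S) \sum_(j in S) (`|f i| - `|f j|) ^+ 2.
  have E i : \sum_(j in S) (`|f i| - `|f j|) ^+ 2 =
     A * f i ^+ 2 - 2 * `|f i| * a + \sum_(j in S) f j ^+ 2.
    rewrite /A /a mulr_suml mulr_sumr -sumrB -big_split/=.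
    apply: eq_bigr => j _; rewrite sqrrB !real_normK ?num_real//; ring.
  under [in RHS]eq_bigr do rewrite E.
  rewrite !big_split/= sumrN -mulr_sumr.
  have -> : \sum_(i in S) 2 * `|f i| * a = 2 * a * a.
    by rewrite -mulr_suml -mulr_sumr.
  have -> : \sum_(i in S) \sum_(j in S) f j ^+ 2 = A * \sum_(j in S) f j ^+ 2.
    by rewrite [in RHS]/A mulr_suml; apply: eq_bigr => i _; rewrite mul1r.
  by field.
by rewrite mulr_ge0// !sumr_ge0// => i _; rewrite sumr_ge0// => j _; rewrite sqr_ge0.
Qed.

End Dot.

Section Loss.
Context {R : realType} (n p : nat) (X : 'M[R]_(n, p)) (bs : 'cV[R]_p).
Context (eps : 'cV[R]_n).
Let G := sample_cov X.

Definition noise_corr : 'cV[R]_p := n%:R^-1 *: (X^T *m eps).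
Let w := noise_corr.
Let y := X *m bs + eps.

Lemma sample_cov_sym : G^T = G.
Proof. by rewrite /G /sample_cov linearZ/= trmx_mul trmxK. Qed.

Lemma lossE b : loss X y b = 2^-1 * qform G b - dot (G *m bs + w) b.
Proof.
rewrite /loss -/G /qform dotE mulmxA; congr (_ - _).
rewrite dotE; congr ((_ *m b) 0 0).
rewrite /w /noise_corr /G /sample_cov -scalemxAl -scalerDr linearZ/= -mulmxA -mulmxDr.
by rewrite trmx_mul trmxK.
Qed.

Definition lgrad (b : 'cV[R]_p) : 'cV[R]_p := G *m (b - bs) - w.

Lemma loss_expand b v :
  loss X y (b + v) = loss X y b + dot (lgrad b) v + 2^-1 * qform G v.
Proof.
rewrite !lossE /lgrad /qform !mulmxDr mulmxN !(dotDl, dotDr, dotNl, dotNr).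
rewrite !dot_mulmx sample_cov_sym.
have -> : dot (G *m v) b = dot (G *m b) v.
  by rewrite dotC dot_mulmx sample_cov_sym.
by field.
Qed.

Lemma grad_lossE b : grad (loss X y) b = lgrad b.
Proof.
apply/colP => j; rewrite mxE; apply: cvg_lim => //=.
set c := lgrad b j 0; set a := 2^-1 * qform G (delta_mx j 0).
have E : {near 0^', (fun h : R => c + h * a) =1
   (fun h => h^-1 *: (loss X y (h *: delta_mx j 0 + b) - loss X y b))}.
  near=> h; have h0 : h != 0 by near: h; exact: nbhs_dnbhs_neq.
  rewrite [h *: _ + b]addrC loss_expand dotZr dot_delta /qform -scalemxAr dotZl dotZr -/c.
  by rewrite /a /qform /GRing.scale/=; field.
have H : c + h * a @[h --> 0^'] --> c.
  have H0 : c + h * a @[h --> (0 : R)] --> c + 0 * a.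
    by apply: cvgD; [exact: cvg_cst|apply: cvgM; [exact: cvg_id|exact: cvg_cst]].
  rewrite mul0r addr0 in H0.
  exact: cvg_within_filter H0.
exact: cvg_trans (near_eq_cvg E) H.
Unshelve. all: by end_near.
Qed.

End Loss.

(** * Restricted strong convexity and its consequences *)

Definition rsc (R : realType) (p : nat) (alpha T : R) (G : 'M[R]_p) : Prop :=
  forall v : 'cV[R]_p, alpha * dot v v - T * l1norm v ^+ 2 <= qform G v.

Section RSC.
Context {R : realType} (p : nat).
Implicit Types (v : 'cV[R]_p) (S : {set 'I_p}).

Lemma l1norm_split S v :
  l1norm v = \sum_(j in S) `|v j 0| + \sum_(j in ~: S) `|v j 0|.
Proof.
rewrite /l1norm (bigID (mem S))/=; congr (_ + _).
by apply: eq_bigl => j; rewrite inE.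
Qed.

Lemma sum_in_sqr_le S v : \sum_(j in S) v j 0 ^+ 2 <= dot v v.
Proof.
rewrite /dot [leRHS](bigID (mem S))/= -[leLHS]addr0 lerD//.
by rewrite sumr_ge0// => j _; rewrite -expr2 sqr_ge0.
Qed.

Lemma sum_norm_sqr_le S v k : (#|S| <= k)%N ->
  (\sum_(j in S) `|v j 0|) ^+ 2 <= k%:R * dot v v.
Proof.
move=> Sk; rewrite (le_trans (sum_norm_le_card _ _))//.
rewrite ler_pM ?ler_nat ?sum_in_sqr_le//.
by rewrite sumr_ge0// => j _; rewrite sqr_ge0.
Qed.

Lemma suppN0 S v j : supp v \subset S -> j \notin S -> v j 0 = 0.
Proof.
move=> /fintype.subsetP vS; apply: contraNeq => vj0; apply: vS.
by rewrite inE.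
Qed.

Lemma suppB S u v : supp u \subset S -> supp v \subset S -> supp (u - v) \subset S.
Proof.
move=> uS vS; apply/fintype.subsetP => j; rewrite inE !mxE.
by apply: contraNT => jS; rewrite (suppN0 uS jS) (suppN0 vS jS) subr0.
Qed.

Lemma l1norm_supp S v : supp v \subset S -> l1norm v = \sum_(j in S) `|v j 0|.
Proof.
move=> vS; rewrite (l1norm_split S) [X in _ + X]big1 ?addr0// => j.
by rewrite inE => /(suppN0 vS) ->; rewrite normr0.
Qed.

Lemma rsc_sparse alpha T (G : 'M[R]_p) S v k : 0 <= T -> rsc alpha T G ->
  (#|S| <= k)%N -> supp v \subset S ->
  (alpha - k%:R * T) * dot v v <= qform G v.
Proof.
move=> T0 H Sk vS; apply: le_trans (H v); rewrite (l1norm_supp vS).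
have := ler_wpM2l T0 (sum_norm_sqr_le v Sk).
rewrite mulrBl; lra.
Qed.

(** Meant for [v] a difference of two feasible points. The l1 mass on [S] is converted into
    curvature through the sparsity bound; the mass outside [S] stays, but only linearly, so that
    dual slack can absorb it. *)
Lemma rsc_feasible alpha T (G : 'M[R]_p) S v k Rad dl :
  0 <= T -> rsc alpha T G -> (#|S| <= k)%N ->
  l1norm v <= 2 * Rad -> 4 * Rad * T <= dl ->
  (alpha - 2 * k%:R * T) * dot v v <=
  qform G v + dl * \sum_(j in ~: S) `|v j 0|.
Proof.
move=> T0 H Sk; rewrite (l1norm_split S) => vR hdl.
have := H v; rewrite (l1norm_split S).
have := ler_wpM2l T0 (sum_norm_sqr_le v Sk); move: vR.
have : 0 <= \sum_(j in S) `|v j 0| by rewrite sumr_ge0.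
have : 0 <= \sum_(j in ~: S) `|v j 0| by rewrite sumr_ge0.
move: (\sum_(j in S) _) (\sum_(j in ~: S) _) (dot v v) (qform G v) => a b l q.
move=> b0 a0 ab ha hq.
(* From [(a + b)^2 <= 2 a^2 + 2 b^2], where one factor of [b^2] is replaced by its bound
   [2 * Rad]. *)
have h1 : (a + b) ^+ 2 <= 2 * a ^+ 2 + 4 * Rad * b.
  have : b * b <= b * (2 * Rad) by rewrite ler_wpM2l//; lra.
  have := sqr_ge0 (a - b); rewrite !expr2; lra.
have := ler_wpM2l T0 h1; have := ler_wpM2r b0 hdl.
rewrite mulrBl; lra.
Qed.

End RSC.

(** * Optimality and uniqueness from strict dual feasibility *)

Section Witness.
Context {R : realType} (mu lam : R) (rho : R -> R).
Hypotheses (mu0 : 0 <= mu) (am : amenable mu lam rho).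

Definition subgradient (a q : R) : Prop :=
  if a == 0 then is_true (`|q| <= lam) else q = derive1 rho a.

Lemma subgradient_weak a q : subgradient a q -> weak_subgradient mu rho a q.
Proof.
rewrite /subgradient; case: eqP => [->|/eqP a0 ->].
  by move=> ql; exact: (weak_subgradient0 mu0 am).
exact: (weak_subgradient_derive mu0 am).
Qed.

Lemma subgradient_norm a q : subgradient a q -> `|q| <= lam.
Proof.
by rewrite /subgradient; case: eqP => [//|/eqP a0 ->]; exact: (norm_derive_penalty am).
Qed.

Lemma subgradient_slope1 a q s : subgradient a q -> q * s <= slope1 lam rho a s.
Proof.
rewrite /subgradient /slope1; case: eqP => [_ ql|/eqP a0 ->//].
by rewrite (le_trans (ler_norm _))// normrM ler_wpM2r.
Qed.

(** First-order condition along one coordinate, with [g] and [c] the linear and quadratic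
    coefficients of the smooth part. Steps [h] and [- h] are compared: at the kink [penalty_le]
    bounds the growth of [rho], elsewhere differentiability does, and the quadratic term vanishes
    with [h]. *)
Lemma subgradient_of_local_min (a g c r : R) : 0 < r ->
  (forall t, `|t| < r -> 0 <= t * g + c * t ^+ 2 + rho (a + t) - rho a) ->
  subgradient a (- g).
Proof.
move=> r0 H; rewrite /subgradient.
pose c' := `|c| + 1; have c'0 : 0 < c' by rewrite ltr_wpDl.
have Hc t : c * t ^+ 2 <= c' * `|t| ^+ 2.
  rewrite real_normK ?num_real// ler_wpM2r ?sqr_ge0// /c'.
  by rewrite (le_trans (ler_norm c))// lerDl.
have rho0 : rho 0 = 0 by case: am => _ [[[]]].
case: eqP => [a0|/eqP a0].
  apply: (@ler_addeps_scale _ _ _ 1) => e e0; rewrite mulr1.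
  pose h := Num.min (r / 2) (e / c').
  have h0 : 0 < h by rewrite lt_min !divr_gt0.
  have hr : h < r by apply: (@le_lt_trans _ _ (r / 2)); [rewrite ge_min lexx|lra].
  have he : c' * h <= e by rewrite mulrC -ler_pdivlMr// ge_min lexx orbT.
  have hN : `|h| = h by rewrite gtr0_norm.
  have K := ler_wpM2r (ltW h0) he.
  have l1 := penalty_le am h; have l2 := penalty_le am (- h).
  rewrite normrN hN in l1 l2.
  have H1 := H h; rewrite hN a0 rho0 add0r in H1; have {}H1 := H1 hr.
  have H2 := H (- h); rewrite normrN hN a0 rho0 add0r in H2; have {}H2 := H2 hr.
  have C1 := Hc h; have C2 := Hc (- h); rewrite normrN hN sqrrN in C1 C2.
  rewrite sqrrN in H2.
  rewrite normrN -(@ler_pM2r _ h)// -[X in `|_| * X]hN -normrM.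
  by apply/ler_normlP; split; rewrite (expr2 h) in C1 C2 H1 H2; lra.
have rho_der : derivable rho a 1 by case: am => _ [[_ _ _ H3] _]; exact: H3.
apply/eqP; rewrite eq_sym -addr_eq0 -normr_eq0 eq_le normr_ge0 andbT.
apply: (@ler_addeps_scale _ _ _ 2) => e e0; rewrite add0r.
have [s s0 hs] := derivable_eps rho_der e0.
pose h := Num.min (Num.min (r / 2) (s / 2)) (e / c').
have h0 : 0 < h by rewrite !lt_min !divr_gt0.
have hr : h < r.
  by apply: (@le_lt_trans _ _ (r / 2)); [rewrite !ge_min lexx|lra].
have hlts : h < s.
  by apply: (@le_lt_trans _ _ (s / 2)); [rewrite !ge_min lexx orbT|lra].
have he : c' * h <= e by rewrite mulrC -ler_pdivlMr// ge_min lexx orbT.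
have hN : `|h| = h by rewrite gtr0_norm.
have K := ler_wpM2r (ltW h0) he.
have H1 := H h; rewrite hN in H1; have {}H1 := H1 hr.
have H2 := H (- h); rewrite normrN hN in H2; have {}H2 := H2 hr.
have C1 := Hc h; have C2 := Hc (- h); rewrite normrN hN sqrrN in C1 C2.
have := hs h; rewrite hN => /(_ hlts) /ler_normlP[_ D1].
have := hs (- h); rewrite normrN hN => /(_ hlts) /ler_normlP[_ D2].
rewrite sqrrN in H2.
rewrite -(@ler_pM2r _ h)// -[X in `|_| * X]hN -normrM.
by apply/ler_normlP; split; rewrite (expr2 h) in C1 C2 H1 H2; lra.
Qed.

Context (n p k : nat) (X : 'M[R]_(n, p)) (bs : 'cV[R]_p) (eps : 'cV[R]_n).
Context (S : {set 'I_p}) (alpha T Rad dl : R).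
Let G := sample_cov X.
Let y := X *m bs + eps.
Hypotheses (Sk : (#|S| <= k)%N) (T0 : 0 <= T) (Grsc : rsc alpha T G).
Hypothesis alpha_gt : mu < alpha - 2 * k%:R * T.
Hypotheses (dl0 : 0 <= dl) (RadT : 4 * Rad * T <= dl).
Variables (bh q : 'cV[R]_p).
Hypotheses (bhS : supp bh \subset S) (bh_feas : feasible Rad bh).
Hypothesis bh_grad : lgrad X bs eps bh = - q.
Hypothesis q_sub : forall j, j \in S -> subgradient (bh j 0) (q j 0).
(* Strict dual feasibility, with margin [2 * dl]. *)
Hypothesis q_strict : forall j, j \notin S -> `|q j 0| <= lam - 2 * dl.

Let q_subgradient j : subgradient (bh j 0) (q j 0).
Proof.
have [jS|jS] := boolP (j \in S); first exact: q_sub.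
rewrite /subgradient (suppN0 bhS jS) eqxx.
have h := dl0; rewrite (le_trans (q_strict jS))//; lra.
Qed.

Let gap (v : 'cV[R]_p) := \sum_(j in ~: S) `|v j 0|.

Let gap_ge0 v : 0 <= gap v. Proof. exact: sumr_ge0. Qed.

(** Coordinatewise weak subgradient inequality. Outside [S], where [bh] is zero, the margin of [q]
    below [lam] leaves a surplus proportional to the entry. *)
Let penalty_gap b : dot q (b - bh) + 2 * dl * gap (b - bh)
   - mu / 2 * dot (b - bh) (b - bh) <= penalty rho b - penalty rho bh.
Proof.
rewrite /gap big_mkcond/= /dot /penalty !mulr_sumr -big_split/= -!sumrB.
apply: ler_sum => j _; rewrite !mxE finset.in_setC.
have [jS|jS]/= := boolP (j \in S).
  have := subgradient_weak (q_sub jS) (b j 0).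
  by rewrite mulr0 expr2; lra.
rewrite (suppN0 bhS jS) subr0; have -> : rho 0 = 0 by case: am => _ [[[]]].
have h1 := penalty_ge mu0 am (b j 0).
have h2 : q j 0 * b j 0 <= (lam - 2 * dl) * `|b j 0|.
  by rewrite (le_trans (ler_norm _))// normrM ler_wpM2r// q_strict.
by move: h1 h2; rewrite expr2; lra.
Qed.

Let key b : feasible Rad b -> (alpha - 2 * k%:R * T) * dot (b - bh) (b - bh) <=
  qform G (b - bh) + dl * gap (b - bh).
Proof.
move=> bR; apply: (rsc_feasible T0 Grsc Sk _ RadT).
rewrite (le_trans (l1norm_triangle _ _))// l1normN.
by move: bR bh_feas; rewrite /feasible; lra.
Qed.

Lemma witness_stationary : stationary X y rho Rad bh.
Proof.
split => // b bR; rewrite grad_lossE bh_grad (penalty_slopeE mu0 am).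
rewrite dotNl addrC subr_ge0; apply: ler_sum => j _.
exact/subgradient_slope1/q_subgradient.
Qed.

(** A stationary [b] is tested in the direction of [bh]. Weak convexity of [rho] is used once from
    [b] and once from [bh], each at a cost of [mu / 2] times the squared distance; the total [mu] is
    below the curvature [alpha - 2 * k * T], and the surplus of [penalty_gap] exceeds the l1 term of
    [key]. So the distance is zero. *)
Lemma witness_unique : unique (stationary X y rho Rad) bh.
Proof.
split; first exact: witness_stationary.
move=> b [bR /(_ _ bh_feas)]; rewrite grad_lossE (penalty_slopeE mu0 am).
have slope_le : \sum_j slope1 lam rho (b j 0) ((bh - b) j 0) <=
    penalty rho bh - penalty rho b + mu / 2 * dot (b - bh) (b - bh).
  rewrite /penalty /dot mulr_sumr -sumrB -big_split/=.
  apply: ler_sum => j _; rewrite !mxE.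
  have [q' [/(_ (bh j 0)) qs ->]] := slope1_subgradient mu0 am (b j 0) (bh j 0 - b j 0).
  by move: qs; rewrite expr2; lra.
have gradE : dot (lgrad X bs eps b) (bh - b) = dot q (b - bh) - qform G (b - bh).
  have -> : lgrad X bs eps b = G *m (b - bh) - q.
    rewrite -bh_grad /lgrad -/G addrA -mulmxDr; congr (_ *m _ - _).
    by rewrite addrA subrK.
  rewrite -(opprB b bh) dotNr dotBl /qform (dotC (G *m _)); ring.
rewrite gradE => st.
have h1 := penalty_gap b; have h2 := key bR; have h3 := gap_ge0 (b - bh).
have h4 := mulr_ge0 dl0 h3; have h5 := dot_ge0 (b - bh).
have : dot (b - bh) (b - bh) <= 0.
  rewrite leNgt; apply/negP => h6.
  have : mu * dot (b - bh) (b - bh) < (alpha - 2 * k%:R * T) * dot (b - bh) (b - bh).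
    by rewrite ltr_pM2r.
  lra.
by move/dot_eq0/eqP; rewrite subr_eq0 => /eqP.
Qed.

Lemma witness_global : global_optimum X y rho Rad bh.
Proof.
split => // b bR.
have := loss_expand X bs eps bh (b - bh); rewrite (addrC bh) subrK bh_grad dotNl => ->.
have h1 := penalty_gap b; have h2 := key bR; have h3 := gap_ge0 (b - bh).
have h4 := mulr_ge0 dl0 h3.
have h5 : mu * dot (b - bh) (b - bh) <= (alpha - 2 * k%:R * T) * dot (b - bh) (b - bh).
  by rewrite ler_wpM2r ?dot_ge0// ltW.
by rewrite -/G; lra.
Qed.

End Witness.

Section Submatrix.
Context {R : realType} (p : nat).
Implicit Types (S A : {set 'I_p}) (v : 'cV[R]_p) (G : 'M[R]_p).

Definition subcol S v : 'cV[R]_#|S| := \col_i v (enum_val i) 0.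

Lemma submx_of_mulmx A S G v : supp v \subset S ->
  submx_of A S G *m subcol S v = subcol A (G *m v).
Proof.
move=> vS; apply/colP => i; rewrite !mxE [RHS](bigID (mem S))/=.
rewrite [X in _ = _ + X]big1 ?addr0; last first.
  by move=> j jS; rewrite (suppN0 vS jS) mulr0.
rewrite [RHS]big_enum_val/=; apply: eq_bigr => j _.
by rewrite !mxE.
Qed.

Lemma subcolE S v j (jS : j \in S) : v j 0 = subcol S v (enum_rank_in jS j) 0.
Proof. by rewrite mxE enum_rankK_in. Qed.

Lemma norm_mulmx_le m n (M : 'M[R]_(m, n)) (u : 'cV[R]_n) c i :
  (forall j, `|u j 0| <= c) -> `|(M *m u) i 0| <= opnorm_inf M * c.
Proof.
(* A negative [c] can bound absolute values only if there are no columns, and then both sides are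
   0. *)
move=> uc; have [n0|c0] := leP 0 c; last first.
  have [m0|] := boolP [exists j : 'I_n, true].
    by case/existsP : m0 => j _; have := uc j; move: (normr_ge0 (u j 0)); lra.
  rewrite negb_exists => /forallP H.
  rewrite mxE /opnorm_inf big1 ?normr0//; last by move=> j; have := H j.
  rewrite (_ : \big[Num.max/0]_(_ < m) _ = 0) ?mul0r//.
  apply/eqP; rewrite eq_le; apply/andP; split; last exact: bigmax_ge_id.
  by apply: bigmax_le => // l _; rewrite big1// => j; have := H j.
rewrite mxE (le_trans (ler_norm_sum _ _ _))//.
apply: (@le_trans _ _ ((\sum_j `|M i j|) * c)).
  by rewrite mulr_suml; apply: ler_sum => j _; rewrite normrM ler_wpM2l.
by rewrite ler_wpM2r//; apply: (le_bigmax _ (fun i => \sum_j `|M i j|)).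
Qed.

Lemma opnorm_inf_ge0 m n (M : 'M[R]_(m, n)) : 0 <= opnorm_inf M.
Proof. exact: bigmax_ge_id. Qed.

Lemma mx_norm_le m n (M : 'M[R]_(m, n)) c : 0 <= c ->
  (forall i j, `|M i j| <= c) -> `|M| <= c.
Proof.
move=> c0 H; rewrite [leLHS]/Num.Def.normr/= mx_normrE.
by apply: bigmax_le => // -[i j] _; exact: H.
Qed.

End Submatrix.

Section Continuity.
Context {R : realType} {T : topologicalType}.
Implicit Types f g : T -> R.

Lemma continuous_sumr (I : finType) (f : I -> T -> R) : (forall i, continuous (f i)) ->
  continuous (fun x => \sum_i f i x).
Proof. by move=> fc; apply: (continuous_big add_continuous) => i _; exact: fc. Qed.

Lemma continuous_mulr f g : continuous f -> continuous g ->
  continuous (fun x => f x * g x).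
Proof. by move=> fc gc x; apply: continuousM; [exact: fc|exact: gc]. Qed.

End Continuity.

Section Minimizer.
Context {R : realType} (n p : nat) (X : 'M[R]_(n, p)) (bs : 'cV[R]_p).
Context (eps : 'cV[R]_n) (rho : R -> R) (Rad : R) (S : {set 'I_p}).
Let y := X *m bs + eps.

Let objective b := loss X y b + penalty rho b.

Lemma restricted_minimizer : continuous rho -> 0 <= Rad ->
  exists bh, [/\ supp bh \subset S, feasible Rad bh &
    forall b, supp b \subset S -> feasible Rad b -> objective bh <= objective b].
Proof.
move=> crho R0.
(* Composing the objective with this mask turns minimization over a coordinate subspace into
   minimization over the whole l1-ball, which is compact; the row vectors match [EVT_min_rV]. *)
pose mask (b : 'rV[R]_p) : 'cV[R]_p := \col_j (if j \in S then b 0 j else 0).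
have maskS b : supp (mask b) \subset S.
  by apply/fintype.subsetP => j; rewrite inE mxE; case: ifP => //; rewrite eqxx.
have mask_id b : supp b \subset S -> mask b^T = b.
  move=> bS; apply/colP => j; rewrite !mxE; case: ifPn => // jS.
  by rewrite (suppN0 bS jS).
have mask_l1 b : l1norm (mask b) <= l1norm b^T.
  by apply: ler_sum => j _; rewrite !mxE; case: ifP => // _; rewrite normr0.
have addC (f g : 'rV[R]_p -> R) : continuous f -> continuous g ->
    continuous (fun b => f b + g b).
  by move=> fc gc b; apply: continuousD; [exact: fc|exact: gc].
have cstC (c : R) : continuous (fun _ : 'rV[R]_p => c) by exact: cst_continuous.
have coordC j : continuous (fun b : 'rV[R]_p => mask b j 0).
  rewrite (_ : (fun _ => _) = fun b : 'rV[R]_p => if j \in S then b 0 j else 0).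
    by case: (j \in S); [exact: coord_continuous|exact: cstC].
  by apply/funext => b; rewrite mxE.
have objC : continuous (fun b : 'rV[R]_p => objective (mask b)).
  rewrite (_ : (fun _ => _) = fun b : 'rV[R]_p =>
    2^-1 * (\sum_i mask b i 0 * \sum_j sample_cov X i j * mask b j 0) +
    (\sum_j ((sample_cov X *m bs + noise_corr X eps) j 0 * (- 1)) * mask b j 0)
    + \sum_j rho (mask b j 0)); last first.
    apply/funext => b; rewrite /objective lossE /qform /dot -sumrN.
    congr (_ * _ + _ + _).
      by apply: eq_bigr => j _; rewrite [(_ *m _) _ _]mxE.
    by apply: eq_bigr => j _; rewrite mulrN1 mulNr.
  have GC i : continuous (fun b : 'rV[R]_p => \sum_j sample_cov X i j * mask b j 0).
    by apply: continuous_sumr => j; exact: continuous_mulr (cstC _) (coordC j).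
  have qC : continuous (fun b : 'rV[R]_p =>
      \sum_i mask b i 0 * \sum_j sample_cov X i j * mask b j 0).
    by apply: continuous_sumr => i; exact: continuous_mulr (coordC i) (GC i).
  have lC : continuous (fun b : 'rV[R]_p =>
      \sum_j ((sample_cov X *m bs + noise_corr X eps) j 0 * (- 1)) * mask b j 0).
    by apply: continuous_sumr => j; exact: continuous_mulr (cstC _) (coordC j).
  have rC : continuous (fun b : 'rV[R]_p => \sum_j rho (mask b j 0)).
    by apply: continuous_sumr => j c; apply: continuous_comp; [exact: coordC|exact: crho].
  exact: addC _ _ (addC _ _ (continuous_mulr (cstC _) qC) lC) rC.
pose K := [set b : 'rV[R]_p | l1norm b^T <= Rad].
have K0 : K !=set0.
  by exists 0; rewrite /K /= /l1norm big1// => j _; rewrite !mxE normr0.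
have l1C : continuous (fun b : 'rV[R]_p => l1norm b^T).
  apply: continuous_sumr => j b; rewrite (_ : (fun _ => _) = (fun b : 'rV[R]_p => `|b 0 j|)).
    by apply: continuous_comp; [exact: coord_continuous|exact: norm_continuous].
  by apply/funext => c; rewrite mxE.
have Kc : compact K.
  apply: bounded_closed_compact.
    exists Rad; split; first exact: num_real.
    move=> r Rr b Kb; apply: mx_norm_le; first exact: le_trans R0 (ltW Rr).
    move=> i j; rewrite (le_trans _ (ltW Rr))// (le_trans _ Kb)//.
    rewrite /l1norm (bigD1 j)//= mxE (ord1 i) lerDl.
    exact: sumr_ge0.
  rewrite (_ : K = (fun b : 'rV[R]_p => l1norm b^T) @^-1` [set x | x <= Rad])//.
  by apply: closed_comp => [b _|]; [exact: l1C|exact: closed_le].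
have [c] := EVT_min_rV K0 Kc (continuous_subspaceT objC).
rewrite inE /K /= => cR cmin; exists (mask c); split => //.
  exact: le_trans (mask_l1 c) cR.
move=> b bS bR; rewrite -(mask_id b bS); apply: cmin.
by rewrite inE /K /= trmxK.
Qed.

End Minimizer.

Section PrimalDualWitness.
Context {R : realType} (n p : nat) (X : 'M[R]_(n, p)) (bs bh : 'cV[R]_p).
Context (eps : 'cV[R]_n).
Let G := sample_cov X.
Let S := supp bs.
Let w := noise_corr X eps.
Let B := submx_of (~: S)%SET S G *m invmx (submx_of S S G).
Hypotheses (Gunit : submx_of S S G \in unitmx) (bhS : supp bh \subset S).
Let q := - lgrad X bs eps bh.

Let nuS : supp (bh - bs) \subset S.
Proof. exact: suppB bhS (fintype.subxx _). Qed.

Let GnuE A : subcol A (G *m (bh - bs)) = subcol A w - subcol A q.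
Proof.
by apply/colP => i; rewrite /q /lgrad -/G -/w !mxE; ring.
Qed.

(** The [S] block of the gradient equation, solved for the error: a noise term minus the bias caused
    by the penalty. Here [q] is just minus the gradient, so this and [witness_dual] are algebraic
    identities for every [bh] supported in [S]. *)
Lemma witness_error : subcol S (bh - bs) =
  invmx (submx_of S S G) *m subcol S w - invmx (submx_of S S G) *m subcol S q.
Proof.
by rewrite -mulmxBr -GnuE -(submx_of_mulmx S G nuS) mulKmx.
Qed.

Lemma witness_dual : subcol (~: S)%SET q =
  subcol (~: S)%SET w - B *m subcol S w + B *m subcol S q.
Proof.
have := GnuE (~: S)%SET; rewrite -(submx_of_mulmx _ G nuS) witness_error.
rewrite mulmxBr !mulmxA -/B => /eqP; rewrite eq_sym subr_eq => /eqP ->.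
rewrite [X in X - _ + _]addrC -addrA [X in X + _]addrC.
by apply/colP => i; rewrite !mxE; ring.
Qed.

End PrimalDualWitness.

Section Auxiliary.
Context {R : realType} (p : nat).

Lemma dot_le_l1_supp (S : {set 'I_p}) (u v : 'cV[R]_p) c : supp v \subset S ->
  (forall j, j \in S -> `|u j 0| <= c) -> `|dot u v| <= c * l1norm v.
Proof.
move=> vS uc; rewrite (le_trans (ler_norm_sum _ _ _))// mulr_sumr.
apply: ler_sum => j _; rewrite normrM; have [jS|jS] := boolP (j \in S).
  by rewrite ler_wpM2r// uc.
by rewrite (suppN0 vS jS) normr0 !mulr0.
Qed.

Lemma dot_supp0 (S : {set 'I_p}) (u v : 'cV[R]_p) : supp v \subset S ->
  (forall j, j \in S -> u j 0 = 0) -> dot u v = 0.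
Proof.
move=> vS u0; apply: big1 => j _; have [jS|jS] := boolP (j \in S).
  by rewrite u0// mul0r.
by rewrite (suppN0 vS jS) mulr0.
Qed.

Lemma penalty_delta (rho : R -> R) (b : 'cV[R]_p) j t :
  penalty rho (b + t *: delta_mx j 0) - penalty rho b = rho (b j 0 + t) - rho (b j 0).
Proof.
rewrite /penalty (bigD1 j)//= [X in _ - X](bigD1 j)//=.
rewrite !mxE !eqxx mulr1 opprD addrACA -[RHS]addr0; congr (_ + _).
apply/eqP; rewrite subr_eq0; apply/eqP/eq_bigr => l lj.
by rewrite !mxE (negbTE lj) mulr0 addr0.
Qed.

Lemma l1norm_delta j (t : R) : l1norm (t *: delta_mx j 0 : 'cV[R]_p) = `|t|.
Proof.
rewrite /l1norm (bigD1 j)//= !mxE !eqxx mulr1 big1 ?addr0// => l lj.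
by rewrite !mxE (negbTE lj) mulr0 normr0.
Qed.

Lemma supp_delta (S : {set 'I_p}) j (t : R) : j \in S ->
  supp (t *: delta_mx j 0 : 'cV[R]_p) \subset S.
Proof.
move=> jS; apply/fintype.subsetP => l; rewrite inE !mxE.
by case: (l =P j) => [->//|_]; rewrite mulr0 eqxx.
Qed.

Lemma suppD (S : {set 'I_p}) (u v : 'cV[R]_p) : supp u \subset S ->
  supp v \subset S -> supp (u + v) \subset S.
Proof.
move=> uS vS; apply/fintype.subsetP => j; rewrite inE !mxE.
by apply: contraNT => jS; rewrite (suppN0 uS jS) (suppN0 vS jS) addr0.
Qed.

(** Extension by zero. The sum has at most one term and is empty for [j] outside [S], which avoids a
    membership proof in the definition. *)
Definition embed (S : {set 'I_p}) (u : 'cV[R]_#|S|) : 'cV[R]_p :=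
  \col_j \sum_(i | enum_val i == j) u i 0.

Lemma embedK (S : {set 'I_p}) (u : 'cV[R]_#|S|) : subcol S (embed u) = u.
Proof.
apply/colP => i; rewrite !mxE (big_pred1 i)// => l.
by rewrite /= (inj_eq enum_val_inj).
Qed.

Lemma supp_embed (S : {set 'I_p}) (u : 'cV[R]_#|S|) : supp (embed u) \subset S.
Proof.
apply/fintype.subsetP => j; rewrite inE mxE; apply: contraNT => jS.
rewrite big_pred0// => i; apply/negbTE; apply: contra jS => /eqP <-.
exact: enum_valP.
Qed.

End Auxiliary.

(** * Both parts of the theorem on a fixed favourable outcome *)

Section Deterministic.
Context {R : realType} (mu lam : R) (rho : R -> R).
Hypotheses (mu0 : 0 <= mu) (lam0 : 0 < lam) (am : amenable mu lam rho).
Context (n p k : nat) (X : 'M[R]_(n, p)) (bs : 'cV[R]_p) (eps : 'cV[R]_n).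
Context (alpha T Rad dl e1 e2 cinf : R).
Let G := sample_cov X.
Let y := X *m bs + eps.
Let S := supp bs.
Let w := noise_corr X eps.
Let B := submx_of (~: S)%SET S G *m invmx (submx_of S S G).
Hypotheses (Sk : (#|S| <= k)%N) (T0 : 0 <= T) (Grsc : rsc alpha T G).
Hypothesis alpha_gt : mu < alpha - 2 * k%:R * T.
Hypotheses (dl0 : 0 <= dl) (RadT : 4 * Rad * T <= dl) (Rad0 : 0 < Rad).
Hypotheses (bsR : l1norm bs <= Rad / 2) (e10 : 0 <= e1).
Hypothesis Ginv : inverse_bounded S cinf G.
Hypothesis noiseS : forall i,
  `|(invmx (submx_of S S G) *m subcol S w) i 0| <= e1.
Hypothesis noiseSc : forall i,
  `|(subcol (~: S)%SET w - B *m subcol S w) i 0| <= e2.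

Let cinf0 : 0 <= cinf. Proof. by case: Ginv => _; apply: le_trans (opnorm_inf_ge0 _). Qed.

Let bsS : supp bs \subset S. Proof. exact: fintype.subxx. Qed.

Let qform_supp v : supp v \subset S -> mu * dot v v <= qform G v.
Proof.
move=> vS; apply: le_trans (rsc_sparse T0 Grsc Sk vS).
rewrite ler_wpM2r ?dot_ge0//; have h := alpha_gt.
have h2 : 0 <= k%:R * T by rewrite mulr_ge0.
lra.
Qed.

(** The quadratic form pays for the [mu / 2] term of [penalty_growth]. What remains is 4/7 (|bh| -
    7/4 |bs|) <= 1/28 (|bh| + |bs|) in l1 norms, that is |bh| <= 29/15 |bs|, and 29/15 < 2.
    Strictness leaves room to move every coordinate both ways. *)
Lemma inactive_constraint bh :
  (forall j, j \in S -> `|w j 0| <= lam / 28) -> supp bh \subset S ->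
  loss X y bh + penalty rho bh <= loss X y bs + penalty rho bs ->
  l1norm bh < Rad.
Proof.
move=> wS bhS; have := loss_expand X bs eps bs (bh - bs).
rewrite (addrC bs) subrK -/y => ->.
have -> : lgrad X bs eps bs = - w by rewrite /lgrad subrr mulmx0 sub0r.
rewrite dotNl => opt.
have nuS := suppB bhS bsS.
have := dot_le_l1_supp nuS wS => /(le_trans (ler_norm _)) h1.
have h2 := qform_supp nuS.
have h3 : 4 / 7 * lam * (l1norm bh - 7 / 4 * l1norm bs) <=
    penalty rho bh - penalty rho bs + mu / 2 * dot (bh - bs) (bh - bs).
  rewrite /l1norm /penalty /dot !mulr_sumr -!sumrB -big_split/= mulr_sumr.
  apply: ler_sum => j _; rewrite !mxE -expr2.
  exact: (penalty_growth mu0 am).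
have h4 := l1norm_triangle bh (- bs); rewrite l1normN in h4.
have l28 : 0 <= lam / 28 by rewrite divr_ge0// ltW.
have h5 := ler_wpM2l l28 h4.
have h6 : lam * (15 / 28 * l1norm bh) <= lam * (29 / 28 * l1norm bs).
  rewrite -/G in opt; lra.
rewrite ler_pM2l// in h6.
have h7 := bsR; have h8 := Rad0; lra.
Qed.

Lemma deterministic_incoherent eta :
  (forall j, j \in S -> `|w j 0| <= lam / 28) ->
  incoherent S eta G -> e2 + eta * lam <= lam - 2 * dl ->
  exists bh, [/\ unique (stationary X y rho Rad) bh,
    global_optimum X y rho Rad bh, supp bh \subset S &
    `|bh - bs| <= e1 + cinf * lam].
Proof.
move=> wS inc e2l; have crho : continuous rho by case: am.
have bsF : feasible Rad bs.
  by have h := bsR; have h2 := Rad0; rewrite /feasible; lra.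
have [bh [bhS bhF bh_min]] := restricted_minimizer X bs eps S crho (ltW Rad0).
have bh_lt := inactive_constraint wS bhS (bh_min _ bsS bsF).
pose q := - lgrad X bs eps bh.
have q_sub j : j \in S -> subgradient lam rho (bh j 0) (q j 0).
  move=> jS; rewrite [q j 0]mxE.
  (* The radius is the room left in the l1-ball, so that every perturbation of the single coordinate
     [j] remains feasible. *)
  apply: (subgradient_of_local_min am (c := 2^-1 * qform G (delta_mx j 0))
    (r := Rad - l1norm bh)).
    by rewrite subr_gt0.
  move=> t tr.
  have tF : feasible Rad (bh + t *: delta_mx j 0).
    rewrite /feasible (le_trans (l1norm_triangle _ _))// l1norm_delta; lra.
  have := bh_min _ (suppD bhS (supp_delta t jS)) tF.
  rewrite loss_expand dotZr dot_delta -/G.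
  have -> : qform G (t *: delta_mx j 0) = t ^+ 2 * qform G (delta_mx j 0).
    by rewrite /qform -scalemxAr dotZl dotZr expr2 mulrA.
  have := penalty_delta rho bh j t; lra.
have qS i : `|subcol S q i 0| <= lam.
  rewrite mxE; apply: (subgradient_norm am (q_sub _ _)); exact: enum_valP.
have Gunit : submx_of S S G \in unitmx by case: Ginv.
have q_strict j : j \notin S -> `|q j 0| <= lam - 2 * dl.
  move=> jS; have jSc : j \in (~: S)%SET by rewrite inE.
  rewrite (subcolE q jSc) (witness_dual eps Gunit bhS) -/G -/B -/w mxE.
  rewrite (le_trans (ler_normD _ _))// (le_trans _ e2l)// lerD//.
  rewrite (le_trans (norm_mulmx_le _ _ qS))// ler_wpM2r// ltW//.
have gE : lgrad X bs eps bh = - q by rewrite opprK.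
exists bh; split.
- exact: (witness_unique mu0 am Sk T0 Grsc alpha_gt dl0 RadT bhS bhF gE q_sub q_strict).
- exact: (witness_global mu0 am Sk T0 Grsc alpha_gt dl0 RadT bhS bhF gE q_sub q_strict).
- exact: bhS.
apply: mx_norm_le; first by rewrite addr_ge0// mulr_ge0// ltW.
move=> j l; rewrite (ord1 l); have [jS|jS] := boolP (j \in S); last first.
  rewrite (suppN0 (suppB bhS bsS) jS) normr0.
  by rewrite addr_ge0// mulr_ge0// ltW.
rewrite (subcolE _ jS) (witness_error eps Gunit bhS) -/G -/w [X in `|X|]mxE.
rewrite (le_trans (ler_normD _ _))// lerD//.
rewrite mxE normrN (le_trans (norm_mulmx_le _ _ qS))// ler_wpM2r ?(ltW lam0)//.
by case: Ginv.
Qed.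

(** The normal equations of the oracle make [q] vanish on [S]. The lower bound on the entries of
    [bs] keeps those of the oracle at size at least [gam * lam], where the penalty is flat, so 0 is
    the right subgradient and the certificate outside [S] is pure noise. *)
Lemma deterministic_oracle gam : 0 < gam ->
  (forall t, gam * lam <= t -> derive1 rho t = 0) ->
  (forall j, j \in S -> lam * gam + e1 <= `|bs j 0|) -> e2 <= lam - 2 * dl ->
  exists bh, [/\ unique (stationary X y rho Rad) bh, unique (oracle X y S) bh &
    `|bh - bs| <= e1].
Proof.
move=> gam0 flat bmin e2l.
have Gunit : submx_of S S G \in unitmx by case: Ginv.
pose u := invmx (submx_of S S G) *m subcol S w.
pose bh := bs + embed u.
have bhS : supp bh \subset S := suppD bsS (supp_embed u).
have nuE : bh - bs = embed u by rewrite /bh addrAC subrr add0r.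
pose q := - lgrad X bs eps bh.
have qS : subcol S q = 0.
  have : subcol S (G *m (bh - bs)) = subcol S w.
    rewrite nuE -(submx_of_mulmx S G (supp_embed u)) embedK /u mulmxA.
    by rewrite mulmxV// mul1mx.
  move/colP => H; apply/colP => i; have := H i.
  by rewrite /q /lgrad -/G -/w !mxE => ->; rewrite subrr oppr0.
have qS0 j : j \in S -> q j 0 = 0 by move=> jS; rewrite (subcolE q jS) qS mxE.
have nu_le j : j \in S -> `|(bh - bs) j 0| <= e1.
  by move=> jS; rewrite (subcolE _ jS) nuE embedK.
have bh_ge j : j \in S -> gam * lam <= `|bh j 0|.
  move=> jS; have h1 := nu_le j jS; have h2 := bmin j jS.
  have -> : bh j 0 = bs j 0 + (bh - bs) j 0.
    by rewrite [(bh - bs) j 0]mxE [(- bs) j 0]mxE; ring.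
  have h3 := lerB_normD (bs j 0) ((bh - bs) j 0); lra.
have gl0 : 0 < gam * lam by rewrite mulr_gt0.
have q_sub j : j \in S -> subgradient lam rho (bh j 0) (q j 0).
  move=> jS; rewrite qS0//; have bj := bh_ge j jS.
  have bj0 : bh j 0 != 0 by rewrite -normr_gt0 (lt_le_trans gl0).
  rewrite /subgradient (negbTE bj0).
  case: (ltgtP (bh j 0) 0) bj0 bj => // [bn|bp] bj0.
    rewrite ltr0_norm// => /flat; rewrite (derive_penaltyN am) ?lt_eqF// => /eqP.
    by rewrite oppr_eq0 => /eqP.
  by rewrite gtr0_norm// => /flat.
have q_strict j : j \notin S -> `|q j 0| <= lam - 2 * dl.
  move=> jS; have jSc : j \in (~: S)%SET by rewrite inE.
  rewrite (subcolE q jSc) (witness_dual eps Gunit bhS) -/G -/B -/w -/q qS mulmx0 addr0.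
  exact: le_trans (noiseSc _) e2l.
have bhF : feasible Rad bh.
  rewrite /feasible (_ : bh = bs + (bh - bs)); last by rewrite addrC subrK.
  rewrite (le_trans (l1norm_triangle _ _))//.
  (* Each error on [S] is below the corresponding entry of [bs], so the l1 norm at most doubles, and
     [l1norm bs <= Rad / 2]. *)
  suff : l1norm (bh - bs) <= l1norm bs by have h := bsR; lra.
  rewrite (l1norm_supp (suppB bhS bsS)) (l1norm_supp bsS).
  apply: ler_sum => j jS; rewrite (le_trans (nu_le j jS))// (le_trans _ (bmin j jS))//.
  by rewrite lerDr mulrC ltW.
have gE : lgrad X bs eps bh = - q by rewrite opprK.
have lossE b : supp b \subset S ->
    loss X y b = loss X y bh + 2^-1 * qform G (b - bh).
  move=> bS; have := loss_expand X bs eps bh (b - bh).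
  rewrite (addrC bh) subrK gE dotNl (dot_supp0 (suppB bS bhS) qS0).
  by rewrite oppr0 addr0.
have qf0 b : supp b \subset S -> 0 <= qform G (b - bh).
  move=> bS; apply: le_trans (qform_supp (suppB bS bhS)).
  by rewrite mulr_ge0// dot_ge0.
exists bh; split.
- exact: (witness_unique mu0 am Sk T0 Grsc alpha_gt dl0 RadT bhS bhF gE q_sub q_strict).
- split.
    split => // b bS; rewrite (lossE b bS) lerDl mulr_ge0 ?invr_ge0//.
    exact: qf0.
  move=> b [bS /(_ bh bhS)]; rewrite (lossE b bS) gerDl => h.
  have h2 := rsc_sparse T0 Grsc Sk (suppB bS bhS).
  have h3 : 0 < alpha - k%:R * T.
    have h4 := alpha_gt; have h5 := mu0; have h6 := mulr_ge0 (ler0n R k) T0.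
    lra.
  have : dot (b - bh) (b - bh) <= 0.
    by rewrite -(pmulr_rle0 _ h3); rewrite -/G in h2; lra.
  by move/dot_eq0/eqP; rewrite subr_eq0 => /eqP.
apply: mx_norm_le => // j l; rewrite (ord1 l).
have [jS|jS] := boolP (j \in S); first exact: nu_le.
by rewrite (suppN0 (suppB bhS bsS) jS) normr0.
Qed.

End Deterministic.

(** * Maurey's method and noise maps *)

Section Maurey.
Context {R : realType} (p : nat).

Lemma qformD (M : 'M[R]_p) u v : M^T = M ->
  qform M (u + v) = qform M u + 2 * dot u (M *m v) + qform M v.
Proof.
move=> Ms; rewrite /qform mulmxDr !(dotDl, dotDr).
rewrite (_ : dot v (M *m u) = dot u (M *m v)); first by ring.
by rewrite dotC [RHS]dot_mulmx Ms.
Qed.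

Lemma qformZ (M : 'M[R]_p) a v : qform M (a *: v) = a ^+ 2 * qform M v.
Proof. by rewrite /qform -scalemxAr dotZl dotZr expr2 mulrA. Qed.

Lemma qform_delta (M : 'M[R]_p) j : qform M (delta_mx j 0) = M j j.
Proof. by rewrite /qform dotC dot_delta -colE mxE. Qed.

Lemma qform_subr_scalar (M : 'M[R]_p) a v :
  qform (M - a%:M) v = qform M v - a * dot v v.
Proof. by rewrite /qform mulmxBl mul_scalar_mx dotDr dotNr dotZr. Qed.

Lemma dot_sumr (I : finType) (u : 'cV[R]_p) (F : I -> 'cV[R]_p) :
  dot u (\sum_i F i) = \sum_i dot u (F i).
Proof.
apply: (big_morph (dot u)) => [x y|]; first exact: dotDr.
by apply: big1 => j _; rewrite mxE mulr0.
Qed.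

(* Maurey's empirical method: [q] is the law of a random vector [U i] with
   mean [m], and the conclusion computes the expectation of the quadratic form
   at [a] plus the sum of [s] independent copies. *)
Lemma maurey_average (I : finType) (M : 'M[R]_p) (U : I -> 'cV[R]_p)
    (q : I -> R) (m a : 'cV[R]_p) (s : nat) : M^T = M ->
  (forall i, 0 <= q i) -> \sum_i q i = 1 -> \sum_i q i *: U i = m ->
  (forall f : seq I, size f = s -> 0 <= qform M (a + \sum_(i <- f) U i)) ->
  0 <= qform M a + 2 * s%:R * dot a (M *m m) + s%:R * (s%:R - 1) * qform M m
    + s%:R * \sum_i q i * qform M (U i).
Proof.
move=> Ms q0 q1 mE; set D := \sum_i q i * _.
elim: s a => [|s IH] a H.
  have := H [::] erefl; rewrite big_nil addr0 => h.
  by rewrite !(mulr0, mul0r, addr0).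
(* The first of the [s + 1] draws is moved into [a]; averaging over it with the weights [q] closes
   the induction. *)
have Hi i : 0 <= qform M (a + U i) + 2 * s%:R * dot (a + U i) (M *m m)
    + s%:R * (s%:R - 1) * qform M m + s%:R * D.
  apply: IH => f fs; have := H (i :: f); rewrite /= fs => /(_ erefl).
  by rewrite big_cons addrA.
pose c := qform M a + 2 * s%:R * dot a (M *m m)
    + s%:R * (s%:R - 1) * qform M m + s%:R * D.
have : 0 <= \sum_i (q i * c + 2 * (q i * dot a (M *m U i)) + q i * qform M (U i)
    + 2 * s%:R * (q i * dot (M *m m) (U i))).
  apply: sumr_ge0 => i _; have := mulr_ge0 (q0 i) (Hi i).
  by rewrite qformD// dotDl (dotC (U i)) /c; lra.
rewrite !big_split/= -mulr_suml q1 mul1r -!mulr_sumr -/D.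
have -> : \sum_i q i * dot a (M *m U i) = dot a (M *m m).
  rewrite -mE mulmx_sumr dot_sumr; apply: eq_bigr => i _.
  by rewrite -scalemxAr dotZr.
have -> : \sum_i q i * dot (M *m m) (U i) = qform M m.
  have -> : qform M m = dot (M *m m) (\sum_i q i *: U i) by rewrite mE /qform dotC.
  rewrite dot_sumr; apply: eq_bigr => i _.
  by rewrite dotZr.
by rewrite /c -natr1; lra.
Qed.

(** The average of Maurey's method without the division by the length: the inequality to be checked
    is homogeneous. *)
Definition signed_sum (f : seq (bool * 'I_p)) : 'cV[R]_p :=
  \sum_(x <- f) ((-1) ^+ x.1 *: delta_mx x.2 0).

(** The vector [v / |v|_1] is the mean of a random signed coordinate vector. Averaging the form of
    [G - alpha] over sums of [s] draws gives [s (s - 1)] times its value at the mean, from pairs of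
    distinct draws, plus at most [s * C] from the diagonal. Dividing by [s (s - 1)] and rescaling
    gives the tolerance. *)
Lemma maurey_rsc (G : 'M[R]_p) (alpha C : R) (s : nat) : G^T = G ->
  0 <= alpha -> 0 <= C -> (1 < s)%N -> (forall j, G j j <= C) ->
  (forall f, size f = s ->
    alpha * dot (signed_sum f) (signed_sum f) <= qform G (signed_sum f)) ->
  rsc alpha (C / (s%:R - 1)) G.
Proof.
move=> Gs a0 C0 s1 GC H v.
have s10 : 0 < s%:R - 1 :> R by rewrite subr_gt0 ltr1n.
have [v0|v0] := eqVneq (l1norm v) 0.
  have -> : v = 0.
    apply/colP => j; rewrite mxE; apply/eqP; rewrite -normr_le0 -v0.
    by rewrite /l1norm (bigD1 j)//= lerDl sumr_ge0.
  rewrite /qform mulmx0 /dot big1 ?mulr0; last by move=> j _; rewrite mxE mul0r.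
  rewrite sub0r oppr_le0 mulr_ge0 ?sqr_ge0// divr_ge0// ltW//.
have {v0} r0 : 0 < l1norm v by rewrite lt_neqAle eq_sym v0 l1norm_ge0.
set r := l1norm v in r0 *.
pose M := G - alpha%:M.
have Ms : M^T = M by rewrite /M linearB/= Gs tr_scalar_mx.
pose sg (j : 'I_p) := v j 0 < 0.
pose U (j : 'I_p) : 'cV[R]_p := (-1) ^+ sg j *: delta_mx j 0.
pose q (j : 'I_p) := `|v j 0| / r.
have q0 j : 0 <= q j by rewrite divr_ge0// ltW.
have q1 : \sum_j q j = 1 by rewrite -mulr_suml divff// gt_eqF.
have mE : \sum_j q j *: U j = r^-1 *: v.
  apply/colP => l; rewrite summxE (bigD1 l)//= !mxE !eqxx mulr1 big1 ?addr0.
    by rewrite /q mulrAC [X in X / _]mulrC mulr_sign_norm mulrC.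
  by move=> j jl; rewrite !mxE eq_sym (negbTE jl) !mulr0.
have := maurey_average (s := s) (a := 0) Ms q0 q1 mE.
have hyp f : size f = s -> 0 <= qform M (0 + \sum_(i <- f) U i).
  move=> fs; rewrite add0r /M qform_subr_scalar subr_ge0.
  have := H [seq (sg j, j) | j <- f]; rewrite size_map fs => /(_ erefl).
  by rewrite /signed_sum big_map.
move=> /(_ hyp) /=.
have -> : qform M (0 : 'cV_p) = 0 by rewrite /qform mulmx0 /dot big1// => j _; rewrite mxE mul0r.
have -> : dot (0 : 'cV_p) (M *m (r^-1 *: v)) = 0 by rewrite /dot big1// => j _; rewrite mxE mul0r.
rewrite mulr0 !add0r qformZ => h.
have DC : \sum_j q j * qform M (U j) <= C.
  rewrite -[leRHS]mul1r -q1 mulr_suml; apply: ler_sum => j _; apply: ler_wpM2l => //.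
  rewrite /U qformZ -exprM mulnC exprM sqrrN expr1n expr1n mul1r qform_delta.
  rewrite !mxE eqxx mulr1n; have := GC j; lra.
have sp : 0 < s%:R :> R by rewrite ltr0n; case: s s1 {s10 H h hyp}.
have h2 : 0 <= (s%:R - 1) * (r^-1 ^+ 2 * qform M v) + C.
  have : 0 <= s%:R * ((s%:R - 1) * (r^-1 ^+ 2 * qform M v) + \sum_j q j * qform M (U j)).
    by lra.
  rewrite pmulr_rge0// => /le_trans; apply; lra.
have h3 : 0 <= qform M v + C / (s%:R - 1) * r ^+ 2.
  have : 0 <= (r ^+ 2 / (s%:R - 1)) * ((s%:R - 1) * (r^-1 ^+ 2 * qform M v) + C).
    by rewrite mulr_ge0// divr_ge0 ?sqr_ge0// ltW.
  congr (0 <= _); field; rewrite ?gt_eqF//.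
by move: h3; rewrite /M qform_subr_scalar; lra.
Qed.

End Maurey.

Section NoiseMaps.
Context {R : realType} (n p : nat).
Implicit Types (X : 'M[R]_(n, p)) (S A B : {set 'I_p}).

Definition col_set A X : 'M[R]_(#|A|, n) := \matrix_(i, l) X l (enum_val i).

Definition noise_map_in S X : 'M[R]_(#|S|, n) :=
  n%:R^-1 *: (invmx (submx_of S S (sample_cov X)) *m col_set S X).

(** When the block on [S] is invertible, the rows are, up to [1 / n], the least-squares residuals of
    the columns outside [S] on those in [S]. *)
Definition noise_map_out S X : 'M[R]_(#|(~: S)%SET|, n) :=
  n%:R^-1 *: (col_set (~: S)%SET X -
    submx_of (~: S)%SET S (sample_cov X) *m
    invmx (submx_of S S (sample_cov X)) *m col_set S X).

Definition noise_map_all X : 'M[R]_(p, n) := n%:R^-1 *: X^T.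

Definition row_energy m (M : 'M[R]_(m, n)) i : R := \sum_l M i l ^+ 2.

Lemma row_energyE m (M : 'M[R]_(m, n)) i : row_energy M i = (M *m M^T) i i.
Proof. by rewrite mxE; apply: eq_bigr => l _; rewrite mxE expr2. Qed.

Lemma row_energy_ge0 m (M : 'M[R]_(m, n)) i : 0 <= row_energy M i.
Proof. by apply: sumr_ge0 => l _; rewrite sqr_ge0. Qed.

Lemma row_energyZ m (M : 'M[R]_(m, n)) a i :
  row_energy (a *: M) i = a ^+ 2 * row_energy M i.
Proof. by rewrite mulr_sumr; apply: eq_bigr => l _; rewrite mxE exprMn. Qed.

Lemma subcol_noise_corr A X eps :
  subcol A (noise_corr X eps) = n%:R^-1 *: (col_set A X *m eps).
Proof.
apply/colP => i; rewrite !mxE; congr (_ * _); apply: eq_bigr => l _.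
by rewrite !mxE.
Qed.

Lemma noise_map_allE X eps : noise_map_all X *m eps = noise_corr X eps.
Proof. by rewrite /noise_map_all -scalemxAl. Qed.

Lemma noise_map_inE S X eps : noise_map_in S X *m eps =
  invmx (submx_of S S (sample_cov X)) *m subcol S (noise_corr X eps).
Proof. by rewrite subcol_noise_corr -scalemxAl -scalemxAr mulmxA. Qed.

Lemma noise_map_outE S X eps : noise_map_out S X *m eps =
  subcol (~: S)%SET (noise_corr X eps) -
  submx_of (~: S)%SET S (sample_cov X) *m invmx (submx_of S S (sample_cov X))
  *m subcol S (noise_corr X eps).
Proof.
by rewrite !subcol_noise_corr -scalemxAl mulmxBl scalerBr -scalemxAr !mulmxA.
Qed.

Lemma col_set_mul A B X : (0 < n)%N ->
  col_set A X *m (col_set B X)^T = n%:R *: submx_of A B (sample_cov X).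
Proof.
move=> n0; apply/matrixP => i j; rewrite !mxE mulrA divff ?mul1r; last first.
  by rewrite pnatr_eq0 -lt0n.
by apply: eq_bigr => l _; rewrite !mxE.
Qed.

Lemma submx_of_tr A B (G : 'M[R]_p) : G^T = G -> (submx_of A B G)^T = submx_of B A G.
Proof. by move=> Gs; apply/matrixP => i j; rewrite !mxE -[in RHS]Gs mxE. Qed.

Lemma dot_subcol S (u v : 'cV[R]_p) : supp u \subset S ->
  dot u v = dot (subcol S u) (subcol S v).
Proof.
move=> uS; rewrite /dot (bigID (mem S))/= [X in _ + X]big1 ?addr0; last first.
  by move=> j jS; rewrite (suppN0 uS jS) mul0r.
by rewrite big_enum_val/=; apply: eq_bigr => j _; rewrite !mxE.
Qed.

(** The energy is [z / n] with [z] a diagonal entry of the inverse block. Testing the form at [u],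
    the [i]-th column of that inverse, gives [c z^2 <= c |u|^2 <= u_i = z]. *)
Lemma noise_map_in_energy S X c i : (0 < n)%N -> 0 < c ->
  submx_of S S (sample_cov X) \in unitmx ->
  (forall v : 'cV[R]_p, supp v \subset S ->
    c * dot v v <= qform (sample_cov X) v) ->
  row_energy (noise_map_in S X) i <= (n%:R * c)^-1.
Proof.
move=> n0 c0; set G := sample_cov X; set g := submx_of S S G => gU H.
have nR : 0 < n%:R :> R by rewrite ltr0n.
have gs : g^T = g by apply: submx_of_tr; exact: sample_cov_sym.
rewrite row_energyZ row_energyE trmx_mul mulmxA -(mulmxA (invmx g)) col_set_mul//.
rewrite -/G -/g -scalemxAr -scalemxAl mulVmx// mul1mx trmx_inv gs mxE.
set z := invmx g i i.
suff zc : z <= c^-1.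
  rewrite invfM expr2 -mulrA mulKf ?gt_eqF//.
  by rewrite ler_pM2l ?invr_gt0.
pose u := invmx g *m (delta_mx i 0 : 'cV_#|S|).
have zE : u i 0 = z by rewrite /u -colE mxE.
have := H (embed u) (supp_embed u); rewrite /qform.
rewrite !(dot_subcol _ (supp_embed u)) -(submx_of_mulmx _ _ (supp_embed u)) !embedK.
rewrite /u mulmxA mulmxV// mul1mx -/u dot_delta zE => h.
have h2 : c * z ^+ 2 <= z.
  apply: le_trans h; rewrite ler_pM2l// /dot (bigD1 i)//= zE -expr2 lerDl.
  by apply: sumr_ge0 => l _; rewrite -expr2 sqr_ge0.
have [z0|z0] := leP z 0; first by rewrite (le_trans z0)// invr_ge0 ltW.
rewrite -[leRHS]mul1r ler_pdivlMr// mulrC -(@ler_pM2r _ z)// mul1r -mulrA -expr2//.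
Qed.

(** Pythagoras: the residuals are orthogonal to the columns in [S], so they are no longer than the
    original columns. *)
Lemma noise_map_out_energy S X C i : (0 < n)%N ->
  submx_of S S (sample_cov X) \in unitmx ->
  (forall j, sample_cov X j j <= C) ->
  row_energy (noise_map_out S X) i <= C / n%:R.
Proof.
move=> n0; set G := sample_cov X; set g := submx_of S S G => gU GC.
have nR : 0 < n%:R :> R by rewrite ltr0n.
set A := col_set (~: S)%SET X; set B := col_set S X.
set K := submx_of (~: S)%SET S G *m invmx g.
have E : A *m A^T = (A - K *m B) *m (A - K *m B)^T + (K *m B) *m (K *m B)^T.
  have o : (A - K *m B) *m B^T = 0.
    rewrite mulmxBl -mulmxA !col_set_mul// -/G -/g -scalemxAr /K -mulmxA.
    by rewrite mulVmx// mulmx1 subrr.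
  have o2 : (A - K *m B) *m (K *m B)^T = 0 by rewrite trmx_mul mulmxA o mul0mx.
  have o3 : (K *m B) *m (A - K *m B)^T = 0.
    by rewrite -[LHS]trmxK trmx_mul trmxK o2 trmx0.
  rewrite -{1 2}(subrK (K *m B) A); set V := A - K *m B in o o2 o3 *.
  by rewrite linearD/= mulmxDl !mulmxDr o2 o3 addr0 add0r.
rewrite row_energyZ row_energyE -/A -/B -/G -/g -/K.
have h : ((A - K *m B) *m (A - K *m B)^T) i i <= (A *m A^T) i i.
  by rewrite E [leRHS]mxE lerDl -row_energyE row_energy_ge0.
rewrite expr2 -mulrA [leRHS]mulrC ler_pM2l ?invr_gt0//.
rewrite mulrC ler_pdivrMr// (le_trans h)// col_set_mul// !mxE mulrC.
by rewrite ler_pM2r//; have := GC (enum_val i); rewrite /G !mxE.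
Qed.

Lemma noise_map_all_energy X C i : (0 < n)%N ->
  (forall j, sample_cov X j j <= C) ->
  row_energy (noise_map_all X) i <= C / n%:R.
Proof.
move=> n0 GC; have nR : 0 < n%:R :> R by rewrite ltr0n.
rewrite row_energyZ row_energyE expr2 -mulrA [leRHS]mulrC ler_pM2l ?invr_gt0//.
by have := GC i; rewrite mxE trmxK.
Qed.

(** A kernel vector of the block, extended by zero, has zero quadratic form, so it vanishes. *)
Lemma submx_of_unit S (G : 'M[R]_p) c : 0 < c ->
  (forall v : 'cV[R]_p, supp v \subset S -> c * dot v v <= qform G v) ->
  submx_of S S G \in unitmx.
Proof.
move=> c0 H; rewrite -unitmx_tr -row_free_unit -kermx_eq0.
apply/eqP/row_matrixP => i; rewrite row0.
set r := row i _; have : r *m (submx_of S S G)^T = 0.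
  by rewrite /r -row_mul mulmx_ker row0.
move/(congr1 trmx); rewrite trmx_mul trmxK trmx0 => h.
have := H (embed r^T) (supp_embed _); rewrite /qform.
rewrite !(dot_subcol _ (supp_embed _)) -(submx_of_mulmx _ _ (supp_embed _)) !embedK h.
rewrite [leRHS](_ : _ = 0); last by rewrite /dot big1// => j _; rewrite [X in _ * X]mxE mulr0.
by rewrite pmulr_rle0// => /dot_eq0 /(congr1 trmx); rewrite trmxK trmx0.
Qed.

End NoiseMaps.

Section Rayleigh.
Context {R : realType} (p : nat).
Implicit Types (A B : 'M[R]_p) (v : 'cV[R]_p).

Lemma continuous_qform A : continuous (fun b : 'rV[R]_p => qform A b^T).
Proof.
have cstC (c : R) : continuous (fun _ : 'rV[R]_p => c) by exact: cst_continuous.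
have coordC j : continuous (fun b : 'rV[R]_p => b 0 j) by exact: coord_continuous.
have GC i : continuous (fun b : 'rV[R]_p => \sum_j A i j * b 0 j).
  by apply: continuous_sumr => j; exact: continuous_mulr (cstC _) (coordC j).
rewrite (_ : (fun _ => _) = fun b : 'rV[R]_p => \sum_i b 0 i * \sum_j A i j * b 0 j).
  by apply: continuous_sumr => i; exact: continuous_mulr (coordC i) (GC i).
apply/funext => b; apply: eq_bigr => i _; rewrite !mxE; congr (_ * _).
by apply: eq_bigr => j _; rewrite mxE.
Qed.

Lemma psd_qform0 B v : B^T = B -> (forall u, 0 <= qform B u) -> qform B v = 0 ->
  B *m v = 0.
Proof.
move=> Bs Bpsd v0; apply: dot_eq0; set u := B *m v; set s := dot u u.
set c := qform B u; have c0 : 0 <= c by exact: Bpsd.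
have c1 : 0 < c + 1 by rewrite ltr_wpDl.
(* A short step from [v] against [B *m v] would make the form negative; the denominator [c + 1] also
   covers [c = 0]. *)
have := Bpsd (v + (- (s / (c + 1))) *: u).
rewrite qformD// qformZ v0 add0r -scalemxAr dotZr -/c.
have -> : dot v (B *m u) = s by rewrite dot_mulmx Bs.
have -> : 2 * (- (s / (c + 1)) * s) + (- (s / (c + 1))) ^+ 2 * c =
   - ((s / (c + 1)) ^+ 2 * (c + 2)) by field; rewrite gt_eqF.
rewrite oppr_ge0 => h; have [//|s0] := leP s 0.
suff : 0 < (s / (c + 1)) ^+ 2 * (c + 2) by rewrite ltNge h.
by rewrite mulr_gt0 ?exprn_gt0 ?divr_gt0//; lra.
Qed.

(** Rayleigh principle: the form attains a minimum [m] on the unit sphere, [A - m] is positive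
    semidefinite with value zero at the minimizer, so the minimizer is an eigenvector and the
    infimum of the eigenvalues is at most [m]. *)
Lemma lambda_min_qform A kappa v : A^T = A -> kappa <= lambda_min A ->
  kappa * dot v v <= qform A v.
Proof.
move=> As kA; have [->|v0] := eqVneq v 0.
  by rewrite /qform mulmx0 /dot !big1 ?mulr0// => j _; rewrite mxE mulr0.
have dotv (u : 'cV[R]_p) : u != 0 -> 0 < dot u u.
  move=> u0; rewrite lt_neqAle dot_ge0 andbT eq_sym.
  by apply: contra u0 => /eqP u0; apply/eqP/dot_eq0; rewrite u0.
have qI (b : 'cV[R]_p) : qform 1%:M b = dot b b by rewrite /qform mul1mx.
pose nrm (u : 'cV[R]_p) : 'cV[R]_p := (Num.sqrt (dot u u))^-1 *: u.
have nrm1 (u : 'cV[R]_p) : u != 0 -> dot (nrm u) (nrm u) = 1.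
  move=> u0; rewrite dotZl dotZr mulrA -invfM -expr2 sqr_sqrtr ?dot_ge0//.
  by rewrite mulVf// gt_eqF// dotv.
pose K := [set b : 'rV[R]_p | qform 1%:M b^T = 1].
have K0 : K !=set0 by exists (nrm v)^T; rewrite /K /= trmxK qI nrm1.
have Kc : compact K.
  apply: bounded_closed_compact.
    exists 1; split; first exact: num_real.
    move=> r r1 b; rewrite /K/= qI => Kb.
    apply: mx_norm_le => [|i j]; first by rewrite ltW// (lt_trans _ r1).
    rewrite (ord1 i) (le_trans _ (ltW r1))// -(@expr_le1 _ 2)//.
    rewrite real_normK ?num_real// -Kb /dot (bigD1 j)//= !mxE -expr2 lerDl.
    by apply: sumr_ge0 => l _; rewrite -expr2 sqr_ge0.
  rewrite (_ : K = (fun b : 'rV[R]_p => qform 1%:M b^T) @^-1` [set 1])//.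
  apply: closed_comp => [b _|]; [exact: continuous_qform|exact: closed_eq].
have [c] := EVT_min_rV K0 Kc (continuous_subspaceT (@continuous_qform A)).
rewrite inE /K /= qI => c1 cmin; pose m := qform A c^T.
have mA u : m * dot u u <= qform A u.
  have [->|u0] := eqVneq u 0.
    by rewrite /qform mulmx0 /dot !big1 ?mulr0// => j _; rewrite mxE mulr0.
  have := cmin (nrm u)^T; rewrite inE /K /= trmxK qI nrm1// => /(_ erefl).
  rewrite qformZ exprVn sqr_sqrtr ?dot_ge0// mulrC ler_pdivlMr ?dotv//.
have Bs : (A - m%:M)^T = A - m%:M by rewrite linearB/= As tr_scalar_mx.
have Bc : (A - m%:M) *m c^T = 0.
  apply: psd_qform0 => // [u|]; rewrite qform_subr_scalar; first by rewrite subr_ge0.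
  by rewrite c1 mulr1 subrr.
have Am : eigenvalue A m.
  apply/eigenvalueP; exists c.
    apply: trmx_inj; rewrite trmx_mul As linearZ/=; apply/eqP.
    by rewrite -subr_eq0 -mul_scalar_mx -mulmxBl Bc.
  apply: contra_eqN c1 => /eqP ->.
  by rewrite trmx0 /dot big1 1?eq_sym ?oner_eq0// => j _; rewrite mxE mulr0.
have lm : lambda_min A <= m.
  (* The infimum of a real set is meaningful only if the set is bounded below; [m] is a lower bound
     of all eigenvalues. *)
  apply: ge_inf => //; exists m => a /eigenvalueP[u uA u0].
  have ut0 : u^T != 0 by rewrite -trmx0 (inj_eq trmx_inj).
  have := mA u^T; rewrite /qform.
  have -> : A *m u^T = a *: u^T by rewrite -[A in LHS]As -trmx_mul uA linearZ.
  by rewrite dotZr ler_pM2r// dotv.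
by apply: le_trans (mA v); rewrite ler_wpM2r ?dot_ge0// (le_trans kA).
Qed.

End Rayleigh.

(** * Sub-Gaussian variables *)

Section WeightedLaw.
Import HBNNSimple.
Context {R : realType} {d d' : measure_display} {Omega : measurableType d}.
Context {T : measurableType d'} (P : probability Omega R).
Variables (Z : Omega -> T) (W : Omega -> R) (c : R).
Hypotheses (mZ : measurable_fun setT Z) (mW : measurable_fun setT W).
Hypotheses (W0 : forall w, 0 <= W w) (c0 : 0 <= c).
Hypothesis W_indic : forall B, measurable B ->
  (\int[P]_w (W w * \1_B (Z w))%:E = c%:E * P (Z @^-1` B))%E.

(** Applied with [V = W] and with [V = 1], so that both sides of [integral_nnsfun_law] are expanded
    over the values of [g]. *)
Let integral_nnsfun_weight (V : Omega -> R) (g : {nnsfun T >-> R}) :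
  measurable_fun setT V -> (forall w, 0 <= V w) ->
  (\int[P]_w (V w * g (Z w))%:E =
   \sum_(y \in range g) y%:E * \int[P]_w (V w * \1_(g @^-1` [set y]) (Z w))%:E)%E.
Proof.
move=> mV V0.
have mI y : measurable_fun setT (fun w => \1_(g @^-1` [set y]) (Z w) : R).
  by apply: measurableT_comp => //; exact: measurable_indic.
have mVI y : measurable_fun setT (fun w => V w * \1_(g @^-1` [set y]) (Z w)).
  exact: measurable_funM.
transitivity (\int[P]_w (\sum_(y \in range g)
    (y * (V w * \1_(g @^-1` [set y]) (Z w)))%:E))%E.
  apply: eq_integral => w _; rewrite fimfunE fsumEFin//; congr EFin.
  by rewrite mulr_fsumr; apply: eq_fsbigr => y _; rewrite mulrCA.
rewrite ge0_integral_fsum//.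
- apply: eq_fsbigr => y; rewrite inE => -[t _ <-].
  under eq_integral do rewrite EFinM.
  rewrite ge0_integralZl_EFin//.
  + by move=> w _; rewrite lee_fin mulr_ge0.
  + exact/measurable_EFinP.
- move=> y; apply/measurable_EFinP; exact: measurable_funM.
- move=> y w _; rewrite mulrCA EFinM mule_ge0 ?lee_fin//.
  by have := @nnfun_muleindic_ge0 _ _ _ g y (Z w); rewrite -EFinM lee_fin.
Qed.

Let integral_nnsfun_law (g : {nnsfun T >-> R}) :
  (\int[P]_w (W w * g (Z w))%:E = c%:E * \int[P]_w (g (Z w))%:E)%E.
Proof.
rewrite integral_nnsfun_weight//.
have -> : (\int[P]_w (g (Z w))%:E = \int[P]_w (1 * g (Z w))%:E)%E.
  by apply: eq_integral => w _; rewrite mul1r.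
rewrite integral_nnsfun_weight// ge0_mule_fsumr; last first.
  move=> y; have [y0|y0] := leP 0 y.
    rewrite mule_ge0 ?lee_fin//; apply: integral_ge0 => w _.
    by rewrite lee_fin mulr_ge0.
  rewrite preimage_nnfun0// integral0_eq ?mule0// => w _.
  by rewrite indic0 mulr0.
apply: eq_fsbigr => y _; rewrite W_indic; last exact: measurable_sfunP.
rewrite muleCA; congr (_ * (_ * _))%E.
under eq_integral do rewrite mul1r.
rewrite (_ : (fun w => _) = (fun w => (\1_(Z @^-1` (g @^-1` [set y])) w)%:E)); last first.
  by apply/funext => w; rewrite !indicE.
rewrite integral_indic ?setIT//.
rewrite -[X in measurable X]setTI; apply: mZ => //.
Qed.

(** Extends [W_indic] from indicators to simple functions and, by monotone convergence, to
    nonnegative functions. In [expectation_prod], [W] is the product of all factors but one. *)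
Lemma integral_weighted_law (h : T -> R) : measurable_fun setT h ->
  (forall t, 0 <= h t) ->
  (\int[P]_w (W w * h (Z w))%:E = c%:E * \int[P]_w (h (Z w))%:E)%E.
Proof.
move=> mh h0; have mhE : measurable_fun setT (EFin \o h) by exact/measurable_EFinP.
pose g := nnsfun_approx measurableT mhE.
have glim t : (g n t)%:E @[n --> \oo] --> (h t)%:E.
  by apply: (cvg_nnsfun_approx measurableT mhE) => // x _; rewrite lee_fin.
have lim_int (V : Omega -> R) : measurable_fun setT V -> (forall w, 0 <= V w) ->
    (\int[P]_w (V w * g n (Z w))%:E)%E @[n --> \oo] --> (\int[P]_w (V w * h (Z w))%:E)%E.
  move=> mV V0.
  have vlim w : (V w * g n (Z w))%:E @[n --> \oo] --> (V w * h (Z w))%:E.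
    under eq_fun do rewrite EFinM.
    by rewrite EFinM; apply: cvgeZl => //; exact: glim.
  have -> : (\int[P]_w (V w * h (Z w))%:E =
     \int[P]_w (limn (fun n => (V w * g n (Z w))%:E)))%E.
    by apply: eq_integral => w _; apply/esym/cvg_lim => //; exact: vlim.
  apply: cvg_monotone_convergence => //.
  - move=> n; apply/measurable_EFinP; apply: measurable_funM => //.
    by apply: measurableT_comp.
  - by move=> n w _; rewrite lee_fin mulr_ge0.
  - by move=> w _ m n mn; rewrite lee_fin ler_wpM2l//; exact/lefP/nd_nnsfun_approx.
have l1 := lim_int W mW W0.
have l2 := lim_int (fun=> 1) (measurable_cst _) (fun=> ler01).
apply: (cvg_unique _ l1) => //.
rewrite (_ : (fun n => _) = (fun n => c%:E * \int[P]_w (g n (Z w))%:E)%E); last first.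
  by apply/funext => n; exact: integral_nnsfun_law.
apply: cvgeZl => //.
rewrite (_ : (fun n => _) = (fun n => \int[P]_w (1 * g n (Z w))%:E)%E); last first.
  by apply/funext => n; apply: eq_integral => w _; rewrite mul1r.
rewrite (_ : (\int[P]_w (h (Z w))%:E = \int[P]_w (1 * h (Z w))%:E)%E)//.
by apply: eq_integral => w _; rewrite mul1r.
Qed.

End WeightedLaw.

Section Independence.
Context {R : realType} {d : measure_display} {Omega : measurableType d}.
Context (P : probability Omega R) (n : nat) (Z : 'I_n -> Omega -> R).

Definition independent_reals : Prop :=
  forall B : 'I_n -> set R, (forall i, measurable (B i)) ->
    P (\bigcap_(i in [set: 'I_n]) (Z i @^-1` B i)) = (\prod_i P (Z i @^-1` B i))%E.

Hypotheses (mZ : forall i, measurable_fun setT (Z i)) (indep : independent_reals).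

Lemma expectation_prod (f : 'I_n -> R -> R) (a : 'I_n -> R) :
  (forall i, measurable_fun setT (f i)) -> (forall i t, 0 <= f i t) ->
  (forall i, \int[P]_w (f i (Z i w))%:E <= (a i)%:E)%E ->
  (\int[P]_w (\prod_i f i (Z i w))%:E = \prod_i \int[P]_w (f i (Z i w))%:E)%E.
Proof.
have mfZ g i : measurable_fun setT g -> measurable_fun setT (fun w => g (Z i w) : R).
  by move=> mg; apply: (measurableT_comp mg).
have intI i B : measurable B -> (\int[P]_w (\1_B (Z i w))%:E = P (Z i @^-1` B))%E.
  move=> mB; rewrite (_ : (fun w => _) = (fun w => (\1_(Z i @^-1` B) w)%:E)); last first.
    by apply/funext => w; rewrite !indicE.
  rewrite integral_indic ?setIT// -[X in measurable X]setTI; exact: mZ.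
(* Induction on the number [m] of leading factors that are general, the others being indicators. For
   [m = 0] the claim is independence itself. *)
suff H m : forall f : 'I_n -> R -> R,
    (forall i, measurable_fun setT (f i)) -> (forall i t, 0 <= f i t) ->
    (forall i, (\int[P]_w (f i (Z i w))%:E \is a fin_num)%E) ->
    (forall i : 'I_n, (m <= i)%N -> exists2 B, measurable B & f i = \1_B) ->
    (\int[P]_w (\prod_i f i (Z i w))%:E = \prod_i \int[P]_w (f i (Z i w))%:E)%E.
  move=> mf f0 fa; apply: (H n) => // [i|i].
    rewrite ge0_fin_numE ?(le_lt_trans (fa i)) ?ltry//.
    by apply: integral_ge0 => w _; rewrite lee_fin.
  by rewrite leqNgt ltn_ord.
elim: m => [|m IH] {}f mf f0 ffin fI.
  have fI' i : {B | measurable B & f i = \1_B}.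
    by apply: cid2; exact: fI.
  pose B i := s2val (fI' i).
  have mB i : measurable (B i) by exact: (s2valP (fI' i)).
  have fB i : f i = \1_(B i) by exact: (s2valP' (fI' i)).
  rewrite (eq_bigr (fun i => P (Z i @^-1` B i))); last first.
    by move=> i _; rewrite fB intI.
  rewrite -indep// -[in RHS](setIT (\bigcap_(i in _) _)) -integral_indic//; last first.
    apply: fin_bigcap_measurable => [|i _]; first exact: finite_finset.
    rewrite -[X in measurable X]setTI; exact: mZ.
  apply: eq_integral => w _; congr EFin; rewrite indicE.
  have [wB|wB] := boolP (w \in _).
    rewrite big1// => i _; rewrite fB indicE mem_set//.
    by rewrite inE in wB; exact: wB.
  move: wB; rewrite notin_setE/= => /existsNP[i /not_implyP[_ wBi]].
  by rewrite (bigD1 i)//= fB indicE memNset ?mul0r.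
have [mn|nm] := ltnP m n; last first.
  apply: IH => // i mi; have := ltn_ord i; by rewrite ltnNge (leq_trans nm mi).
pose i0 := Ordinal mn.
pose W w := \prod_(i | i != i0) f i (Z i w).
pose c := (\prod_(i | i != i0) \int[P]_w (f i (Z i w))%:E)%E.
have cfin : c \is a fin_num by rewrite /c; apply: prode_fin_num.
have int0 i : (0 <= \int[P]_w (f i (Z i w))%:E)%E.
  by apply: integral_ge0 => w _; rewrite lee_fin.
have c0 : 0 <= fine c.
  by apply: fine_ge0; rewrite /c; apply: prode_ge0 => i _.
have mW : measurable_fun setT W.
  rewrite /W; under eq_fun do rewrite -big_filter.
  by apply: measurable_prod => i _; exact: mfZ.
have W0 w : 0 <= W w by apply: prodr_ge0 => i _.
rewrite (bigD1 i0)//= -/c -{1}(fineK cfin) muleC.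
rewrite -(@integral_weighted_law _ _ _ _ _ P (Z i0) W)//.
  by apply: eq_integral => w _; rewrite (bigD1 i0)//= mulrC.
(* With an indicator in position [i0] the induction hypothesis applies, and it supplies the product
   rule on sets that [integral_weighted_law] asks for. *)
move=> B mB; pose f' i := if i == i0 then \1_B else f i.
have f'0E : f' i0 = \1_B by rewrite /f' eqxx.
have f'E i : i != i0 -> f' i = f i by move=> ii0; rewrite /f' (negbTE ii0).
have f'P (K : (R -> R) -> Prop) i : K \1_B -> K (f i) -> K (f' i).
  by move=> K1 K2; rewrite /f'; case: ifP.
have E := IH f' (fun i => f'P (measurable_fun setT) i (measurable_indic mB) (mf i)).
have {}E := E (fun i => f'P (fun g => forall t, 0 <= g t) i
  (fun t => ltac:(by rewrite indicE)) (f0 i)).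
rewrite fineK// [RHS]muleC.
have -> : (P (Z i0 @^-1` B) * c = \prod_i \int[P]_w (f' i (Z i w))%:E)%E.
  rewrite (bigD1 i0)//= f'0E intI//; congr (_ * _)%E.
  by apply: eq_bigr => i ii0; rewrite f'E.
rewrite -E.
- apply: eq_integral => w _; rewrite (bigD1 i0)//= f'0E mulrC; congr (_ * _)%:E.
  by apply: eq_bigr => i ii0; rewrite f'E.
- move=> i; rewrite /f'; case: ifP => // _; rewrite intI//.
  by rewrite fin_num_measure// -[X in measurable X]setTI; exact: mZ.
- move=> i mi; rewrite /f'; case: ifPn => [_|ii0]; first by exists B.
  apply: fI; rewrite ltn_neqAle mi andbT.
  by apply: contra ii0 => /eqP mE; apply/eqP/val_inj.
Qed.

End Independence.

Section Exponential.
Context {R : realType}.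
Implicit Types x y z : R.

Lemma expR_half_le2 : expR 2^-1 <= 2 :> R.
Proof.
have : 2^-1 <= expR (- 2^-1) :> R by apply: le_trans (expR_ge1Dx _); lra.
by rewrite expRN lef_pV2 ?posrE ?expR_gt0.
Qed.

(** For the lower tail of sums of squares: with [y = t * z ^+ 2] the expectation of the right side
    involves only second and fourth moments. *)
Lemma expRN_le y : 0 <= y -> expR (- y) <= 1 - y + y ^+ 2.
Proof.
move=> y0; have h : (1 + y / 2) ^+ 2 <= expR y.
  have -> : y = 2%:R * (y / 2) by field.
  rewrite expRM_natl [X in (1 + X / 2) ^+ 2](_ : _ = y); last by field.
  by rewrite ler_sqr ?nnegrE ?expR_ge1Dx ?expR_ge0//; lra.
rewrite expRN -[leLHS]mul1r ler_pdivrMr ?expR_gt0//.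
have h2 : 0 <= 1 - y + y ^+ 2.
  have := sqr_ge0 (y - 2^-1); rewrite !expr2; lra.
have h3 : 1 <= (1 - y + y ^+ 2) * (1 + y / 2) ^+ 2.
  have -> : (1 - y + y ^+ 2) * (1 + y / 2) ^+ 2 =
    1 + (y ^+ 2 / 4 + y * y ^+ 2 * (3 / 4) + (y ^+ 2) ^+ 2 / 4) by field.
  by rewrite lerDl !addr_ge0// ?mulr_ge0 ?sqr_ge0// ?divr_ge0.
by rewrite (le_trans h3)// ler_wpM2l.
Qed.

Lemma pow4_le_expR z : z ^+ 4 <= 24 * (expR z + expR (- z)).
Proof.
have H y : 0 <= y -> y ^+ 4 <= 24 * expR y.
  move=> y0; have := expR_ge1Dxn 3 y0; rewrite (_ : 4`! = 24)%N//.
  by rewrite -ler_pdivrMl//; lra.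
have [z0|z0] := leP 0 z.
  by have := H z z0; have := expR_ge0 (- z); lra.
have := H (- z); rewrite oppr_ge0 ltW// => /(_ isT).
by rewrite (_ : (- z) ^+ 4 = z ^+ 4); [have := expR_ge0 z; lra|ring].
Qed.

(** A discrete substitute for Gaussian averaging over the parameter of the moment generating
    function: [k] is the integer part of [|x|], the factor [expR (- k^2 / 2)] will cancel the
    sub-Gaussian bound, and [2 ^- k] makes the sum over all [k] converge. *)
Lemma expR_sqr_le_grid x : exists k : nat, expR (x ^+ 2 / 8) <=
  expR (5 / 4) / 2 ^+ k * expR (- (k%:R ^+ 2 / 2)) * (expR (k%:R * x) + expR (- (k%:R * x))).
Proof.
exists (Num.trunc `|x|); set k := Num.trunc _.
have /andP[kx xk] : k%:R <= `|x| < k.+1%:R by rewrite truncn_itv.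
have h1 : expR (k%:R * `|x|) <= expR (k%:R * x) + expR (- (k%:R * x)).
  have e1 := expR_ge0 (k%:R * x); have e2 := expR_ge0 (- (k%:R * x)).
  have [x0|x0] := leP 0 x; first by rewrite ger0_norm// lerDl.
  by rewrite ltr0_norm// mulrN lerDr.
have h2 : expR (- (k%:R : R)) <= (2 ^+ k)^-1.
  rewrite expRN lef_pV2 ?posrE ?exprn_gt0 ?expR_gt0//.
  rewrite -[k%:R]mulr1 expRM_natl lerXn2r ?nnegrE ?expR_ge0//.
  by apply: le_trans (expR_ge1Dx _); lra.
apply: (@le_trans _ _ (expR (5 / 4) * expR (- (k%:R : R)) * expR (- (k%:R ^+ 2 / 2))
    * expR (k%:R * `|x|))); last first.
  apply: ler_pM => //; rewrite ?mulr_ge0 ?expR_ge0//.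
  by rewrite ler_wpM2r ?expR_ge0// ler_wpM2l// expR_ge0.
rewrite -!expRD ler_expR.
have h3 : k%:R * k%:R <= k%:R * `|x| by rewrite ler_wpM2l.
have h4 : x ^+ 2 <= (k%:R + 1) ^+ 2.
  rewrite -[x ^+ 2]real_normK ?num_real// ler_sqr ?nnegrE ?addr_ge0//.
  by rewrite natr1 ltW.
(* After [h3] and [h4] the exponents differ by at least 3/8 (k - 5/3)^2 + 1/12; the constant 5/4 was
   chosen for this. *)
have h5 := sqr_ge0 (k%:R - 5 / 3 : R).
rewrite !expr2 in h4 h5 *; lra.
Qed.

End Exponential.

Section RealExpectation.
Context {R : realType} {d : measure_display} {Omega : measurableType d}.
Context (P : probability Omega R).
Implicit Types f g : Omega -> R.

Lemma ge0_le_expectation f g : measurable_fun setT f -> measurable_fun setT g ->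
  (forall w, 0 <= f w) -> (forall w, f w <= g w) ->
  (\int[P]_w (f w)%:E <= \int[P]_w (g w)%:E)%E.
Proof.
move=> mf mg f0 fg; apply: ge0_le_integral => //.
- by move=> w _; rewrite lee_fin.
- exact/measurable_EFinP.
- exact/measurable_EFinP.
- by move=> w _; rewrite lee_fin.
Qed.

Lemma ge0_expectationD f g : measurable_fun setT f -> measurable_fun setT g ->
  (forall w, 0 <= f w) -> (forall w, 0 <= g w) ->
  (\int[P]_w (f w + g w)%:E = \int[P]_w (f w)%:E + \int[P]_w (g w)%:E)%E.
Proof.
move=> mf mg f0 g0; under eq_integral do rewrite EFinD.
apply: ge0_integralD => //.
- by move=> w _; rewrite lee_fin.
- exact/measurable_EFinP.
- by move=> w _; rewrite lee_fin.
- exact/measurable_EFinP.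
Qed.

Lemma ge0_expectationZ f a : measurable_fun setT f -> 0 <= a ->
  (forall w, 0 <= f w) ->
  (\int[P]_w (a * f w)%:E = a%:E * \int[P]_w (f w)%:E)%E.
Proof.
move=> mf a0 f0; under eq_integral do rewrite EFinM.
apply: ge0_integralZl_EFin => //.
- by move=> w _; rewrite lee_fin.
- exact/measurable_EFinP.
Qed.

Lemma expectation_const a : (\int[P]_w a%:E = a%:E)%E.
Proof. by rewrite integral_cst//= probability_setT mule1. Qed.

Lemma markov_ge f (A : set Omega) a : measurable A -> measurable_fun setT f ->
  (forall w, 0 <= f w) -> 0 <= a -> (forall w, A w -> a <= f w) ->
  (a%:E * P A <= \int[P]_w (f w)%:E)%E.
Proof.
move=> mA mf f0 a0 Af; have mI : measurable_fun setT (\1_A : Omega -> R) by exact: measurable_indic.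
apply: (@le_trans _ _ (\int[P]_w (a * \1_A w)%:E)%E).
  rewrite ge0_expectationZ// integral_indic// setIT//.
apply: ge0_le_expectation => //.
- exact: measurable_funM.
- by move=> w; rewrite mulr_ge0// indicE.
- move=> w; rewrite indicE; have [wA|wA] := boolP (w \in A).
    by rewrite mulr1 Af//; exact: set_mem.
  by rewrite mulr0.
Qed.

End RealExpectation.

Section Subgaussian.
Context {R : realType} {d : measure_display} {Omega : measurableType d}.
Context (P : probability Omega R) (sigma : R) (Z : Omega -> R).
Hypotheses (sigma0 : 0 < sigma) (mZ : measurable_fun setT Z).
Hypothesis sgZ : zero_mean_subgaussian P sigma Z.

Lemma subgaussian_expR t :
  (\int[P]_w (expR (t * Z w))%:E <= (expR (sigma ^+ 2 * t ^+ 2 / 2))%:E)%E.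
Proof.
case: sgZ => _ /(_ t); rewrite /mmt_gen_fun unlock; apply: le_trans.
by under eq_integral do rewrite mulrC.
Qed.

Lemma measurable_expR_scale t : measurable_fun setT (fun w => expR (t * Z w)).
Proof.
apply: measurableT_comp => //; exact: measurable_funM.
Qed.

(** [pow4_le_expR] at [Z / sigma]: each of the two exponentials has expectation at most
    [expR (1 / 2) <= 2], and 24 (2 + 2) = 96. *)
Lemma subgaussian_fourth_moment :
  (\int[P]_w (Z w ^+ 4)%:E <= (96 * sigma ^+ 4)%:E)%E.
Proof.
have mp t : measurable_fun setT (fun w => expR (t * Z w)) := measurable_expR_scale t.
pose f w := 24 * sigma ^+ 4 * (expR (sigma^-1 * Z w) + expR (- sigma^-1 * Z w)).
have s4 : 0 <= 24 * sigma ^+ 4 by rewrite mulr_ge0// exprn_ge0// ltW.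
apply: (@le_trans _ _ (\int[P]_w (f w)%:E)%E).
  apply: ge0_le_expectation.
  - exact: measurable_funX.
  - apply: measurable_funM => //; exact: measurable_funD.
  - by move=> w; rewrite (exprM _ 2 2) sqr_ge0.
  - move=> w; have := pow4_le_expR (sigma^-1 * Z w).
    rewrite exprMn -(@ler_pM2l _ (sigma ^+ 4)) ?exprn_gt0// mulrA exprVn divff ?mul1r.
      by rewrite /f mulNr mulrA (mulrC 24).
    by rewrite gt_eqF// exprn_gt0.
rewrite ge0_expectationZ//; last exact: measurable_funD.
rewrite ge0_expectationD//.
have e (t : R) : t ^+ 2 = sigma^-2 -> (\int[P]_w (expR (t * Z w))%:E <= 2%:E)%E.
  move=> tE; apply: le_trans (subgaussian_expR t) _.
  by rewrite tE mulfV ?mul1r ?lee_fin ?expR_half_le2// gt_eqF// exprn_gt0.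
have := leeD (e sigma^-1 (exprVn _ _)) (e (- sigma^-1) _).
rewrite sqrrN exprVn => /(_ erefl) h.
apply: (@le_trans _ _ ((24 * sigma ^+ 4)%:E * (2%:E + 2%:E))%E).
  by rewrite lee_pmul2l// lte_fin mulr_gt0// exprn_gt0.
by rewrite -EFinD -EFinM lee_fin; lra.
Qed.

(** The sum over [k] of [2 * expR (5 / 4) / 2 ^+ k], one term for each grid point of
    [expR_sqr_le_grid]. *)
Definition exp_square_bound : R := 4 * expR (5 / 4).

Lemma subgaussian_exp_square :
  (\int[P]_w (expR (Z w ^+ 2 / (8 * sigma ^+ 2)))%:E <= exp_square_bound%:E)%E.
Proof.
have mp t : measurable_fun setT (fun w => expR (t * Z w)) := measurable_expR_scale t.
pose u k (w : Omega) : R := expR (5 / 4) / 2 ^+ k * expR (- (k%:R ^+ 2 / 2)) *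
  (expR (k%:R / sigma * Z w) + expR (- (k%:R / sigma) * Z w)).
have c0 k : 0 <= expR (5 / 4) / 2 ^+ k * expR (- (k%:R ^+ 2 / 2)) :> R.
  by rewrite mulr_ge0 ?divr_ge0 ?expR_ge0 ?exprn_ge0.
have u0 k w : 0 <= u k w by rewrite mulr_ge0// addr_ge0// expR_ge0.
have mu k : measurable_fun setT (u k).
  by apply: measurable_funM => //; exact: measurable_funD.
have intu k : (\int[P]_w (u k w)%:E <= (2 * expR (5 / 4) / 2 ^+ k)%:E)%E.
  rewrite ge0_expectationZ//; last exact: measurable_funD.
  rewrite ge0_expectationD//.
  have e (t : R) : t ^+ 2 = (k%:R / sigma) ^+ 2 ->
      (\int[P]_w (expR (t * Z w))%:E <= (expR (k%:R ^+ 2 / 2))%:E)%E.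
    move=> tE; apply: le_trans (subgaussian_expR t) _.
    rewrite tE exprMn mulrCA exprVn divff ?mulr1// gt_eqF// exprn_gt0//.
  have := leeD (e _ erefl) (e (- (k%:R / sigma)) (sqrrN _)).
  rewrite -EFinD => h.
  apply: (le_trans (lee_wpmul2l _ h)); first by rewrite lee_fin.
  rewrite -EFinM lee_fin expRN le_eqVlt; apply/orP; left; apply/eqP.
  by field; rewrite expf_neq0//= gt_eqF// expR_gt0.
apply: (@le_trans _ _ (\int[P]_w \sum_(k <oo) (u k w)%:E)%E).
  apply: ge0_le_integral => //.
  - apply/measurable_EFinP; apply: measurableT_comp => //.
    by apply: measurable_funM => //; exact: measurable_funX.
  - by apply: ge0_emeasurable_sum => [k w _|k _]; [rewrite lee_fin|exact/measurable_EFinP].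
  - move=> w _; have [k hk] := expR_sqr_le_grid (Z w / sigma).
    apply: (@le_trans _ _ (u k w)%:E).
      rewrite lee_fin /u mulNr.
      have -> : Z w ^+ 2 / (8 * sigma ^+ 2) = (Z w / sigma) ^+ 2 / 8.
        by field; rewrite gt_eqF.
      by rewrite (_ : k%:R / sigma * Z w = k%:R * (Z w / sigma))//; ring.
    apply: le_trans (nneseries_lim_ge k.+1 _); last first.
      by move=> j _ _; rewrite lee_fin.
    rewrite big_nat_recr//= leeDr//; apply: sume_ge0 => j _.
    by rewrite lee_fin.
rewrite integral_nneseries//; last 2 first.
- by move=> k; exact/measurable_EFinP.
- by move=> k w _; rewrite lee_fin.
apply: lime_le.
  apply: is_cvg_nneseries => k _ _; apply: integral_ge0 => w _.
  by rewrite lee_fin.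
apply: nearW => m; apply: (@le_trans _ _ (\sum_(0 <= k < m) (2 * expR (5 / 4) / 2 ^+ k)%:E)%E).
  exact: lee_sum.
rewrite sumEFin lee_fin -mulr_sumr /exp_square_bound.
have -> : \sum_(0 <= k < m) (2 ^+ k)^-1 = 2 - 2 / 2 ^+ m :> R.
  elim: m => [|m IH]; first by rewrite big_nil expr0 divr1 subrr.
  rewrite big_nat_recr//= IH exprS; field.
  by rewrite expf_neq0.
have e54 : 0 <= expR (5 / 4) :> R := expR_ge0 _.
have h : 0 <= 2 / 2 ^+ m :> R by rewrite divr_ge0// exprn_ge0.
have := mulr_ge0 e54 h; lra.
Qed.

End Subgaussian.

Lemma prode_le_EFin (R : realType) (I : finType) (x : I -> \bar R) (a : I -> R) :
  (forall i, 0 <= x i)%E -> (forall i, x i <= (a i)%:E)%E ->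
  (\prod_i x i <= (\prod_i a i)%:E)%E.
Proof.
move=> x0 xa.
suff : (0 <= \prod_i x i /\ \prod_i x i <= (\prod_i a i)%:E)%E by case.
elim/big_rec2: _ => [|i b y _ [y0 yb]]; first by rewrite lee_fin ler01.
by split; [rewrite mule_ge0|rewrite EFinM lee_pmul].
Qed.

(** * Chernoff bounds for independent variables *)

Section Tails.
Context {R : realType} {d : measure_display} {Omega : measurableType d}.
Context (P : probability Omega R) (n : nat) (Z : 'I_n -> Omega -> R).
Hypotheses (mZ : forall i, measurable_fun setT (Z i)) (indep : independent_reals P Z).

Lemma expectation_prod_le (f : 'I_n -> R -> R) (a : 'I_n -> R) :
  (forall i, measurable_fun setT (f i)) -> (forall i t, 0 <= f i t) ->
  (forall i, \int[P]_w (f i (Z i w))%:E <= (a i)%:E)%E ->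
  (\int[P]_w (\prod_i f i (Z i w))%:E <= (\prod_i a i)%:E)%E.
Proof.
move=> mf f0 fa; rewrite (expectation_prod mZ indep mf f0 fa).
apply: prode_le_EFin => // i; apply: integral_ge0 => w _.
by rewrite lee_fin.
Qed.

Lemma measurable_prod_comp (f : 'I_n -> R -> R) :
  (forall i, measurable_fun setT (f i)) ->
  measurable_fun setT (fun w => \prod_i f i (Z i w)).
Proof.
by move=> mf; apply: measurable_prod => i _; apply: (measurableT_comp (mf i)).
Qed.

Lemma chernoff_prod (f : R -> R) (a b : R) (A : set Omega) :
  measurable_fun setT f -> (forall t, 0 <= f t) ->
  (forall i, \int[P]_w (f (Z i w))%:E <= a%:E)%E -> 0 < b -> measurable A ->
  (forall w, A w -> b <= \prod_i f (Z i w)) ->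
  (P A <= (a ^+ n / b)%:E)%E.
Proof.
move=> mf f0 fa b0 mA Ab.
have F0 w : 0 <= \prod_i f (Z i w) by apply: prodr_ge0.
have := markov_ge P mA (measurable_prod_comp (fun _ : 'I_n => mf)) F0 (ltW b0) Ab.
move=> /le_trans /(_ (expectation_prod_le (fun _ => mf) (fun _ => f0) fa)).
rewrite prodr_const card_ord => h.
by rewrite EFinM lee_pdivlMr// muleC.
Qed.

Lemma sum_sqr_lower_tail (m V e : R) (A : set Omega) : 0 < V -> 0 < e ->
  (forall i, m%:E <= \int[P]_w (Z i w ^+ 2)%:E)%E ->
  (forall i, \int[P]_w (Z i w ^+ 4)%:E <= V%:E)%E -> measurable A ->
  (forall w, A w -> \sum_i Z i w ^+ 2 <= n%:R * (m - e)) ->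
  (P A <= (expR (- (n%:R * (e ^+ 2 / (4 * V)))))%:E)%E.
Proof.
(* This [t] minimizes the exponent [t ^+ 2 * V - t * e] per variable, with minimum
   [- e ^+ 2 / (4 * V)]. *)
move=> V0 e0 Zm ZV mA Ae; pose t := e / (2 * V).
have t0 : 0 < t by rewrite divr_gt0// mulr_gt0.
have mX k : measurable_fun setT (fun s : R => s ^+ k).
  exact: measurable_funX.
have mXZ k i : measurable_fun setT (fun w => Z i w ^+ k) by exact: measurable_funX.
have me : measurable_fun setT (fun s : R => expR (- t * s ^+ 2)).
  by apply: measurableT_comp => //; exact: measurable_funM.
have meZ i : measurable_fun setT (fun w => expR (- t * Z i w ^+ 2)).
  by apply: (measurableT_comp me).
have Z20 i w : 0 <= Z i w ^+ 2 by rewrite sqr_ge0.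
have Z40 i w : 0 <= Z i w ^+ 4 by rewrite (exprM _ 2 2) sqr_ge0.
have bound i : (\int[P]_w (expR (- t * Z i w ^+ 2))%:E <=
    (expR (- (t * m) + t ^+ 2 * V))%:E)%E.
  have h1 : (\int[P]_w (expR (- t * Z i w ^+ 2) + t * Z i w ^+ 2)%:E <=
      \int[P]_w (1 + t ^+ 2 * Z i w ^+ 4)%:E)%E.
    apply: ge0_le_expectation.
    - by apply: measurable_funD => //; exact: measurable_funM.
    - by apply: measurable_funD => //; exact: measurable_funM.
    - by move=> w; rewrite addr_ge0 ?expR_ge0// mulr_ge0// ltW.
    - move=> w; have := expRN_le (mulr_ge0 (ltW t0) (Z20 i w)).
      by rewrite mulNr exprMn -exprM; lra.
  rewrite !ge0_expectationD ?ge0_expectationZ ?sqr_ge0 ?(ltW t0)// in h1;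
    try (by move=> w; rewrite mulr_ge0 ?sqr_ge0// ltW);
    try exact: measurable_funM.
  rewrite expectation_const in h1.
  have h2 : (\int[P]_w (expR (- t * Z i w ^+ 2))%:E + (t * m)%:E <= (1 + t ^+ 2 * V)%:E)%E.
    apply: (@le_trans _ _ (1%:E + (t ^+ 2)%:E * \int[P]_w (Z i w ^+ 4)%:E)%E).
      apply: le_trans h1; rewrite leeD2l// EFinM lee_pmul2l//.
    by rewrite EFinD leeD2l// (EFinM (t ^+ 2)) lee_wpmul2l// lee_fin sqr_ge0.
  have h3 : (\int[P]_w (expR (- t * Z i w ^+ 2))%:E <= (1 + t ^+ 2 * V - t * m)%:E)%E.
    by rewrite EFinB leeBrDr.
  apply: (le_trans h3); rewrite lee_fin; apply: le_trans (expR_ge1Dx _); lra.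
have := @chernoff_prod (fun s => expR (- t * s ^+ 2)) _
  (expR (- t * (n%:R * (m - e)))) A me (fun _ => expR_ge0 _) bound (expR_gt0 _) mA.
have hA w : A w -> expR (- t * (n%:R * (m - e))) <= \prod_i expR (- t * Z i w ^+ 2).
  move=> /Ae h; rewrite -expR_sum ler_expR -mulr_sumr ler_wnM2l// oppr_le0 ltW//.
move=> /(_ hA) /le_trans; apply; rewrite lee_fin.
rewrite -expRM_natl -expRN -expRD ler_expR /t le_eqVlt; apply/orP; left; apply/eqP.
by field; rewrite gt_eqF.
Qed.

(** The threshold [ln K + 1] per variable is chosen so that the Chernoff quotient
    [K ^+ n / expR (n * (ln K + 1))] is exactly [expR (- n)]. *)
Lemma sum_sqr_upper_tail (sigma : R) (A : set Omega) : 0 < sigma ->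
  (forall i, zero_mean_subgaussian P sigma (Z i)) -> measurable A ->
  (forall w, A w ->
    n%:R * (8 * sigma ^+ 2 * (ln (exp_square_bound (R := R)) + 1)) <= \sum_i Z i w ^+ 2) ->
  (P A <= (expR (- n%:R))%:E)%E.
Proof.
move=> s0 sg mA AC; set K := exp_square_bound in AC.
have K0 : 0 < K by rewrite mulr_gt0// expR_gt0.
have me : measurable_fun setT (fun s : R => expR (s ^+ 2 / (8 * sigma ^+ 2))).
  by apply: measurableT_comp => //; apply: measurable_funM => //; exact: measurable_funX.
have := @chernoff_prod (fun s => expR (s ^+ 2 / (8 * sigma ^+ 2))) K
  (expR (n%:R * (ln K + 1))) A me (fun _ => expR_ge0 _)
  (fun i => subgaussian_exp_square s0 (mZ i) (sg i)) (expR_gt0 _) mA.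
have hA w : A w -> expR (n%:R * (ln K + 1)) <= \prod_i expR (Z i w ^+ 2 / (8 * sigma ^+ 2)).
  move=> /AC h; rewrite -expR_sum ler_expR -mulr_suml ler_pdivlMr ?mulr_gt0 ?exprn_gt0//.
  by apply: le_trans h; rewrite le_eqVlt; apply/orP; left; apply/eqP; ring.
move=> /(_ hA) /le_trans; apply; rewrite lee_fin.
rewrite expRM_natl -expr_div_n expRD lnK ?posrE// invfM mulrA divff ?gt_eqF// mul1r.
by rewrite -expRN -expRM_natl mulrN1.
Qed.

Lemma linear_form_mgf (sigma : R) (a : 'I_n -> R) : 0 < sigma ->
  (forall i, zero_mean_subgaussian P sigma (Z i)) ->
  (\int[P]_w (expR (\sum_i a i * Z i w))%:E <=
   (expR (sigma ^+ 2 * (\sum_i a i ^+ 2) / 2))%:E)%E.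
Proof.
move=> s0 sg; under eq_integral do rewrite expR_sum.
rewrite mulr_sumr mulr_suml expR_sum.
apply: (@expectation_prod_le (fun i s => expR (a i * s))
  (fun i => expR (sigma ^+ 2 * a i ^+ 2 / 2))).
- by move=> i; apply: measurableT_comp => //; exact: measurable_funM.
- by move=> i t; exact: expR_ge0.
- by move=> i; exact: subgaussian_expR (sg i) _.
Qed.

End Tails.

(** Links [borel], generated by open sets, with the measurable sets of the reals: open intervals
    generate the latter, and their preimages are open. *)
Lemma borel_preimage (R : realType) (T : ptopologicalType) (f : T -> R)
    (B : set R) : continuous f -> measurable B -> borel (f @^-1` B).
Proof.
move=> fc mB.
have mf : measurable_fun setT (f : g_sigma_algebraType [set U : set T | open U] -> R).
  apply: (measurability _ (RGenOpens.measurableE R)).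
  move=> _ [_ [a [b ->] <-]]; rewrite setTI.
  apply: sub_sigma_algebra => /=; move/continuousP : fc; apply.
  exact: interval_open.
rewrite /borel; have := mf measurableT B mB; rewrite setTI.
exact.
Qed.

Lemma coordinate_borel (R : realType) m n i j (B : set R) : measurable B ->
  borel ((fun M : 'M[R]_(m, n) => M i j) @^-1` B).
Proof. by move=> mB; apply: borel_preimage => //; exact: coord_continuous. Qed.

(** * Moments of the rows of the design *)

Section Rows.
Context {R : realType} {d : measure_display} {Omega : measurableType d}.
Context (P : probability Omega R) (n p : nat) (sigma : R).
Context (X : Omega -> 'M[R]_(n, p)).
Hypotheses (sigma0 : 0 < sigma) (subgX : subgaussian_design P sigma X).

Definition projection (u : 'cV[R]_p) (i : 'I_n) (w : Omega) : R :=
  (row i (X w) *m u) 0 0.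

Let proj_continuous (u : 'cV[R]_p) : continuous (fun r : 'rV[R]_p => (r *m u) 0 0).
Proof.
rewrite (_ : (fun _ => _) = fun r : 'rV[R]_p => \sum_j r 0 j * u j 0); last first.
  by apply/funext => r; rewrite mxE.
apply: (continuous_big add_continuous) => j _ r.
apply: continuousM; [exact: coord_continuous|exact: cst_continuous].
Qed.

Lemma measurable_projection u i : measurable_fun setT (projection u i).
Proof.
case: subgX => -[rX _ _] _ _ B mB; rewrite setTI.
have := rX i _ (borel_preimage (@proj_continuous u) mB).
exact.
Qed.

Lemma independent_projections u : independent_reals P (projection u).
Proof.
case: subgX => -[_ iX _] _ B mB.
exact: (iX _ (fun i => borel_preimage (@proj_continuous u) (mB i))).
Qed.

Lemma subgaussian_projection u i : dot u u = 1 ->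
  zero_mean_subgaussian P sigma (projection u i).
Proof.
case: subgX => _ /(_ i) sg u1; apply: sg.
by rewrite -u1; apply: eq_bigr => j _; rewrite expr2.
Qed.

Lemma projection_delta i j w : projection (delta_mx j 0) i w = X w i j.
Proof. by rewrite /projection -colE !mxE. Qed.

Lemma dot_delta_self j : dot (delta_mx j 0 : 'cV[R]_p) (delta_mx j 0) = 1.
Proof. by rewrite dot_delta mxE !eqxx. Qed.

Lemma measurable_entry i j : measurable_fun setT (fun w => X w i j).
Proof.
under eq_fun do rewrite -projection_delta; exact: measurable_projection.
Qed.

Let entry_sg i j : zero_mean_subgaussian P sigma (fun w => X w i j).
Proof.
have := subgaussian_projection i (dot_delta_self j).
by congr zero_mean_subgaussian; apply/funext => w; rewrite projection_delta.
Qed.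

Lemma integrable_entry_prod i j l :
  P.-integrable setT (fun w => (X w i j * X w i l)%:E).
Proof.
have m4 j' : (\int[P]_w (X w i j' ^+ 4)%:E < +oo)%E.
  exact: le_lt_trans
    (subgaussian_fourth_moment sigma0 (measurable_entry i j') (entry_sg i j')) (ltry _).
have mX j' : measurable_fun setT (fun w => X w i j' ^+ 4).
  by apply: measurable_funX; exact: measurable_entry.
apply: (@le_integrable _ _ _ _ _ measurableT _
  (fun w => (1 + (X w i j ^+ 4 + X w i l ^+ 4))%:E)) => //.
- by apply/measurable_EFinP; apply: measurable_funM; exact: measurable_entry.
- move=> w _; rewrite lee_fin.
  have p4 (z : R) : 0 <= z ^+ 4 by rewrite (exprM _ 2 2) sqr_ge0.
  rewrite [leRHS]ger0_norm ?addr_ge0//.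
  have h1 (z : R) : z ^+ 2 <= 2^-1 + z ^+ 4 / 2.
    by have := sqr_ge0 (z ^+ 2 - 1); rewrite sqrrB -exprM; lra.
  have := h1 (X w i j); have := h1 (X w i l).
  move: (X w i j) (X w i l) (p4 (X w i j)) (p4 (X w i l)) => a b.
  have := sqr_ge0 (a - b); have := sqr_ge0 (a + b); rewrite !expr2.
  by move=> *; apply/ler_normlP; split; lra.
- apply/integrableP; split.
    by apply/measurable_EFinP; apply: measurable_funD => //; apply: measurable_funD.
  have p4 j' w : 0 <= X w i j' ^+ 4 by rewrite (exprM _ 2 2) sqr_ge0.
  under eq_integral do rewrite abse_EFin ger0_norm ?addr_ge0//.
  rewrite !ge0_expectationD//; last 2 first.
  + exact: measurable_funD.
  + by move=> w; rewrite addr_ge0.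
  by rewrite expectation_const lte_add_pinfty ?ltry// lte_add_pinfty.
Qed.

(** The zero mean removes the centering, and integrability of the product ensures that [fine] loses
    nothing. *)
Lemma covariance_entry i j l : (covariance_mx P (fun w => row i (X w)) j l)%:E =
  (\int[P]_w (X w i j * X w i l)%:E)%E.
Proof.
have E0 (j' : 'I_p) : ('E_P[fun w => (row i (X w) 0 j')%R] = 0)%E.
  case: (entry_sg i j') => + _; congr (expectation _ _ = _).
  by apply/funext => w; rewrite mxE.
rewrite mxE unlock !E0 /= unlock.
have intE : (\int[P]_w ((((fun w => row i (X w) 0 j) \- cst 0) *
    ((fun w => row i (X w) 0 l) \- cst 0))%R w)%:E = \int[P]_w (X w i j * X w i l)%:E)%E.
  apply: eq_integral => w _; congr EFin.
  transitivity ((row i (X w) 0 j - 0) * (row i (X w) 0 l - 0)) => //.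
  by rewrite !subr0 !mxE.
rewrite intE fineK//; apply: integrable_fin_num => //.
exact: integrable_entry_prod.
Qed.

Lemma covariance_mx_sym i : (covariance_mx P (fun w => row i (X w)))^T =
  covariance_mx P (fun w => row i (X w)).
Proof. by apply/matrixP => j l; rewrite !mxE covarianceC. Qed.

Lemma second_moment_projection u i :
  (\int[P]_w (projection u i w ^+ 2)%:E =
   (qform (covariance_mx P (fun w => row i (X w))) u)%:E)%E.
Proof.
pose I := ('I_p * 'I_p)%type.
have sqE w : projection u i w ^+ 2 =
    \sum_(jl : I) (u jl.1 0 * u jl.2 0) * (X w i jl.1 * X w i jl.2).
  rewrite -(pair_bigA _ (fun j l => (u j 0 * u l 0) * (X w i j * X w i l)))/=.
  rewrite /projection mxE expr2 mulr_suml; apply: eq_bigr => j _.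
  rewrite mulr_sumr; apply: eq_bigr => l _; rewrite !mxE; ring.
under eq_integral do rewrite sqE -sumEFin.
rewrite integral_sum//; last first.
  move=> jl; under eq_fun do rewrite EFinM.
  by apply: integrableZl => //; exact: integrable_entry_prod.
transitivity (\sum_(jl : I) ((u jl.1 0 * u jl.2 0) *
    covariance_mx P (fun w => row i (X w)) jl.1 jl.2)%:E)%E.
  apply: eq_bigr => jl _; under eq_integral do rewrite EFinM.
  rewrite integralZl//; last exact: integrable_entry_prod.
  by rewrite -covariance_entry -EFinM.
rewrite sumEFin -(pair_bigA _ (fun j l => (u j 0 * u l 0) *
  covariance_mx P (fun w => row i (X w)) j l))/=; congr EFin.
rewrite /qform /dot; apply: eq_bigr => j _.
rewrite [X in _ = _ * X]mxE mulr_sumr; apply: eq_bigr => l _; ring.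
Qed.

Lemma second_moment_ge kappa u i : dot u u = 1 ->
  kappa <= lambda_min (covariance_mx P (fun w => row i (X w))) ->
  (kappa%:E <= \int[P]_w (projection u i w ^+ 2)%:E)%E.
Proof.
move=> u1 kl; rewrite second_moment_projection lee_fin.
by have := lambda_min_qform u (covariance_mx_sym i) kl; rewrite u1 mulr1.
Qed.

Lemma qform_sample_cov u w : (0 < n)%N ->
  n%:R * qform (sample_cov (X w)) u = \sum_i projection u i w ^+ 2.
Proof.
move=> n0; rewrite /qform /sample_cov -scalemxAl dotZr mulrA divff ?mul1r; last first.
  by rewrite pnatr_eq0 -lt0n.
rewrite -mulmxA dot_mulmx trmxK; apply: eq_bigr => i _.
by rewrite -expr2; congr (_ ^+ 2); rewrite /projection -row_mul [RHS]mxE.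
Qed.

End Rows.

(** * Measurable matrices and the noise *)

Section MeasurableMatrix.
Context {R : realType} {d : measure_display} {T : measurableType d}.

Definition measurable_mx m n (F : T -> 'M[R]_(m, n)) : Prop :=
  forall i j, measurable_fun setT (fun t => F t i j).

Lemma measurable_inv (f : T -> R) :
  measurable_fun setT f -> measurable_fun setT (fun t => (f t)^-1).
Proof.
(* The inverse as [f / f^2], with the division done by [expR] and [ln]; the factor [f] gives 0 at
   zeros of [f], as the convention [0^-1 = 0] requires. *)
move=> mf; rewrite (_ : (fun _ => _) = fun t => f t * expR (- ln (f t ^+ 2))).
  apply: measurable_funM => //; apply: measurableT_comp => //.
  apply: measurableT_comp => //; apply: (measurableT_comp (@measurable_ln R)).
  exact: measurable_funX.
apply/funext => t; have [->|f0] := eqVneq (f t) 0; first by rewrite invr0 mul0r.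
by rewrite expRN lnK ?posrE ?exprn_even_gt0// expr2 invfM mulrA divff// mul1r.
Qed.

Lemma measurable_big_sum (I : finType) (f : I -> T -> R) :
  (forall i, measurable_fun setT (f i)) ->
  measurable_fun setT (fun t => \sum_i f i t).
Proof. by move=> mf; exact: measurable_sum. Qed.

Lemma measurable_mulmx m n q (F : T -> 'M[R]_(m, n)) (G : T -> 'M[R]_(n, q)) :
  measurable_mx F -> measurable_mx G -> measurable_mx (fun t => F t *m G t).
Proof.
move=> mF mG i j; under eq_fun do rewrite mxE.
by apply: measurable_big_sum => l; exact: measurable_funM.
Qed.

Lemma measurable_scalemx m n (a : R) (F : T -> 'M[R]_(m, n)) :
  measurable_mx F -> measurable_mx (fun t => a *: F t).
Proof.
by move=> mF i j; under eq_fun do rewrite mxE; exact: measurable_funM.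
Qed.

Lemma measurable_submx m n (F G : T -> 'M[R]_(m, n)) :
  measurable_mx F -> measurable_mx G -> measurable_mx (fun t => F t - G t).
Proof.
by move=> mF mG i j; under eq_fun do rewrite !mxE; exact: measurable_funB.
Qed.

Lemma measurable_trmx m n (F : T -> 'M[R]_(m, n)) :
  measurable_mx F -> measurable_mx (fun t => (F t)^T).
Proof. by move=> mF i j; under eq_fun do rewrite mxE; exact: mF. Qed.

Lemma measurable_det n (F : T -> 'M[R]_n) :
  measurable_mx F -> measurable_fun setT (fun t => \det (F t)).
Proof.
move=> mF; apply: measurable_big_sum => s; apply: measurable_funM => //.
by apply: measurable_prod => i _; exact: mF.
Qed.

Lemma measurable_invmx n (F : T -> 'M[R]_n) :
  measurable_mx F -> measurable_mx (fun t => invmx (F t)).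
Proof.
move=> mF i j.
(* [invmx] returns its argument on a singular matrix, and the adjugate formula holds elsewhere. *)
rewrite (_ : (fun _ => _) = fun t => if \det (F t) == 0 then F t i j else
    (\det (F t))^-1 * ((-1) ^+ (j + i) * \det (row' j (col' i (F t))))); last first.
  apply/funext => t; rewrite /invmx unitmxE unitfE; case: eqP => // _.
  by rewrite !mxE.
apply: measurable_fun_ifT.
- by apply: measurable_fun_eqr => //; exact: measurable_det.
- exact: mF.
- apply: measurable_funM; first exact/measurable_inv/measurable_det.
  apply: measurable_funM => //; apply: measurable_det => k l.
  by under eq_fun do rewrite !mxE; exact: mF.
Qed.

Lemma measurable_sample_cov n p (F : T -> 'M[R]_(n, p)) :
  measurable_mx F -> measurable_mx (fun t => sample_cov (F t)).
Proof.
move=> mF; apply: measurable_scalemx; apply: measurable_mulmx => //.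
exact: measurable_trmx.
Qed.

Lemma measurable_submx_of p (A B : {set 'I_p}) (F : T -> 'M[R]_p) :
  measurable_mx F -> measurable_mx (fun t => submx_of A B (F t)).
Proof. by move=> mF i j; under eq_fun do rewrite mxE; exact: mF. Qed.

Lemma measurable_col_set n p (A : {set 'I_p}) (F : T -> 'M[R]_(n, p)) :
  measurable_mx F -> measurable_mx (fun t => col_set A (F t)).
Proof. by move=> mF i j; under eq_fun do rewrite mxE; exact: mF. Qed.

Lemma measurable_noise_map_all n p (F : T -> 'M[R]_(n, p)) :
  measurable_mx F -> measurable_mx (fun t => noise_map_all (F t)).
Proof. by move=> mF; apply: measurable_scalemx; exact: measurable_trmx. Qed.

Lemma measurable_noise_map_in n p S (F : T -> 'M[R]_(n, p)) :
  measurable_mx F -> measurable_mx (fun t => noise_map_in S (F t)).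
Proof.
move=> mF; apply: measurable_scalemx; apply: measurable_mulmx; last exact: measurable_col_set.
by apply: measurable_invmx; apply: measurable_submx_of; exact: measurable_sample_cov.
Qed.

Lemma measurable_noise_map_out n p S (F : T -> 'M[R]_(n, p)) :
  measurable_mx F -> measurable_mx (fun t => noise_map_out S (F t)).
Proof.
move=> mF; apply: measurable_scalemx; apply: measurable_submx; first exact: measurable_col_set.
have mG := measurable_sample_cov mF.
apply: measurable_mulmx; last exact: measurable_col_set.
apply: measurable_mulmx; first exact: measurable_submx_of.
by apply: measurable_invmx; exact: measurable_submx_of.
Qed.

Lemma measurable_qform p (F : T -> 'M[R]_p) u :
  measurable_mx F -> measurable_fun setT (fun t => qform (F t) u).
Proof.
move=> mF; apply: measurable_big_sum => i; apply: measurable_funM => //.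
by apply: (measurable_mulmx mF) => k l; exact: measurable_cst.
Qed.

End MeasurableMatrix.

Section CoordinateSigmaAlgebra.
Context {R : realType} (m n : nat).

Definition coordinate_sets : set (set 'M[R]_(m, n)) :=
  [set A | exists i j B, measurable B /\ A = (fun M : 'M[R]_(m, n) => M i j) @^-1` B].

(* Unlike the Borel sigma-algebra of matrices, this one makes the
   measurability of a matrix a statement about its entries. *)
Definition coord_mx := g_sigma_algebraType coordinate_sets.

Lemma measurable_coord_mx : measurable_mx (fun M : coord_mx => M : 'M[R]_(m, n)).
Proof.
move=> i j _ B mB; rewrite setTI; apply: sub_sigma_algebra.
by exists i, j, B.
Qed.

(** This inclusion transfers the independence of [X] and [eps], stated on Borel sets, to the
    coordinate sigma-algebra. *)
Lemma coord_measurable_borel (A : set coord_mx) :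
  measurable A -> borel (A : set 'M[R]_(m, n)).
Proof.
apply: smallest_sub; first exact: smallest_sigma_algebra.
by move=> _ [i [j [B [mB ->]]]]; exact: coordinate_borel.
Qed.

Lemma measurable_to_coord_mx d (T : measurableType d) (F : T -> 'M[R]_(m, n)) :
  measurable_mx F -> measurable_fun setT (F : T -> coord_mx).
Proof.
move=> mF; apply: (@measurability _ _ T coord_mx setT F coordinate_sets) => //.
move=> _ [_ [i [j [B [mB ->]]]] <-]; exact: mF.
Qed.

End CoordinateSigmaAlgebra.

Section Fubini.
Context {R : realType} {d d1 d2 : measure_display} {Omega : measurableType d}.
Context {T1 : measurableType d1} {T2 : measurableType d2} (P : probability Omega R).
Variables (U : Omega -> T1) (V : Omega -> T2).
Hypotheses (mU : measurable_fun setT U) (mV : measurable_fun setT V).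
Hypothesis indep : forall A B, measurable A -> measurable B ->
  (P (U @^-1` A `&` V @^-1` B) = P (U @^-1` A) * P (V @^-1` B))%E.

Let mU_mixin := isMeasurableFun.Build _ _ _ _ _ mU.
Let U' : {mfun Omega >-> T1} := HB.pack U mU_mixin.
Let mV_mixin := isMeasurableFun.Build _ _ _ _ _ mV.
Let V' : {mfun Omega >-> T2} := HB.pack V mV_mixin.
Let UV w := (U w, V w).
Let mUV : measurable_fun setT UV. Proof. exact: measurable_fun_pair. Qed.
Let mUV_mixin := isMeasurableFun.Build _ _ _ _ _ mUV.
Let UV' : {mfun Omega >-> (T1 * T2)%type} := HB.pack UV mUV_mixin.

(** The joint law agrees with the product of the laws on rectangles, hence everywhere by uniqueness
    of the product measure; then Tonelli. *)
Lemma expectation_independent (F : T1 * T2 -> R) : measurable_fun setT F ->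
  (forall x, 0 <= F x) ->
  (\int[P]_w (F (U w, V w))%:E = \int[P]_w \int[P]_w' (F (U w, V w'))%:E)%E.
Proof.
move=> mF F0; have mFE : measurable_fun setT (EFin \o F) by exact/measurable_EFinP.
have FE0 x : (0 <= (EFin \o F) x)%E by rewrite lee_fin.
have lawE : (\int[distribution P UV']_x (F x)%:E =
    \int[distribution P U' \x distribution P V']_x (F x)%:E)%E.
  apply: eq_measure_integral => A mA _.
  apply/esym; apply: product_measure_unique; last exact: mA.
  by move=> B C mB mC; exact: (indep mB mC).
transitivity (\int[distribution P UV']_x (F x)%:E)%E.
  by rewrite ge0_integral_distribution.
rewrite lawE (@fubini_tonelli1 _ _ _ _ _ _ _ (EFin \o F))//.
rewrite ge0_integral_distribution//.
- apply: eq_integral => w _.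
  transitivity (\int[distribution P V']_y (F (U w, y))%:E)%E => //.
  rewrite ge0_integral_distribution//; last by move=> y; exact: FE0.
  exact: (measurableT_comp mFE (pair1_measurable _)).
- exact: (measurable_fun_fubini_tonelli_F _ mFE FE0).
- by move=> x; apply: integral_ge0.
Qed.

End Fubini.

Section NoiseTail.
Context {R : realType} {d : measure_display} {Omega : measurableType d}.
Context (P : probability Omega R) (n p : nat) (sigma_x sigma : R).
Context (X : Omega -> 'M[R]_(n, p)) (eps : Omega -> 'cV[R]_n).
Hypotheses (sigma0 : 0 < sigma).
Hypothesis mX : measurable_mx X.
Hypothesis sgeps : subgaussian_noise P sigma eps.
Hypothesis indep : independent P X eps.

Lemma measurable_noise : measurable_mx eps.
Proof.
move=> i j; rewrite (ord1 j); case: sgeps => -[reps _ _] _ _ B mB; rewrite setTI.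
apply: (reps i B); rewrite -[B]preimage_id; apply: borel_preimage mB => //.
by move=> x; exact: cvg_id.
Qed.

Lemma independent_noise : independent_reals P (fun i w => eps w i 0).
Proof.
case: sgeps => -[_ ieps _] _ B mB; apply: ieps => i.
by rewrite -[B i]preimage_id; apply: borel_preimage (mB i) => // x; exact: cvg_id.
Qed.

(* Conditionally on [X] the linear form is sub-Gaussian with variance proxy
   [sigma ^+ 2 * b]; by independence Fubini turns this into a bound for the joint law. *)
Lemma noise_tail_one_sided (a : 'M[R]_(n, p) -> 'I_n -> R) (Gd : set 'M[R]_(n, p))
    (b t : R) : 0 < b -> 0 < t ->
  (forall l, measurable_fun setT (fun M : coord_mx n p => a M l)) ->
  measurable (Gd : set (coord_mx n p)) ->
  (forall M, Gd M -> \sum_l a M l ^+ 2 <= b) ->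
  (P (X @^-1` Gd `&` [set w | (t <= \sum_l a (X w) l * eps w l 0)%R]) <=
    (expR (- (t ^+ 2 / (2 * sigma ^+ 2 * b))))%:E)%E.
Proof.
(* The Chernoff parameter minimizing [sigma ^+ 2 * r ^+ 2 * b / 2 - r * t]. *)
move=> b0 t0 ma mGd Gb; pose r := t / (sigma ^+ 2 * b).
have sb0 : 0 < sigma ^+ 2 * b by rewrite mulr_gt0// exprn_gt0.
have r0 : 0 < r by rewrite divr_gt0.
have mXc : measurable_fun setT (X : Omega -> coord_mx n p) := measurable_to_coord_mx mX.
have mec : measurable_fun setT (eps : Omega -> coord_mx n 1) :=
  measurable_to_coord_mx measurable_noise.
pose F (x : coord_mx n p * coord_mx n 1) : R :=
  \1_Gd x.1 * expR (\sum_l (r * a x.1 l) * (x.2 : 'cV[R]_n) l 0).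
have F0 x : 0 <= F x by rewrite mulr_ge0 ?expR_ge0// indicE.
have mF : measurable_fun setT F.
  apply: measurable_funM.
    exact: (measurableT_comp (measurable_indic mGd) measurable_fst).
  apply: measurableT_comp => //; apply: measurable_big_sum => l.
  apply: measurable_funM; first apply: measurable_funM => //.
    exact: (measurableT_comp (ma l) measurable_fst).
  exact: (measurableT_comp (@measurable_coord_mx R n 1 l 0) measurable_snd).
have ind A B : measurable A -> measurable B ->
    (P ((X : Omega -> coord_mx n p) @^-1` A `&` (eps : Omega -> coord_mx n 1) @^-1` B) =
     P ((X : Omega -> coord_mx n p) @^-1` A) * P ((eps : Omega -> coord_mx n 1) @^-1` B))%E.
  move=> mA mB; exact: (indep (coord_measurable_borel mA) (coord_measurable_borel mB)).
have EF : (\int[P]_w (F (X w, eps w))%:E <= (expR (sigma ^+ 2 * (r ^+ 2 * b) / 2))%:E)%E.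
  rewrite (expectation_independent mXc mec ind mF F0).
  apply: (@le_trans _ _ (\int[P]_w (expR (sigma ^+ 2 * (r ^+ 2 * b) / 2))%:E)%E); last first.
    by rewrite expectation_const.
  apply: ge0_le_integral => //.
  - by move=> w _; apply: integral_ge0 => w' _; rewrite lee_fin.
  - have mFX : measurable_fun setT (fun x : Omega * Omega => F (X x.1, eps x.2)).
      apply: (measurableT_comp mF); apply: measurable_fun_pair.
        exact: (measurableT_comp mXc measurable_fst).
      exact: (measurableT_comp mec measurable_snd).
    apply: (@measurable_fun_fubini_tonelli_F _ _ _ _ _ P
      (fun x : Omega * Omega => (F (X x.1, eps x.2))%:E)).
      exact/measurable_EFinP.
    by move=> x; rewrite lee_fin.
  - move=> w _; rewrite /F /=; have [XG|XG] := boolP (X w \in Gd); last first.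
      under eq_integral do rewrite indicE (negbTE XG) mul0r.
      by rewrite integral0 lee_fin expR_ge0.
    under eq_integral do rewrite indicE XG mul1r.
    have [_ sge] := sgeps.
    apply: le_trans (linear_form_mgf (fun i => measurable_noise i 0) independent_noise
      _ sigma0 sge) _.
    rewrite lee_fin ler_expR ler_pM2r// ler_pM2l ?exprn_gt0//.
    under eq_bigr do rewrite exprMn.
    by rewrite -mulr_sumr ler_pM2l ?exprn_gt0// Gb//; exact: set_mem.
set A := _ `&` _.
have mA : measurable A.
  apply: measurableI.
    by rewrite -[X in measurable X]setTI; exact: (mXc measurableT).
  have ms : measurable_fun setT (fun w => \sum_l a (X w) l * eps w l 0).
    apply: measurable_big_sum => l; apply: measurable_funM; last exact: measurable_noise.
    exact: (measurableT_comp (ma l) mXc).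
  have /(_ measurableT [set true]) := measurable_fun_ler (measurable_cst t) ms.
  by rewrite setTI; apply.
have mFX : measurable_fun setT (fun w => F (X w, eps w)).
  by apply: (measurableT_comp mF); apply: measurable_fun_pair.
have AF w : A w -> expR (r * t) <= F (X w, eps w).
  move=> [XG tw]; rewrite /F indicE mem_set//= mul1r ler_expR.
  under eq_bigr do rewrite -mulrA.
  by rewrite -mulr_sumr ler_pM2l.
have := markov_ge P mA mFX (fun w => F0 _) (expR_ge0 _) AF.
move=> /le_trans /(_ EF); rewrite muleC -lee_pdivlMr ?expR_gt0// => h.
apply: (le_trans h); rewrite -EFinM lee_fin -expRN -expRD ler_expR /r.
rewrite le_eqVlt; apply/orP; left; apply/eqP; field.
by rewrite !gt_eqF// exprn_gt0.
Qed.

End NoiseTail.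

(** * The favourable event *)

Section UnionBound.
Context {R : realType} {d : measure_display} {Omega : measurableType d}.
Context (P : probability Omega R).

Lemma union_bound (I : finType) (A : I -> set Omega) (a : R) (B : set Omega) :
  (forall i, measurable (A i)) -> (forall i, P (A i) <= a%:E)%E ->
  measurable B -> (forall w, B w -> exists i, A i w) ->
  (P B <= (#|I|%:R * a)%:E)%E.
Proof.
move=> mA Aa mB BA.
have bigP (r : seq I) : measurable (\big[setU/set0]_(i <- r) A i) /\
    (P (\big[setU/set0]_(i <- r) A i) <= ((size r)%:R * a)%:E)%E.
  elim: r => [|i r [mr IH]]; first by rewrite big_nil measure0 mul0r.
  rewrite big_cons; split; first exact: measurableU.
  apply: (le_trans (measureU2 _ (mA i) mr)).
  by rewrite /= -natr1 mulrDl mul1r addrC EFinD leeD.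
have [mU] := bigP (enum I); rewrite -cardT; apply: le_trans.
apply: le_measure; rewrite ?inE// => w /BA[i Aiw].
rewrite -bigcup_seq; exists i => //=.
by rewrite mem_enum.
Qed.

End UnionBound.

Section GoodDesign.
Context {R : realType} (n p s : nat) (alpha C : R).

Definition good_design : set 'M[R]_(n, p) := [set M |
  (forall f : s.-tuple (bool * 'I_p), alpha * dot (signed_sum f) (signed_sum f) <=
     qform (sample_cov M) (signed_sum f)) /\
  (forall j, sample_cov M j j <= C)].

Lemma measurable_le_set d (T : measurableType d) (f : T -> R) (a : R) :
  measurable_fun setT f -> measurable [set t | a <= f t] /\ measurable [set t | f t <= a].
Proof.
move=> mf; split.
  have /(_ measurableT [set true]) := measurable_fun_ler (measurable_cst a) mf.
  by rewrite setTI; apply.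
have /(_ measurableT [set true]) := measurable_fun_ler mf (measurable_cst a).
by rewrite setTI; apply.
Qed.

Lemma measurable_lt_set d (T : measurableType d) (f : T -> R) (a : R) :
  measurable_fun setT f -> measurable [set t | a < f t] /\ measurable [set t | f t < a].
Proof.
move=> mf; split.
  have /(_ measurableT [set true]) := measurable_fun_ltr (measurable_cst a) mf.
  by rewrite setTI; apply.
have /(_ measurableT [set true]) := measurable_fun_ltr mf (measurable_cst a).
by rewrite setTI; apply.
Qed.

Lemma measurable_good_design : measurable (good_design : set (coord_mx n p)).
Proof.
have mG := measurable_sample_cov (@measurable_coord_mx R n p).
pose A1 := \bigcap_(f in [set: s.-tuple (bool * 'I_p)])
  [set M : coord_mx n p | alpha * dot (signed_sum f) (signed_sum f) <=
     qform (sample_cov M) (signed_sum f)].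
pose A2 := \bigcap_(j in [set: 'I_p]) [set M : coord_mx n p | sample_cov M j j <= C].
rewrite (_ : good_design = A1 `&` A2); last first.
  by apply/seteqP; split => [M [H1 H2]|M [H1 H2]]; split => [f|j];
    [move=> _; exact: H1|move=> _; exact: H2|exact: H1|exact: H2].
apply: measurableI.
  apply: fin_bigcap_measurable => [|f _]; first exact: finite_finset.
  by have [] := measurable_le_set (alpha * dot (signed_sum f) (signed_sum f))
    (measurable_qform (signed_sum f) mG).
apply: fin_bigcap_measurable => [|j _]; first exact: finite_finset.
by have [] := measurable_le_set C (mG j j).
Qed.

Lemma good_design_rsc M : 0 <= alpha -> 0 <= C -> (1 < s)%N -> good_design M ->
  rsc alpha (C / (s%:R - 1)) (sample_cov M).
Proof.
move=> a0 C0 s1 [H1 H2]; apply: maurey_rsc => //; first exact: sample_cov_sym.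
by move=> f /eqP fs; exact: (H1 (Tuple fs)).
Qed.

End GoodDesign.

Section GoodDesignProbability.
Context {R : realType} {d : measure_display} {Omega : measurableType d}.
Context (P : probability Omega R) (n p s : nat) (sigma kappa e : R).
Context (X : Omega -> 'M[R]_(n, p)).
Hypotheses (sigma0 : 0 < sigma) (subgX : subgaussian_design P sigma X).
Hypothesis cov_ge : forall i, kappa <= lambda_min (covariance_mx P (fun w => row i (X w))).
Hypotheses (e0 : 0 < e) (n0 : (0 < n)%N).
(** The threshold of [sum_sqr_upper_tail]; [ct] below is the exponent of [sum_sqr_lower_tail] with
    the fourth moment bound [96 * sigma ^+ 4]. *)
Let C : R := 8 * sigma ^+ 2 * (ln (exp_square_bound (R := R)) + 1).
Let ct : R := e ^+ 2 / (4 * (96 * sigma ^+ 4)).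

Let mX := measurable_entry subgX.

Let small_form (f : s.-tuple (bool * 'I_p)) : set Omega :=
  [set w | qform (sample_cov (X w)) (signed_sum f) <
    (kappa - e) * dot (signed_sum f) (signed_sum f)].

Let measurable_small_form f : measurable (small_form f).
Proof.
have mq := measurable_qform (signed_sum f) (measurable_sample_cov mX).
by have [] := measurable_lt_set ((kappa - e) * dot (signed_sum f) (signed_sum f)) mq.
Qed.

Let small_form_prob f : (P (small_form f) <= (expR (- (n%:R * ct)))%:E)%E.
Proof.
set u : 'cV[R]_p := signed_sum f; have nR : 0 < n%:R :> R by rewrite ltr0n.
(* Opposite signs may cancel to the zero vector, which cannot be normalized; the strict inequality
   in [small_form] makes its event empty. *)
have [u0|u0] := leP (dot u u) 0.
  have -> : small_form f = set0.
    apply/seteqP; split => // w; rewrite /small_form/= -/u (dot_eq0 u0) /qform mulmx0.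
    by rewrite /dot !big1 ?mulr0 ?ltxx// => j _; rewrite mxE mulr0.
  by rewrite measure0 lee_fin expR_ge0.
pose v := (Num.sqrt (dot u u))^-1 *: u.
have v1 : dot v v = 1.
  rewrite dotZl dotZr mulrA -invfM -expr2 sqr_sqrtr ?dot_ge0// mulVf// gt_eqF//.
apply: (@sum_sqr_lower_tail _ _ _ P n (projection X v) _ _ kappa (96 * sigma ^+ 4) e) => //.
- exact: measurable_projection subgX v.
- exact: independent_projections subgX v.
- by rewrite mulr_gt0// exprn_gt0.
- by move=> i; exact: (second_moment_ge sigma0 subgX v1 (cov_ge i)).
- move=> i; apply: subgaussian_fourth_moment => //.
    exact: measurable_projection subgX v i.
  by apply: subgaussian_projection.
move=> w; rewrite /small_form/= -/u => h; rewrite -(qform_sample_cov _ _ _ n0) ler_pM2l//.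
rewrite qformZ exprVn sqr_sqrtr ?dot_ge0// mulrC ler_pdivrMr// ltW//.
Qed.

Let large_column (j : 'I_p) : set Omega := [set w | C <= sample_cov (X w) j j].

Let measurable_large_column j : measurable (large_column j).
Proof. by have [] := measurable_le_set C (measurable_sample_cov mX j j). Qed.

Let large_column_prob j : (P (large_column j) <= (expR (- n%:R))%:E)%E.
Proof.
have d1 := @dot_delta_self R p j.
apply: (@sum_sqr_upper_tail _ _ _ P n (projection X (delta_mx j 0)) _ _ sigma) => //.
- exact: measurable_projection subgX _.
- exact: independent_projections subgX _.
- by move=> i; apply: subgaussian_projection.
move=> w /=; rewrite /large_column/= => h.
by rewrite -(qform_sample_cov _ _ _ n0) qform_delta ler_pM2l ?ltr0n.
Qed.

Lemma good_design_prob :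
  (P (~` (X @^-1` good_design s (kappa - e) C)) <=
   (((2 * p) ^ s)%:R * expR (- (n%:R * ct)) + p%:R * expR (- n%:R))%:E)%E.
Proof.
have mXc := measurable_to_coord_mx mX.
have mG : measurable (X @^-1` good_design s (kappa - e) C).
  rewrite -[X in measurable X]setTI.
  exact: (mXc measurableT _ (@measurable_good_design _ n p s (kappa - e) C)).
pose B1 := \bigcup_(f in [set: s.-tuple (bool * 'I_p)]) small_form f.
pose B2 := \bigcup_(j in [set: 'I_p]) large_column j.
have mB1 : measurable B1.
  by apply: fin_bigcup_measurable => [|f _]; [exact: finite_finset|].
have mB2 : measurable B2.
  by apply: fin_bigcup_measurable => [|f _]; [exact: finite_finset|].
apply: (@le_trans _ _ (P (B1 `|` B2))).
  apply: le_measure; rewrite ?inE//; [exact: measurableC|exact: measurableU|].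
  move=> w /= nG; apply: contrapT => nB; apply: nG; split => [f|j].
    rewrite leNgt; apply/negP => h; apply: nB; left; by exists f.
  rewrite leNgt; apply/negP => h; apply: nB; right; exists j => //.
  exact: ltW.
apply: (le_trans (measureU2 _ mB1 mB2)); rewrite EFinD; apply: leeD.
  apply: le_trans (union_bound measurable_small_form small_form_prob mB1 _) _.
    by move=> w [f _ fw]; exists f.
  by rewrite card_tuple card_prod card_bool card_ord.
apply: le_trans (union_bound measurable_large_column large_column_prob mB2 _) _.
  by move=> w [f _ fw]; exists f.
by rewrite card_ord.
Qed.

End GoodDesignProbability.

Section NoiseEvents.
Context {R : realType} {d : measure_display} {Omega : measurableType d}.
Context (P : probability Omega R) (n p m : nat) (sigma : R).
Context (X : Omega -> 'M[R]_(n, p)) (eps : Omega -> 'cV[R]_n).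
Hypotheses (sigma0 : 0 < sigma) (mX : measurable_mx X).
Hypothesis sgeps : subgaussian_noise P sigma eps.
Hypothesis indep : independent P X eps.
Context (L : 'M[R]_(n, p) -> 'M[R]_(m, n)) (Gd : set 'M[R]_(n, p)) (b t : R).
Hypotheses (b0 : 0 < b) (t0 : 0 < t).
Hypothesis mL : measurable_mx (fun M : coord_mx n p => L M).
Hypothesis mGd : measurable (Gd : set (coord_mx n p)).
Hypothesis Lb : forall M i, Gd M -> row_energy (L M) i <= b.

(** Restricted to the designs in [Gd], because the row energies are bounded only there; the
    complement is a bad event of its own. *)
Definition large_noise : set Omega := X @^-1` Gd `&`
  [set w | exists i, t < `|(L (X w) *m eps w) i 0|].

Let signed_map (x : 'I_m * bool) (M : 'M[R]_(n, p)) l : R := (-1) ^+ x.2 * L M x.1 l.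

Let mXc : measurable_fun setT (X : Omega -> coord_mx n p) := measurable_to_coord_mx mX.

Let mXG : measurable (X @^-1` Gd).
Proof. by rewrite -[X in measurable X]setTI; exact: (mXc measurableT). Qed.

Let mN i : measurable_fun setT (fun w => (L (X w) *m eps w) i 0).
Proof.
apply: measurable_mulmx; last exact: measurable_noise sgeps.
by move=> k l; exact: (measurableT_comp (mL k l) mXc).
Qed.

Lemma measurable_large_noise : measurable large_noise.
Proof.
apply: measurableI; first exact: mXG.
rewrite (_ : mkset _ = \bigcup_(i in [set: 'I_m]) [set w | t < `|(L (X w) *m eps w) i 0|]).
  apply: fin_bigcup_measurable => [|i _]; first exact: finite_finset.
  have mn : measurable_fun setT (fun w => `|(L (X w) *m eps w) i 0|).
    by apply: measurableT_comp.
  by have [] := measurable_lt_set t mn.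
by apply/seteqP; split => w /= [i]; [exists i|move=> _; exists i].
Qed.

(** Each of the [m] rows is taken with both signs, which gives [2 * m] one-sided tails. *)
Lemma large_noise_prob :
  (P large_noise <= ((2 * m)%:R * expR (- (t ^+ 2 / (2 * sigma ^+ 2 * b))))%:E)%E.
Proof.
pose A x := X @^-1` Gd `&` [set w | t <= \sum_l signed_map x (X w) l * eps w l 0].
have ms x l : measurable_fun setT (fun M : coord_mx n p => signed_map x M l).
  by apply: measurable_funM => //; exact: mL.
have mA x : measurable (A x).
  apply: measurableI => //; apply: (measurable_le_set t _).1.
  apply: measurable_big_sum => l; apply: measurable_funM; last exact: measurable_noise sgeps _ _.
  exact: (measurableT_comp (ms x l) mXc).
have Ab x : (P (A x) <= (expR (- (t ^+ 2 / (2 * sigma ^+ 2 * b))))%:E)%E.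
  apply: (noise_tail_one_sided sigma0 mX sgeps indep) => // M GM.
  apply: le_trans (Lb x.1 GM); rewrite le_eqVlt; apply/orP; left; apply/eqP.
  by apply: eq_bigr => l _; rewrite exprMn sqrr_sign mul1r.
apply: le_trans (union_bound mA Ab measurable_large_noise _) _; last first.
  by rewrite card_prod card_bool card_ord mulnC.
move=> w [wG [i ti]]; exists (i, (L (X w) *m eps w) i 0 < 0); split => //=.
apply: ltW; apply: lt_le_trans ti _; rewrite le_eqVlt; apply/orP; left; apply/eqP.
rewrite normrEsign mxE mulr_sumr; apply: eq_bigr => l _.
by rewrite /signed_map mulrA.
Qed.

End NoiseEvents.

Section GoodEvent.
Context {R : realType}.

(* [truncn x - 1 >= x / 2] and the union bound over [(2 p)^s] signed sums. *)
Lemma sparsity_level (ct : R) (n p k : nat) : 0 < ct -> (0 < k)%N -> (1 < p)%N ->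
  (2 + 16 / ct) * k%:R * ln p%:R <= n%:R ->
  let s := Num.trunc (ct / 4 * n%:R / ln p%:R) in
  [/\ (1 < s)%N, ct / 8 * n%:R / ln p%:R <= s%:R - 1 &
    ((2 * p) ^ s)%:R * expR (- (n%:R * ct)) + p%:R * expR (- n%:R) <=
    2 * expR (- ln p%:R)].
Proof.
move=> ct0 k0 p1 nk s.
have p0 : 0 < p%:R :> R by rewrite ltr0n (ltn_trans _ p1).
have L0 : 0 < ln (p%:R : R) by rewrite ln_gt0// ltr1n.
have k1 : 1 <= k%:R :> R by rewrite ler1n.
have c160 : 0 < 16 / ct by rewrite divr_gt0.
have nL : (2 + 16 / ct) * ln p%:R <= n%:R.
  apply: le_trans nk; rewrite mulrAC ler_peMr// mulr_ge0 ?(ltW L0)//; lra.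
have n2L : 2 * ln p%:R <= n%:R :> R.
  by apply: le_trans nL; rewrite ler_pM2r//; lra.
have n16 : 16 * ln p%:R <= n%:R * ct :> R.
  rewrite -ler_pdivrMr//; apply: le_trans nL; rewrite mulrAC ler_pM2r//; lra.
pose x := ct / 4 * n%:R / ln p%:R.
have x4 : 4 <= x by rewrite /x ler_pdivlMr//; lra.
have x0 : 0 <= x by lra.
have /andP[sx xs] : s%:R <= x < s.+1%:R := truncn_itv x0.
have xE : ct / 8 * n%:R / ln p%:R = x / 2 by rewrite /x; field; rewrite gt_eqF.
rewrite -natr1 in xs.
split.
- rewrite -(@ltr_nat R); lra.
- rewrite xE; lra.
have pE : p%:R = expR (ln p%:R) :> R by rewrite lnK ?posrE.
(* Since [2 <= p], the number of signed sums is at most [p ^ (2 s)], and [s] is at most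
   [ct / 4 * n / ln p]: half of the exponent [n * ct] survives the union bound. *)
have h1 : ((2 * p) ^ s)%:R <= expR (ct / 2 * n%:R) :> R.
  apply: (@le_trans _ _ (expR (ln p%:R * 2) ^+ s)).
    rewrite natrX lerXn2r ?nnegrE ?expR_ge0//.
    rewrite mulrC expRM_natl -pE expr2 natrM ler_pM2r// ler_nat//.
  rewrite -expRM_natl ler_expR.
  have -> : ct / 2 * n%:R = x * (ln p%:R * 2) by rewrite /x; field; rewrite gt_eqF.
  by rewrite ler_pM2r// mulr_gt0.
have h2 : ((2 * p) ^ s)%:R * expR (- (n%:R * ct)) <= expR (- ln (p%:R : R)).
  apply: (le_trans (ler_wpM2r (expR_ge0 _) h1)).
  by rewrite -expRD ler_expR; move: n16 L0; clear; lra.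
have h3 : p%:R * expR (- n%:R) <= expR (- ln (p%:R : R)).
  by rewrite {1}pE -expRD ler_expR; move: n2L; clear; lra.
by apply: le_trans (lerD h2 h3) _; move: (expR _); clear => E; lra.
Qed.

(** [rate2] stands for the squared threshold. The assumed size makes the exponent at least
    [2 * ln p], one [ln p] of which pays for the union over at most [p] rows. *)
Lemma noise_level (c sigma b rate2 : R) (m p : nat) : 0 < sigma -> 0 < b -> (0 < p)%N ->
  (m <= p)%N -> 4 * sigma ^+ 2 * b * ln p%:R <= rate2 ->
  (2 * m)%:R * expR (- (rate2 / (2 * sigma ^+ 2 * b))) <= 2 * expR (- ln p%:R).
Proof.
move=> s0 b0 p0 mp h.
have d0 : 0 < 2 * sigma ^+ 2 * b by rewrite !mulr_gt0// exprn_gt0.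
apply: (@le_trans _ _ ((2 * p)%:R * expR (- (2 * ln p%:R)))).
  apply: ler_pM; rewrite ?expR_ge0// ?ler_nat ?leq_mul2l// ler_expR lerN2.
  by rewrite ler_pdivlMr//; lra.
have pR : 0 < p%:R :> R by rewrite ltr0n.
rewrite natrM -mulrA ler_pM2l// -[X in X * _]lnK ?posrE// -expRD ler_expR; lra.
Qed.

(** The constants are fixed before the probability space and the dimensions, hence are uniform in
    them. The factor 8 comes from four bad events, each of probability at most
    [2 * expR (- ln p)]. *)
Lemma good_event (sigma_x sigma_eps kappa e : R) : 0 < sigma_x -> 0 < sigma_eps ->
  0 < e -> 0 < kappa - 2 * e ->
  exists c0 tau c3 c4 : R, [/\ 0 < c0, 0 < tau, 0 < c3 & 0 < c4] /\
  forall (d : measure_display) (Omega : measurableType d)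
    (P : probability Omega R) (n p k : nat)
    (X : Omega -> 'M[R]_(n, p)) (eps : Omega -> 'cV[R]_n) (S : {set 'I_p}),
  let rate := Num.sqrt (ln p%:R / n%:R) in
  (0 < k)%N -> (1 < p)%N -> (#|S| <= k)%N ->
  subgaussian_design P sigma_x X -> subgaussian_noise P sigma_eps eps ->
  independent P X eps ->
  (forall i, kappa <= lambda_min (covariance_mx P (fun w => row i (X w)))) ->
  c0 * k%:R * ln p%:R <= n%:R ->
  exists A T, [/\ measurable A, ((1 - 8 * expR (- ln p%:R))%:E <= P A)%E,
    0 <= T, T <= tau * rate ^+ 2 & 2 * k%:R * T <= e] /\
  forall w, A w -> [/\ rsc (kappa - e) T (sample_cov (X w)),
    forall i, `|(noise_map_in S (X w) *m eps w) i 0| <= c3 * rate,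
    forall i, `|(noise_map_out S (X w) *m eps w) i 0| <= c4 * rate &
    forall i, `|(noise_map_all (X w) *m eps w) i 0| <= c4 * rate].
Proof.
move=> sx0 se0 e0 ke0.
pose ct : R := e ^+ 2 / (4 * (96 * sigma_x ^+ 4)).
pose C : R := 8 * sigma_x ^+ 2 * (ln (exp_square_bound (R := R)) + 1).
have ct0 : 0 < ct by rewrite divr_gt0 ?exprn_gt0// !mulr_gt0// exprn_gt0.
have K1 : 1 <= exp_square_bound :> R.
  rewrite /exp_square_bound; have := expR_ge1Dx (5 / 4 : R); lra.
have C0 : 0 < C.
  by rewrite mulr_gt0 ?mulr_gt0 ?exprn_gt0// ltr_wpDl// ln_ge0.
(* From [T = C / (s - 1)] and [s - 1 >= ct / 8 * n / ln p]. *)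
pose tau := 8 * C / ct; have tau0 : 0 < tau by rewrite divr_gt0// mulr_gt0.
pose c := kappa - 2 * e.
(* [noise_level] needs squares at least [4 * sigma_eps ^+ 2] times [c^-1] and [C];
   [(1 + x) ^+ 2 >= x] avoids square roots. *)
pose c3 := 2 * sigma_eps * (1 + c^-1); pose c4 := 2 * sigma_eps * (1 + C).
have c30 : 0 < c3 by rewrite !mulr_gt0// addr_gt0// invr_gt0.
have c40 : 0 < c4 by rewrite !mulr_gt0// addr_gt0.
(* The first two summands are for [sparsity_level], the last for [2 * k * T <= e]. *)
pose c0 := 2 + 16 / ct + 2 * tau / e.
have c00 : 0 < c0 by rewrite !addr_gt0// divr_gt0// mulr_gt0.
exists c0, tau, c3, c4; split => // d Omega P n p k X eps S rate k0 p1 Sk sgX sgE ind cov nk.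
have p0 : (0 < p)%N by apply: ltn_trans p1.
have L0 : 0 < ln (p%:R : R) by rewrite ln_gt0// ltr1n.
have kR : 0 < k%:R :> R by rewrite ltr0n.
have nR : 0 < n%:R :> R by apply: lt_le_trans nk; rewrite !mulr_gt0.
have n0 : (0 < n)%N by rewrite -(ltr0n R).
have rate2 : rate ^+ 2 = ln p%:R / n%:R by rewrite sqr_sqrtr// divr_ge0// ltW.
have rate0 : 0 < rate by rewrite sqrtr_gt0 divr_gt0.
have kL0 : 0 < k%:R * ln p%:R :> R by rewrite mulr_gt0.
have nk' : (2 + 16 / ct) * k%:R * ln p%:R <= n%:R.
  apply: le_trans nk; rewrite -(mulrA c0) -(mulrA (2 + _)) ler_pM2r// /c0 lerDl.
  rewrite divr_ge0 ?(ltW e0)//.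
  by rewrite mulr_ge0// ltW.
have [s1 s_ge fail_design] := sparsity_level ct0 k0 p1 nk'.
set s := Num.trunc _ in s1 s_ge fail_design.
pose T := C / (s%:R - 1).
have s10 : 0 < s%:R - 1 :> R by rewrite subr_gt0 ltr1n.
have T0 : 0 <= T by rewrite divr_ge0// ltW.
have Ttau : T <= tau * rate ^+ 2.
  rewrite rate2 /T ler_pdivrMr//.
  apply: (@le_trans _ _ (tau * (ln p%:R / n%:R) * (ct / 8 * n%:R / ln p%:R))).
    rewrite le_eqVlt; apply/orP; left; apply/eqP; rewrite /tau; field.
    by rewrite !gt_eqF.
  rewrite ler_wpM2l//; apply: mulr_ge0; first exact: ltW.
  by rewrite divr_ge0// ltW.
have kT : 2 * k%:R * T <= e.
  have h : 2 * k%:R * (tau * rate ^+ 2) <= e.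
    have h0 : 2 * tau / e * (k%:R * ln p%:R) <= n%:R.
      apply: le_trans nk; rewrite -(mulrA c0) ler_pM2r// /c0 lerDr.
      by rewrite addr_ge0// divr_ge0// ltW.
    rewrite rate2 -(@ler_pM2r _ (n%:R / e)) ?divr_gt0//.
    apply: le_trans (le_trans h0 _); rewrite le_eqVlt; apply/orP; left; apply/eqP; field.
      by rewrite !gt_eqF.
    by rewrite gt_eqF.
  by apply: le_trans h; rewrite ler_wpM2l// mulr_ge0.
pose Gd : set 'M[R]_(n, p) := good_design s (kappa - e) C.
have mGd : measurable (Gd : set (coord_mx n p)) := measurable_good_design _ _ _.
have mX : measurable_mx X := measurable_entry sgX.
have ke : 0 <= kappa - e by move: e0 ke0; clear; lra.
have Grsc M : Gd M -> rsc (kappa - e) T (sample_cov M).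
  exact: good_design_rsc ke (ltW C0) s1.
have Gsparse M : Gd M -> forall v : 'cV[R]_p, supp v \subset S ->
    c * dot v v <= qform (sample_cov M) v.
  move=> GM v vS; apply: le_trans (rsc_sparse T0 (Grsc M GM) Sk vS).
  rewrite ler_wpM2r ?dot_ge0// /c; move: kT (mulr_ge0 (ltW kR) T0).
  by rewrite -mulrA; move: (k%:R * T) => t; clear; lra.
have c_gt0 : 0 < c by [].
have bin0 : 0 < (n%:R * c)^-1 by rewrite invr_gt0 mulr_gt0.
have bout0 : 0 < C / n%:R by rewrite divr_gt0.
have Ein M i : Gd M -> row_energy (noise_map_in S M) i <= (n%:R * c)^-1.
  move=> GM; apply: noise_map_in_energy => //; last exact: Gsparse.
  exact: submx_of_unit c_gt0 (Gsparse M GM).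
have Eout M i : Gd M -> row_energy (noise_map_out S M) i <= C / n%:R.
  move=> GM; apply: noise_map_out_energy => //; last by case: GM.
  exact: submx_of_unit c_gt0 (Gsparse M GM).
have Eall M i : Gd M -> row_energy (noise_map_all M) i <= C / n%:R.
  by move=> GM; apply: noise_map_all_energy => //; case: GM.
have idM := @measurable_coord_mx R n p.
have t30 : 0 < c3 * rate by rewrite mulr_gt0.
have t40 : 0 < c4 * rate by rewrite mulr_gt0.
have min_ := measurable_noise_map_in (S := S) idM.
have mout_ := measurable_noise_map_out (S := S) idM.
have mall_ := measurable_noise_map_all idM.
pose N0 := ~` (X @^-1` Gd).
pose N1 := large_noise X eps (noise_map_in S) Gd (c3 * rate).
pose N2 := large_noise X eps (noise_map_out S) Gd (c4 * rate).
pose N3 := large_noise X eps (@noise_map_all R n p) Gd (c4 * rate).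
have mN0 : measurable N0.
  apply: measurableC; rewrite -[X in measurable X]setTI.
  exact: (measurable_to_coord_mx mX measurableT).
have mN1 : measurable N1 := measurable_large_noise mX sgE _ min_ mGd.
have mN2 : measurable N2 := measurable_large_noise mX sgE _ mout_ mGd.
have mN3 : measurable N3 := measurable_large_noise mX sgE _ mall_ mGd.
pose E : R := expR (- ln p%:R).
have PN0 : (P N0 <= (2 * E)%:E)%E.
  apply: le_trans (good_design_prob s sx0 sgX cov e0 n0) _.
  by rewrite lee_fin.
have Sp : (#|S| <= p)%N by rewrite -[X in (_ <= X)%N]card_ord max_card.
have Scp : (#|~: S| <= p)%N by rewrite -[X in (_ <= X)%N]card_ord max_card.
have PN1 : (P N1 <= (2 * E)%:E)%E.
  apply: le_trans (large_noise_prob se0 mX sgE ind bin0 t30 min_ mGd Ein) _.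
  rewrite lee_fin; apply: noise_level => //.
  rewrite exprMn rate2 /c3 invfM [leRHS](_ : _ =
    4 * sigma_eps ^+ 2 * (n%:R^-1 * c^-1) * ln p%:R * (c + 2 + c^-1)); last first.
    by field; rewrite !gt_eqF.
  rewrite ler_peMr ?mulr_ge0 ?invr_ge0 ?sqr_ge0 ?(ltW nR) ?(ltW L0) ?(ltW c_gt0) ?(ltW se0)//.
  have : 0 < c^-1 by rewrite invr_gt0.
  by move: c_gt0; move: (c^-1) => ci; clear; lra.
have out2 : 4 * sigma_eps ^+ 2 * (C / n%:R) * ln p%:R <= (c4 * rate) ^+ 2.
  rewrite exprMn rate2 /c4 [leRHS](_ : _ =
    4 * sigma_eps ^+ 2 * (1 + C) ^+ 2 * (ln p%:R / n%:R)); last by field; rewrite gt_eqF.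
  rewrite [leLHS](_ : _ = 4 * sigma_eps ^+ 2 * C * (ln p%:R / n%:R)); last first.
    by field; rewrite gt_eqF.
  rewrite ler_wpM2r ?divr_ge0 ?(ltW L0) ?(ltW nR)// ler_wpM2l ?mulr_ge0 ?sqr_ge0 ?(ltW se0)//.
  have -> : (1 + C) ^+ 2 = C + (1 + C + C ^+ 2) by ring.
  by rewrite lerDl addr_ge0 ?sqr_ge0// addr_ge0// ltW.
have PN2 : (P N2 <= (2 * E)%:E)%E.
  apply: le_trans (large_noise_prob se0 mX sgE ind bout0 t40 mout_ mGd Eout) _.
  by rewrite lee_fin; apply: noise_level.
have PN3 : (P N3 <= (2 * E)%:E)%E.
  apply: le_trans (large_noise_prob se0 mX sgE ind bout0 t40 mall_ mGd Eall) _.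
  by rewrite lee_fin; apply: noise_level.
pose N := N0 `|` (N1 `|` (N2 `|` N3)).
have mN : measurable N by do ?apply: measurableU.
have PN : (P N <= (8 * E)%:E)%E.
  have -> : 8 * E = 2 * E + (2 * E + (2 * E + 2 * E)) by ring.
  rewrite !EFinD.
  apply: (le_trans (measureU2 _ mN0 _)); first by do ?apply: measurableU.
  apply: leeD => //; apply: (le_trans (measureU2 _ mN1 _)); first exact: measurableU.
  apply: leeD => //; apply: (le_trans (measureU2 _ mN2 mN3)).
  exact: leeD.
exists (~` N), T; split.
  split => //; first exact: measurableC.
  by rewrite probability_setC// EFinB; apply: leeB.
move=> w /= Nw.
have wG : Gd (X w) by apply: contrapT => wG; apply: Nw; left.
split.
- exact: Grsc.
- move=> i; rewrite leNgt; apply/negP => h; apply: Nw; right; left; split => //.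
  by exists i.
- move=> i; rewrite leNgt; apply/negP => h; apply: Nw; right; right; left; split => //.
  by exists i.
- move=> i; rewrite leNgt; apply/negP => h; apply: Nw; right; right; right; split => //.
  by exists i.
Qed.

End GoodEvent.

(** The constants are to depend on the row covariance only through [kappa], a lower bound for its
    smallest eigenvalue. The conditions on the sample covariance are random, so they appear as
    premises inside the event. *)
Theorem corollary1 (R : realType) (sigma_x sigma_eps kappa mu eta : R)
  (sigma_x_gt0 : 0 < sigma_x) (sigma_eps_gt0 : 0 < sigma_eps)
  (mu_ge0 : 0 <= mu) (mu_lt_kappa : mu < kappa) (eta_lt1 : eta < 1) :
  exists c0 c1 c2 c3 cl cu : R,
  [/\ 0 < c0, 0 < c1, 0 < c2 & 0 < c3] /\ 0 < cl /\ 0 < cu /\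
  forall (d : measure_display) (Omega : measurableType d)
    (P : probability Omega R) (n p k : nat)
    (X : Omega -> 'M[R]_(n, p)) (eps : Omega -> 'cV[R]_n)
    (bstar : 'cV[R]_p) (lam Rad cinf : R),
  let S := supp bstar in
  let y := fun w => X w *m bstar + eps w in
  let hatG := fun w => sample_cov (X w) in
  let prob := 1 - c1 * expR (- (c2 * Num.min k%:R (ln p%:R))) in
  let rate := Num.sqrt (ln p%:R / n%:R) in
  (#|S| <= k)%N ->
  subgaussian_design P sigma_x X ->
  subgaussian_noise P sigma_eps eps ->
  independent P X eps ->
  (forall i, kappa <= lambda_min (covariance_mx P (fun w => row i (X w)))) ->
  c0 * k%:R * ln p%:R <= n%:R ->
  0 < Rad ->
  l1norm bstar <= Rad / 2 ->
  cl * rate <= lam -> lam <= cu / Rad ->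
  (forall rho : R -> R, amenable mu lam rho ->
    with_probability_at_least P prob [set w |
      inverse_bounded S cinf (hatG w) -> incoherent S eta (hatG w) ->
      exists bhat : 'cV[R]_p,
        [/\ unique (stationary (X w) (y w) rho Rad) bhat,
            global_optimum (X w) (y w) rho Rad bhat,
            supp bhat \subset S &
            `|bhat - bstar| <= c3 * rate + cinf * lam]])
  /\
  (forall (gam : R) (rho : R -> R), amenable_gamma mu gam lam rho ->
    (forall j, j \in S -> lam * (gam + cinf) + c3 * rate <= `|bstar j 0|) ->
    with_probability_at_least P prob [set w |
      inverse_bounded S cinf (hatG w) ->
      exists bhat : 'cV[R]_p,
        [/\ unique (stationary (X w) (y w) rho Rad) bhat,
            unique (oracle (X w) (y w) S) bhat &
            `|bhat - bstar| <= c3 * rate]]).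
Proof.
(* One [e] is lost to the lower tail and one to [2 * k * T], which leaves curvature [kappa - 2 * e],
   the midpoint of [mu] and [kappa]. A negative [eta] is replaced by 0 so that [etap * lam] is
   nonnegative. *)
pose e := (kappa - mu) / 4; pose etap := Num.max eta 0.
have e0 : 0 < e by rewrite divr_gt0// subr_gt0.
have ke0 : 0 < kappa - 2 * e by move: mu_ge0 mu_lt_kappa; rewrite /e; clear; lra.
have etap1 : 0 < 1 - etap by rewrite subr_gt0 gt_max eta_lt1 ltr01.
have [c0 [tau [c3 [c4 [[c00 tau0 c30 c40] good]]]]] :=
  good_event sigma_x_gt0 sigma_eps_gt0 e0 ke0.
(* Half of the incoherence gap [1 - etap] is left to the noise; the other half is [2 * del], the
   dual slack relative to [lam]. *)
pose del := (1 - etap) / 4; have del0 : 0 < del by rewrite divr_gt0.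
(* One summand per demand on [lam]: it dominates [rate]; the noise on [S] is at most [lam / 28]; the
   certificate noise fits in half the gap; and [4 * Rad * T <= dl]. *)
pose cl := 1 + 28 * c4 + 2 * c4 / (1 - etap) + 4 * tau / del.
have a1 : 0 < 28 * c4 by rewrite mulr_gt0.
have a2 : 0 < 2 * c4 / (1 - etap) by rewrite divr_gt0// mulr_gt0.
have a3 : 0 < 4 * tau / del by rewrite divr_gt0// mulr_gt0.
have cl0 : 0 < cl by rewrite !addr_gt0.
exists c0, 8, 1, c3, cl, 1; do 3 split => //.
move=> d Omega P n p k X eps bs lam Rad cinf S y hatG prob rate Sk sgX sgE ind cov nk
  Rad0 bsR lam_ge lam_le.
(* For [k = 0] or [p <= 1] the required probability is at most [1 - 8], so the empty event will
   do. *)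
have [min0|] := leP (Num.min k%:R (ln p%:R) : R) 0.
  have prob0 : prob <= 0.
    rewrite /prob mul1r subr_le0.
    have : 1 <= expR (- Num.min k%:R (ln p%:R : R)) by rewrite -[leLHS]expR0 ler_expR oppr_ge0.
    by move: (expR _) => E; clear; lra.
  have trivial_event (E : set Omega) : with_probability_at_least P prob E.
    by exists set0; split; [exact: measurable0|exact: sub0set|rewrite measure0 lee_fin].
  by split.
rewrite lt_min ltr0n => /andP[k0 L0].
have p1 : (1 < p)%N by rewrite ltnNge; apply/negP => p1; move: L0; rewrite ltNge ln_le0 ?lern1.
have nR : 0 < n%:R :> R by apply: lt_le_trans nk; rewrite !mulr_gt0// ltr0n.
have rate0 : 0 < rate by rewrite sqrtr_gt0 divr_gt0.
have [A [T [[mA PA T0 Ttau kT] HA]]] := good d Omega P n p k X eps S k0 p1 Sk sgX sgE ind cov nk.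
rewrite -/rate in Ttau HA.
have prob_le : (prob%:E <= P A)%E.
  apply: le_trans PA; rewrite lee_fin lerD2l lerN2 ler_pM2l// ler_expR lerN2 mul1r.
  by rewrite ge_min lexx orbT.
have lam1 : rate <= lam.
  by apply: le_trans lam_ge; rewrite ler_peMl ?(ltW rate0)// /cl; move: a1 a2 a3; clear; lra.
have lam0 : 0 < lam by apply: lt_le_trans lam1.
have cl_part c : 0 < c -> c <= cl -> c * rate <= lam.
  by move=> c_gt0 cle; apply: le_trans lam_ge; rewrite ler_pM2r.
have b1 : 28 * c4 * rate <= lam by apply: cl_part; rewrite // /cl; move: a2 a3; clear; lra.
have b2 : 2 * c4 / (1 - etap) * rate <= lam.
  by apply: cl_part; rewrite // /cl; move: a1 a3; clear; lra.
have b3 : 4 * tau / del * rate <= lam by apply: cl_part; rewrite // /cl; move: a1 a2; clear; lra.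
pose dl := del * lam.
have dl0 : 0 <= dl by rewrite mulr_ge0 ?ltW.
(* Of the two factors [rate] in the bound on [T], one is turned into [lam] together with the
   constant [4 * tau / del], the other by [rate <= lam]; then [Rad * lam <= 1]. *)
have RadT : 4 * Rad * T <= dl.
  apply: (@le_trans _ _ (Rad * (del * (4 * tau / del * rate) * rate))).
    rewrite [leRHS](_ : _ = 4 * Rad * (tau * rate ^+ 2)); last by field; rewrite gt_eqF.
    by rewrite ler_wpM2l// mulr_ge0 ?ltW.
  apply: (@le_trans _ _ (Rad * (del * lam * lam))).
    rewrite ler_pM2l//; apply: ler_pM => //; rewrite ?ler_pM2l//.
      by rewrite !mulr_ge0 ?invr_ge0 ?ltW.
    exact: ltW.
  by rewrite mulrCA -/dl ler_piMr// mulrC -ler_pdivlMr.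
have alpha_gt : mu < kappa - e - 2 * k%:R * T.
  by move: kT mu_lt_kappa; rewrite /e; move: (2 * k%:R * T) => t; clear; lra.
have e10 : 0 <= c3 * rate by rewrite mulr_ge0// ltW.
have e2_le : c4 * rate <= (1 - etap) / 2 * lam.
  rewrite mulrAC ler_pdivlMr// mulrC -ler_pdivrMl//.
  by apply: le_trans b2; rewrite le_eqVlt; apply/orP; left; apply/eqP; field; rewrite gt_eqF.
have dl2 : 2 * dl = (1 - etap) / 2 * lam by rewrite /dl /del; field.
have etap0 : 0 <= etap * lam by rewrite mulr_ge0 ?(ltW lam0)// le_max lexx orbT.
split=> [rho am|gam rho [am gam0 flat] bs_min]; exists A; split=> // w Aw.
  move=> inv inc; have [Grsc noiseS noiseSc noise] := HA w Aw.
  have ee : eta * lam <= etap * lam by rewrite ler_pM2r// le_max lexx.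
  apply: (deterministic_incoherent mu_ge0 lam0 am Sk T0 Grsc alpha_gt dl0 RadT Rad0 bsR
    e10 inv (e2 := c4 * rate)) inc _.
  - by move=> i; rewrite -noise_map_inE.
  - by move=> i; rewrite -noise_map_outE.
  - move=> j _; rewrite -noise_map_allE (le_trans (noise j))// ler_pdivlMr//.
    by rewrite mulrC mulrA.
  - by move: e2_le dl2 ee; clear; lra.
move=> inv; have [Grsc noiseS noiseSc noise] := HA w Aw.
apply: (deterministic_oracle mu_ge0 lam0 am Sk T0 Grsc alpha_gt dl0 RadT bsR
  e10 inv (e2 := c4 * rate)) gam0 flat _ _.
- by move=> i; rewrite -noise_map_inE.
- by move=> i; rewrite -noise_map_outE.
- have cinf0 : 0 <= cinf by case: inv => _; apply: le_trans (opnorm_inf_ge0 _).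
  move=> j jS; apply: le_trans (bs_min j jS); rewrite lerD2r ler_pM2l// lerDl//.
- by move: e2_le dl2 etap0; clear; lra.
Qed.
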